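(* Let $0<\alpha<\alpha_0$, and let $B_{t,\mathrm{ren}}^{(\varepsilon)}$ ($\varepsilon>0$) and $B_{t,V}$, $t\in[0,\delta(\alpha_0-\alpha))$, be the local solutions in $\mathcal{E}_\alpha$ to the initial value problems $$\frac{\partial}{\partial t}B_{t,\mathrm{ren}}^{(\varepsilon)}=\tilde L_{\varepsilon,\mathrm{ren}}B_{t,\mathrm{ren}}^{(\varepsilon)},\quad B_{t,\mathrm{ren}}^{(\varepsilon)}|_{t=0}=B_{0,\mathrm{ren}}^{(\varepsilon)},\qquad\text{and}\qquad \frac{\partial}{\partial t}B_{t,V}=\tilde L_VB_{t,V},\quad B_{t,V}|_{t=0}=B_{0,V},$$ respectively, with $B_{0,\mathrm{ren}}^{(\varepsilon)},B_{0,V}\in\mathcal{E}_{\alpha_0}$. If $0\le\phi\in L^1\cap L^\infty$ and $\lim_{\varepsilon\to0}\|B_{0,\mathrm{ren}}^{(\varepsilon)}-B_{0,V}\|_{\alpha_0}=0$, then, for each $t\in[0,\delta(\alpha_0-\alpha))$, $$\lim_{\varepsilon\to0}\|B_{t,\mathrm{ren}}^{(\varepsilon)}-B_{t,V}\|_{\alpha}=0.$$ Moreover, if $B_{0,V}(\theta)=\exp\left(\int_{\mathbb{R}^d}dx\,\rho_0(x)\theta(x)\right)$, $\theta\in L^1$, for some function $0\le\rho_0\in L^\infty$ such that $\|\rho_0\|_{L^\infty}\le\frac1{\alpha_0}$, and $\max\{\frac1{\alpha_0},z\}<\frac1\alpha$, then, for each $t\in[0,\delta(\alpha_0-\alpha))$,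 $$B_{t,V}(\theta)=\exp\left(\int_{\mathbb{R}^d}dx\,\rho_t(x)\theta(x)\right),\quad\theta\in L^1,$$ where $0\le\rho_t\in L^\infty$ is a classical solution, with initial value $\rho_0$, to the equation $$\frac{\partial}{\partial t}\rho_t(x)=-\rho_t(x)+ze^{-(\rho_t*\phi)(x)},\quad x\in\mathbb{R}^d,$$ such that, for each $t\in[0,\delta(\alpha_0-\alpha))$, $\|\rho_t\|_{L^\infty}\le\frac1\alpha$.
   Context: $L^1:=L^1(\mathbb{R}^d,dx)$ (complex-valued functions), $L^\infty:=L^\infty(\mathbb{R}^d)$, $d\in\mathbb{N}$. A functional $B:L^1\to\mathbb{C}$ is entire on $L^1$ if it is locally bounded and for all $\theta_0,\theta\in L^1$ the map $\mathbb{C}\ni w\mapsto B(\theta_0+w\theta)$ is entire. For an entire $B$ and $\theta\in L^1$, the first variational derivative $\delta B(\theta;\cdot)\in L^\infty$ is determined by $\frac{\partial}{\partial w}B(\theta+wh)\big|_{w=0}=\int_{\mathbb{R}^d}dx\,\delta B(\theta;x)h(x)$ for all $h\in L^1$. For $\alpha>0$, $\mathcal{E}_\alpha$ is the Banach space of all entire functionals $B$ on $L^1$ with $\|B\|_\alpha:=\sup_{\theta\in L^1}\bigl(|B(\theta)|e^{-\frac1\alpha\|\theta\|_{L^1}}\bigr)<\infty$. Standing assumptions: $z>0$ is a constant, and $\phi:\mathbb{R}^d\to\mathbb{R}\cup\{+\infty\}$ is Borel measurable with $\phi(-x)=\phi(x)\in\mathbb{R}$ for all $x\neq0$, non-negative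 and integrable. For $\varepsilon>0$, $$(\tilde L_{\varepsilon,\mathrm{ren}}B)(\theta)=-\int_{\mathbb{R}^d}dx\,\theta(x)\left(\delta B(\theta;x)-zB\Bigl(\theta e^{-\varepsilon\phi(x-\cdot)}+\frac{e^{-\varepsilon\phi(x-\cdot)}-1}{\varepsilon}\Bigr)\right),$$ $$(\tilde L_VB)(\theta)=-\int_{\mathbb{R}^d}dx\,\theta(x)\Bigl(\delta B(\theta;x)-zB\bigl(\theta-\phi(x-\cdot)\bigr)\Bigr).$$ Let $M:=\alpha_0\bigl(1+z\alpha_0e^{\frac{\|\phi\|_{L^1}}{\alpha}-1}\bigr)$ and $\delta:=\frac{1}{eM}$. For any initial conditions in $\mathcal{E}_{\alpha_0}$ each of the initial value problems has a unique solution in $\mathcal{E}_\alpha$ on $[0,\delta(\alpha_0-\alpha))$; these are the local solutions in the claim. A solution in $\mathcal{E}_\alpha$ on $[0,T)$ is a function $[0,T)\to\mathcal{E}_\alpha$, continuous on $[0,T)$ and continuously differentiable on $(0,T)$ in the norm of $\mathcal{E}_\alpha$, whose image under the operator stays in $\mathcal{E}_\alpha$, satisfying the equation and the initial condition. $*$ denotes the usual convolution on $\mathbb{R}^d$. A classical solution $\rho_t$ means that, for a.a. $x\in\mathbb{R}^d$, $t\mapsto\rho_t(x)$ is continuously differentiable and satisfies the equation pointwise. *)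

(* Defs.v *)
From HB Require Import structures.
From mathcomp Require Import all_boot all_order all_algebra.
From mathcomp Require Import all_classical all_reals all_analysis.
From mathcomp Require Import measurable_realfun complex.

Set Implicit Arguments.
Unset Strict Implicit.
Unset Printing Implicit Defensive.

Import Order.TTheory GRing.Theory Num.Theory.
Import numFieldNormedType.Exports.
Import ComplexField.Normc.

Local Open Scope classical_set_scope.
Local Open Scope complex_scope.
Local Open Scope ring_scope.

(* The points of R^d; the library equips tuples with the sigma-algebra         *)
(* generated by the coordinates, that is, the Borel sets of R^d.               *)
Definition Rd (R : realType) (d : nat) := d.-tuple (measurableTypeR R).

Definition Rd0 (R : realType) (d : nat) : Rd R d := [tuple (0 : R) | i < d].
Definition Rdopp (R : realType) (d : nat) (x : Rd R d) : Rd R d :=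
  [tuple - (tnth x i : R) | i < d].
Definition Rdsub (R : realType) (d : nat) (x y : Rd R d) : Rd R d :=
  [tuple (tnth x i : R) - (tnth y i : R) | i < d].

Section lebesgue_cons.
Local Open Scope ereal_scope.
Context (R : realType) (n : nat).
Variable m : {sigma_finite_measure set (Rd R n) -> \bar R}.

Definition Rdcons (p : measurableTypeR R * Rd R n) : Rd R n.+1 :=
  [tuple of p.1 :: p.2].

Definition Rduncons (x : Rd R n.+1) : measurableTypeR R * Rd R n :=
  (tnth x ord0, [tuple of behead x]).

Lemma RdconsK : cancel Rdcons Rduncons.
Proof.
move=> [x y]; rewrite /Rduncons /Rdcons; congr pair => //.
exact/val_inj.
Qed.

Lemma measurable_Rdcons : measurable_fun setT Rdcons.
Proof. exact: measurable_cons. Qed.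

Lemma measurable_Rduncons : measurable_fun setT Rduncons.
Proof.
apply/measurable_fun_pairP; split; first exact: measurable_tnth.
exact: measurable_behead.
Qed.

Definition lebesgue_cons : set (Rd R n.+1) -> \bar R :=
  pushforward (@lebesgue_measure R \x m) Rdcons.

Let lc0 : lebesgue_cons set0 = 0.
Proof. by rewrite /lebesgue_cons /pushforward preimage_set0 measure0. Qed.

Let lc_ge0 A : 0 <= lebesgue_cons A.
Proof. exact: (measure_ge0 (@lebesgue_measure R \x m)). Qed.

Let lc_sigma_additive : semi_sigma_additive lebesgue_cons.
Proof.
move=> F mF tF mUF; rewrite /lebesgue_cons /pushforward preimage_bigcup.
apply: measure_semi_sigma_additive.
- by move=> k; rewrite -[X in measurable X]setTI; exact: measurable_Rdcons.
- apply/trivIsetP => /= i j _ _ ij; rewrite -preimage_setI.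
  by move/trivIsetP : tF => /(_ _ _ _ _ ij) ->//; rewrite preimage_set0.
- rewrite -preimage_bigcup -[X in measurable X]setTI.
  exact: measurable_Rdcons.
Qed.

HB.instance Definition _ := isMeasure.Build _ _ _
  lebesgue_cons lc0 lc_ge0 lc_sigma_additive.

Let lc_sigma_finite : sigma_finite setT lebesgue_cons.
Proof.
have /sigma_finiteP[F [TF ndF mF]] := sigma_finiteT (@lebesgue_measure R).
have /sigma_finiteP[G [TG ndG mG]] := sigma_finiteT m.
exists (fun k => Rduncons @^-1` (F k `*` G k)).
  rewrite -preimage_bigcup [X in _ @^-1` X](_ : _ = setT) ?preimage_setT//.
  apply/seteqP; split => // -[x y] _.
  have [i _ Fix] : (\bigcup_k F k) x by rewrite -TF.
  have [j _ Gjy] : (\bigcup_k G k) y by rewrite -TG.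
  exists (maxn i j) => //; split.
  - by move: x Fix; exact/subsetPset/ndF/leq_maxl.
  - by move: y Gjy; exact/subsetPset/ndG/leq_maxr.
move=> k; have [mFk Fkoo] := mF k; have [mGk Gkoo] := mG k; split.
  rewrite -[X in measurable X]setTI; apply: measurable_Rduncons => //.
  exact: measurableX.
rewrite /lebesgue_cons /pushforward -comp_preimage.
rewrite (_ : Rduncons \o Rdcons = id); last by apply/funext => p; exact: RdconsK.
by rewrite preimage_id product_measure1E// lte_mul_pinfty// ge0_fin_numE.
Qed.

HB.instance Definition _ :=
  Measure_isSigmaFinite.Build _ _ _ lebesgue_cons lc_sigma_finite.

End lebesgue_cons.

(* Lebesgue measure on R^d, as the d-fold product of the one on R; it is       *)
(* characterised by lebesgue_Rd_box below.                                     *)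
Fixpoint lebesgue_Rd (R : realType) (d : nat) :
    {sigma_finite_measure set (Rd R d) -> \bar R} :=
  match d with
  | 0 => [the {sigma_finite_measure set (Rd R 0) -> \bar R} of
           \d_([tuple] : Rd R 0)]
  | n.+1 => [the {sigma_finite_measure set (Rd R n.+1) -> \bar R} of
              lebesgue_cons (lebesgue_Rd R n)]
  end.

Lemma lebesgue_Rd_box (R : realType) (d : nat)
    (A : 'I_d -> set (measurableTypeR R)) :
  (forall i, measurable (A i)) ->
  lebesgue_Rd R d [set x | forall i, A i (tnth x i)] =
  (\prod_(i < d) lebesgue_measure (A i))%E.
Proof.
elim: d A => [|d IHd] A mA.
  rewrite big_ord0 /= diracE mem_set//= => -[].
  by [].
rewrite big_ord_recl /= /lebesgue_cons /pushforward.
rewrite (_ : _ @^-1` _ =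
    A ord0 `*` [set x | forall i, A (lift ord0 i) (tnth x i)]).
  rewrite product_measure1E//; first by rewrite -(IHd (fun i => A (lift ord0 i))).
  rewrite (_ : [set _ | _] = \bigcap_(i in [set: 'I_d])
      ((fun x : Rd R d => tnth x i) @^-1` A (lift ord0 i))).
    apply: fin_bigcap_measurable => // i _.
    by rewrite -[X in measurable X]setTI; exact: measurable_tnth.
  by apply/seteqP; split => x /= h i => [_|]; exact: h.
apply/seteqP; split => -[x y] /=.
  move=> h; split; first exact: (h ord0).
  by move=> i; have := h (lift ord0 i); rewrite tnthS.
move=> [hx hy] i; have [j ->|->] := unliftP ord0 i; last exact: hx.
by rewrite tnthS; exact: hy.
Qed.

Section functionals.
Context (R : realType) (d : nat).
Local Notation E := (Rd R d).
Local Notation C := R[i].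
Local Notation mu := (lebesgue_Rd R d).

(* [E -> C] functions stand for their a.e. classes: a functional on L^1 is a   *)
(* map [(E -> C) -> C], looked at on [L1] only and required to be compatible   *)
(* with a.e. equality (see [entire]).                                          *)

Definition Cintegral (f : E -> C) : C :=
  (\int[mu]_x complex.Re (f x)) +i* (\int[mu]_x complex.Im (f x)).

Definition L1 : set (E -> C) := [set f |
  mu.-integrable setT (fun x => (complex.Re (f x))%:E) /\
  mu.-integrable setT (fun x => (complex.Im (f x))%:E)].

Definition L1norm (f : E -> C) : R :=
  fine ('N[mu]_1[EFin \o (@normc R \o f)])%E.

Definition Linfty : set (E -> C) := [set f |
  [/\ measurable_fun setT (fun x => complex.Re (f x) : measurableTypeR R),
      measurable_fun setT (fun x => complex.Im (f x) : measurableTypeR R) &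
      ('N[mu]_+oo[EFin \o (@normc R \o f)] < +oo)%E]].

Definition line (theta h : E -> C) (w : C) : E -> C :=
  fun x => theta x + w * h x.

Definition locally_bounded (B : (E -> C) -> C) :=
  forall theta0, L1 theta0 -> exists r M : R, 0 < r /\
    forall theta, L1 theta -> L1norm (theta \- theta0) < r ->
      normc (B theta) <= M.

Definition entire (B : (E -> C) -> C) :=
  [/\ forall theta theta', L1 theta -> L1 theta' ->
        theta = theta' %[ae mu] -> B theta = B theta',
      locally_bounded B &
      forall theta0 theta, L1 theta0 -> L1 theta -> forall w : C,
        derivable (fun w : C^o => B (line theta0 theta w) : C^o) w 1].

Definition is_variational_derivative (B : (E -> C) -> C) (theta g : E -> C) :=
  Linfty g /\ forall h, L1 h ->
    is_derive (0 : C^o) 1 (fun w : C^o => B (line theta h w) : C^o)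
      (Cintegral (fun x => g x * h x)).

(* For entire B such a g exists and is unique a.e.                             *)
Definition variational_derivative (B : (E -> C) -> C) (theta : E -> C) : E -> C :=
  xget (fun=> 0) (is_variational_derivative B theta).

Definition Enorm (alpha : R) (B : (E -> C) -> C) : \bar R :=
  ereal_sup [set (normc (B theta) * expR (- (alpha^-1 * L1norm theta)))%:E |
             theta in L1].

Definition Espace (alpha : R) : set ((E -> C) -> C) :=
  [set B | entire B /\ (Enorm alpha B < +oo)%E].

Section operators.
Variables (z : R) (phi : E -> \bar R).

(* e^{-eps phi(x-y)}, equal to 0 where phi = +oo                               *)
Definition boltzmann (eps : R) (x y : E) : R :=
  fine (expeR (- (eps%:E * phi (Rdsub x y)))).

Definition Lren (eps : R) (B : (E -> C) -> C) : (E -> C) -> C := fun theta =>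
  - Cintegral (fun x => theta x * (variational_derivative B theta x -
      z%:C * B (fun y => theta y * (boltzmann eps x y)%:C +
                         ((boltzmann eps x y - 1) / eps)%:C))).

(* The set y = x, where phi(x-y) may be +oo, is negligible.                    *)
Definition LV (B : (E -> C) -> C) : (E -> C) -> C := fun theta =>
  - Cintegral (fun x => theta x * (variational_derivative B theta x -
      z%:C * B (fun y => theta y - (fine (phi (Rdsub x y)))%:C))).

Definition phinorm : R := fine ('N[mu]_1[phi])%E.

Definition Mconst (alpha alpha0 : R) : R :=
  alpha0 * (1 + z * alpha0 * expR (phinorm / alpha - 1)).

Definition deltaconst (alpha alpha0 : R) : R :=
  (expR 1 * Mconst alpha alpha0)^-1.

Definition convolution (rho : E -> R) (x : E) : R :=
  \int[mu]_y (rho y * fine (phi (Rdsub x y))).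

Definition vlasov_rhs (rho : E -> R) (x : E) : R :=
  - rho x + z * expR (- convolution rho x).

(* At t = 0 the derivative is one-sided.                                       *)
Definition classical_solution (T : R) (rho0 : E -> R) (rho : R -> E -> R) :=
  \forall x \ae mu, rho 0 x = rho0 x /\
    exists2 rho' : R -> R, {within `[0, T[, continuous rho'} &
      forall t, 0 <= t < T ->
        ((rho s x - rho t x) / (s - t) @[s --> within `[0, T[ t^'] --> rho' t) /\
        rho' t = vlasov_rhs (rho t) x.

End operators.

Definition local_solution (L : ((E -> C) -> C) -> (E -> C) -> C) (alpha T : R)
    (B0 : (E -> C) -> C) (u : R -> (E -> C) -> C) :=
  [/\ forall t, 0 <= t < T -> Espace alpha (u t) /\ Espace alpha (L (u t)),
      forall t, 0 <= t < T ->
        Enorm alpha (u s \- u t) @[s --> within `[0, T[ (nbhs t)] --> 0%E,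
      exists u' : R -> (E -> C) -> C,
        [/\ forall t, 0 < t < T -> Espace alpha (u' t),
            forall t, 0 < t < T ->
              Enorm alpha (fun theta => (u s theta - u t theta) / (s - t)%:C
                                        - u' t theta) @[s --> t^'] --> 0%E,
            forall t, 0 < t < T ->
              Enorm alpha (u' s \- u' t) @[s --> t] --> 0%E &
            forall t, 0 < t < T -> {in L1, u' t =1 L (u t)}] &
      {in L1, u 0 =1 B0}].

Definition Cexp (w : C) : C := (expR (complex.Re w) * cos (complex.Im w)) +i* (expR (complex.Re w) * sin (complex.Im w)).

Definition exp_functional (rho : E -> R) : (E -> C) -> C := fun theta =>
  Cexp (Cintegral (fun x => (rho x)%:C * theta x)).

End functionals.

(* Main.v *)
(* Both generators have the form
     (L B)(theta) = - int theta (delta B(theta; x) - z B(theta b(x,.) + c(x,.))) dx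
   with 0 <= b <= 1 and |c(x,.)|_1 <= |phi|_1, and map E_a' into E_a'' with norm at most
   M / (a' - a''): the derivative is bounded by Cauchy's estimate on discs, the other term
   by s e^{-s k} <= 1 / (e k). Ovsyannikov's method then shows that any local solution is
   the sum of its Taylor series sum_n t^n / n! L^n B_0 for t < delta (alpha_0 - alpha), with
   a geometric tail depending only on the norm of B_0. Since B is locally Lipschitz on L^1,
   L_{eps,ren} converges strongly to L_V, hence every Taylor coefficient converges, and so
   do the solutions. The same Taylor expansion gives uniqueness; as the exponential
   functional of a solution of the kinetic equation (built by Picard iteration) solves the
   evolution equation of L_V, it is B_{t,V}. *)
Require Import Defs.
From HB Require Import structures.
From mathcomp Require Import all_boot all_order all_algebra.
From mathcomp Require Import all_classical all_reals all_analysis.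
From mathcomp Require Import finmap measurable_realfun ess_sup_inf complex.
From mathcomp Require Import ring lra.

Set Implicit Arguments.
Unset Strict Implicit.
Unset Printing Implicit Defensive.

Import Order.TTheory GRing.Theory Num.Theory.
Import numFieldNormedType.Exports.
Import ComplexField.Normc.

Local Open Scope classical_set_scope.
Local Open Scope complex_scope.
Local Open Scope ring_scope.

(** * Complex differentiability and the Cauchy estimate *)

(** The generators are unbounded on each [E_alpha]: every application of [L] costs some index, so
    Gronwall's lemma cannot control a solution known to live in a single space. [ode_stability]
    bounds the error [u - psum] for a short time at the smaller index [al / 2]; once convergence at
    that time is known, the tail of the series restores the bound at index [al], so the loss does
    not accumulate and steps of one fixed length reach every [T1 < T]. The constant
    [delta = 1 / (e M)] comes from spending the index gap in [n] equal steps on [L^n] and from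
    [n^n / n! <= e^n]. Two facts hidden in the definition of the generators must be earned:
    [delta B] exists as a bounded function, by Radon-Nikodym after weighting the sigma-finite
    measure, and [x |-> B(theta b(x,.) + c(x,.))] is measurable, because the argument of [B] has
    separable range in L^1. In the kinetic part [m = max(1 / alpha0, z)] is an invariant bound:
    densities in [[0, m]] stay there, and [m < 1 / alpha] puts their exponential functionals into
    [E_alpha]. *)

Section deriv_eps.
Variable K : numFieldType.

(** Without a quotient the increment [h = 0] is harmless, so the chain rule and the Taylor estimates
    below need no case distinction. *)
Lemma is_derive_epsP (f : K^o -> K^o) (t : K^o) (l : K^o) :
  is_derive t 1 f l <->
  forall e : K, 0 < e -> exists2 r : K, 0 < r &
    forall h, `|h| < r -> `|f (t + h) - f t - l * h| <= e * `|h|.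
Proof.
split.
- move=> [df dl] e e0.
  have : (fun h : K^o => h^-1 *: (f (h *: (1:K^o) + t) - f t)) @ 0^' --> l.
    by rewrite -dl; exact: df.
  move/cvgrPdist_le => /(_ e e0); rewrite near_withinE.
  move=> /nbhs_ballP[r /= r0 H]; exists r => // h hr.
  have [->|h0] := eqVneq h 0; first by rewrite addr0 subrr mulr0 subr0 !normr0 mulr0.
  have := H h; rewrite /ball/= sub0r normrN => /(_ hr h0).
  rewrite -(ler_pM2r (x := `|h|)) ?normr_gt0// -normrM.
  rewrite -[h *: _]/(h * 1) mulr1 (addrC h) -[_ *: (_ - _)]/(_ * (_ - _)).
  by rewrite mulrBl mulrAC mulVf// mul1r distrC.
- move=> H.
  have C : (fun h : K^o => h^-1 *: (f (h *: (1:K^o) + t) - f t)) @ 0^' --> l.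
    apply/cvgrPdist_le => e e0; rewrite near_withinE.
    have [r r0 Hr] := H e e0; apply/nbhs_ballP; exists r => // h.
    rewrite /ball/= sub0r normrN => hr h0.
    rewrite -(ler_pM2r (x := `|h|)) ?normr_gt0// -normrM.
    rewrite -[h *: _]/(h * 1) mulr1 (addrC h) -[_ *: (_ - _)]/(_ * (_ - _)).
    by rewrite mulrBl mulrAC mulVf// mul1r distrC; exact: Hr.
  apply: DeriveDef; first by apply/cvg_ex; exists l.
  exact: (cvg_lim (@norm_hausdorff _ _) C).
Qed.

End deriv_eps.

Section complex_basics.
Variable R : realType.
Local Notation C := R[i].

Lemma complex_normE (x : C) : `|x| = (normc x)%:C. Proof. by []. Qed.

Lemma normc_ge0 (x : C) : 0 <= normc x.
Proof. by case: x => a b; exact: sqrtr_ge0. Qed.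

Lemma normcB (x y : C) : normc (x - y) <= normc x + normc y.
Proof. by rewrite -(normcN y) le_normcD. Qed.

Lemma normc_distC (x y : C) : normc (x - y) = normc (y - x).
Proof. by rewrite -normcN opprB. Qed.

Lemma normcR (x : R) : normc x%:C = `|x|.
Proof. by rewrite /normc /= expr0n/= addr0 sqrtr_sqr. Qed.

Lemma normc_Re (x : C) : `|complex.Re x| <= normc x.
Proof.
by case: x => a b /=; rewrite -sqrtr_sqr ler_wsqrtr// lerDl sqr_ge0.
Qed.

Lemma normc_Im (x : C) : `|complex.Im x| <= normc x.
Proof.
by case: x => a b /=; rewrite -sqrtr_sqr ler_wsqrtr// lerDr sqr_ge0.
Qed.

Lemma normc_le_ReIm (x : C) : normc x <= `|complex.Re x| + `|complex.Im x|.
Proof.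
case: x => a b /=; rewrite -[leRHS]ger0_norm ?addr_ge0// -sqrtr_sqr ler_wsqrtr//.
by rewrite sqrrD !real_normK ?num_real// lerD2r lerDl mulrn_wge0// mulr_ge0.
Qed.

Lemma normc_gt0 (x : C) : (0 < normc x) = (x != 0).
Proof.
rewrite lt_def normc_ge0 andbT; congr (~~ _).
by apply/eqP/eqP => [/eq0_normc//|->]; rewrite normc0.
Qed.

(** Complex differentiability with real tolerances and the real modulus [normc], so that all
    estimates take place in the totally ordered field [R]. *)
Definition cdiff (f : C -> C) (w l : C) := forall e : R, 0 < e ->
  exists2 r : R, 0 < r & forall h : C, normc h < r ->
    normc (f (w + h) - f w - l * h) <= e * normc h.

Lemma cdiffP (f : C -> C) (w l : C) :
  is_derive (w : C^o) 1 (f : C^o -> C^o) (l : C^o) <-> cdiff f w l.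
Proof.
split.
- move=> /is_derive_epsP H e e0.
  have [|r r0 Hr] := H e%:C; first by rewrite ltcR.
  have [re rE] : exists re : R, r = re%:C.
    by apply/complex_realP; rewrite gtr0_real.
  move: r0 Hr; rewrite rE ltcR => r0 Hr.
  exists re => // h hr; have := Hr h; rewrite !complex_normE ltcR => /(_ hr).
  by rewrite -rmorphM lecR.
- move=> H; apply/is_derive_epsP => e.
  move=> e0; have [re eE] : exists re : R, e = re%:C.
    by apply/complex_realP; rewrite gtr0_real.
  move: e0; rewrite eE ltcR => e0; have [r r0 Hr] := H re e0.
  exists r%:C; first by rewrite ltcR.
  by move=> h; rewrite !complex_normE ltcR -rmorphM lecR => /Hr.
Qed.

Lemma cdiff_unique (f : C -> C) (w l m : C) : cdiff f w l -> cdiff f w m -> l = m.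
Proof.
move=> /cdiffP[_ <-] /cdiffP[_ <-]; reflexivity.
Qed.

Lemma derivable_cdiff (f : C -> C) (w : C) :
  derivable (f : C^o -> C^o) (w : C^o) 1 <-> exists l, cdiff f w l.
Proof.
split=> [/derivableP/cdiffP H|[l /cdiffP[]//]].
by exists ('D_1 (f : C^o -> C^o) (w : C^o)).
Qed.

Lemma cdiff_cst (c w : C) : cdiff (fun=> c) w 0.
Proof. by apply/cdiffP; exact: is_derive_cst. Qed.

Lemma cdiff_id (w : C) : cdiff id w 1.
Proof. by apply/cdiffP; exact: is_derive_id. Qed.

Lemma cdiffD (f g : C -> C) w l m :
  cdiff f w l -> cdiff g w m -> cdiff (fun x => f x + g x) w (l + m).
Proof. by move=> /cdiffP F /cdiffP G; apply/cdiffP; exact: is_deriveD. Qed.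

Lemma cdiffB (f g : C -> C) w l m :
  cdiff f w l -> cdiff g w m -> cdiff (fun x => f x - g x) w (l - m).
Proof. by move=> /cdiffP F /cdiffP G; apply/cdiffP; exact: is_deriveB. Qed.

Lemma cdiffM (f g : C -> C) w l m :
  cdiff f w l -> cdiff g w m -> cdiff (fun x => f x * g x) w (f w * m + g w * l).
Proof. by move=> /cdiffP F /cdiffP G; apply/cdiffP; exact: is_deriveM. Qed.

Lemma cdiff_continuous f w l : cdiff f w l ->
  forall e : R, 0 < e -> exists2 r : R, 0 < r & forall h : C, normc h < r ->
    normc (f (w + h) - f w) < e.
Proof.
move=> H e e0; have [r r0 Hr] := H 1 ltr01.
have n0 := normc_ge0 l.
exists (Num.min r (e / (normc l + 2))).
  by rewrite lt_min r0 divr_gt0// ltr_wpDl.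
move=> h; rewrite lt_min => /andP[/Hr h1 h2].
have -> : f (w + h) - f w = (f (w + h) - f w - l * h) + l * h by rewrite subrK.
apply: le_lt_trans (le_normcD _ _) _; rewrite normcM.
move: h2; rewrite ltr_pdivlMr; last by rewrite ltr_wpDl.
by move: h1 (normc_ge0 h); nra.
Qed.

Lemma cdiff_comp (f g : C -> C) w l m :
  cdiff g w m -> cdiff f (g w) l -> cdiff (fun x => f (g x)) w (l * m).
Proof.
move=> G F e e0.
have nl := normc_ge0 l; have nm := normc_ge0 m.
(* [k] bounds the difference quotients of [g] at [w] for small [h]; the [+ 1] here and in
   [normc l + 1] keeps the divisors positive when a derivative vanishes. *)
set k := normc m + 1; have k0 : 0 < k by rewrite /k; lra.
have [r1 r10 H1] := F (e / (2 * k)) ltac:(by rewrite divr_gt0// mulr_gt0).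
have e2 : 0 < e / (2 * (normc l + 1)) by rewrite divr_gt0// mulr_gt0//; lra.
have [r2 r20 H2] := G (Num.min 1 (e / (2 * (normc l + 1)))) ltac:(by rewrite lt_min ltr01).
exists (Num.min r2 (r1 / k)); first by rewrite lt_min r20 divr_gt0.
move=> h; rewrite lt_min => /andP[/H2 h2 h3].
set D := g (w + h) - g w in h2 *.
have hn := normc_ge0 h.
have D2 : normc (D - m * h) <= normc h.
  by apply: le_trans h2 _; rewrite ler_piMl// ge_min lexx.
have D3 : normc (D - m * h) <= e / (2 * (normc l + 1)) * normc h.
  by apply: le_trans h2 _; rewrite ler_wpM2r// ge_min lexx orbT.
have Dk : normc D <= k * normc h.
  have -> : D = (D - m * h) + m * h by rewrite subrK.
  by apply: le_trans (le_normcD _ _) _; rewrite normcM /k mulrDl mul1r addrC lerD2l.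
have Dr : normc D < r1.
  by apply: le_lt_trans Dk _; rewrite -ltr_pdivlMl// mulrC.
have := H1 D Dr; rewrite (_ : g w + D = g (w + h)); last by rewrite /D addrC subrK.
move=> H3.
have -> : f (g (w + h)) - f (g w) - l * m * h =
  (f (g (w + h)) - f (g w) - l * D) + l * (D - m * h) by ring.
apply: le_trans (le_normcD _ _) _; rewrite normcM.
have A1 : e / (2 * k) * normc D <= e / 2 * normc h.
  apply: (le_trans (y := e / (2 * k) * (k * normc h))).
    by rewrite ler_wpM2l// divr_ge0// ltW// mulr_gt0.
  by rewrite le_eqVlt; apply/orP; left; apply/eqP; field; exact: lt0r_neq0.
have A2 : normc l * normc (D - m * h) <= e / 2 * normc h.
  apply: (le_trans (y := (normc l + 1) * (e / (2 * (normc l + 1)) * normc h))).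
    by apply: ler_pM => //; [exact: normc_ge0|lra].
  by rewrite le_eqVlt; apply/orP; left; apply/eqP; field; apply: lt0r_neq0; lra.
by apply: le_trans (lerD (le_trans H3 A1) A2) _; lra.
Qed.

End complex_basics.

(** * Complex-valued functions of a real variable *)

Section curves.
Variable R : realType.
Local Notation C := R[i].

(** Componentwise, so that real primitives and the real monotonicity criterion apply to each
    part. *)
Definition rdiff (c : R -> C) (t : R) (l : C) :=
  is_derive t 1 (fun s => complex.Re (c s)) (complex.Re l) /\
  is_derive t 1 (fun s => complex.Im (c s)) (complex.Im l).

Lemma is_derive_realP (q : R -> R) (t l : R) : is_derive t 1 q l <->
  forall e : R, 0 < e -> exists2 r : R, 0 < r &
    forall h : R, `|h| < r -> `|q (t + h) - q t - l * h| <= e * `|h|.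
Proof. exact: (@is_derive_epsP R). Qed.

Lemma rdiff_epsP (c : R -> C) (t : R) (l : C) : rdiff c t l <->
  forall e : R, 0 < e -> exists2 r : R, 0 < r &
    forall h : R, `|h| < r -> normc (c (t + h) - c t - l * h%:C) <= e * `|h|.
Proof.
have re (h : R) : complex.Re (c (t + h) - c t - l * h%:C) =
    complex.Re (c (t + h)) - complex.Re (c t) - complex.Re l * h.
  by case: (c _) => ? ?; case: (c _) => ? ?; case: (l) => ? ? /=; ring.
have im (h : R) : complex.Im (c (t + h) - c t - l * h%:C) =
    complex.Im (c (t + h)) - complex.Im (c t) - complex.Im l * h.
  by case: (c _) => ? ?; case: (c _) => ? ?; case: (l) => ? ? /=; ring.
split.
- move=> [/is_derive_realP H1 /is_derive_realP H2] e e0.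
  have [r1 r10 {}H1] := H1 (e / 2) ltac:(by rewrite divr_gt0).
  have [r2 r20 {}H2] := H2 (e / 2) ltac:(by rewrite divr_gt0).
  exists (Num.min r1 r2); first by rewrite lt_min r10.
  move=> h; rewrite lt_min => /andP[/H1 h1 /H2 h2].
  by apply: le_trans (normc_le_ReIm _) _; rewrite re im; lra.
- move=> H; split; apply/is_derive_realP => e e0; have [r r0 Hr] := H e e0;
    exists r => // h /Hr; apply: le_trans.
    by rewrite -re normc_Re.
  by rewrite -im normc_Im.
Qed.

Lemma rdiffD (c1 c2 : R -> C) t l1 l2 : rdiff c1 t l1 -> rdiff c2 t l2 ->
  rdiff (fun s => c1 s + c2 s) t (l1 + l2).
Proof.
move=> [h1 h2] [h3 h4]; split.
  have -> : (fun s => complex.Re (c1 s + c2 s)) =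
    (fun s => complex.Re (c1 s)) + (fun s => complex.Re (c2 s)).
    by apply/funext => s; rewrite raddfD.
  by rewrite raddfD; exact: is_deriveD.
have -> : (fun s => complex.Im (c1 s + c2 s)) =
  (fun s => complex.Im (c1 s)) + (fun s => complex.Im (c2 s)).
  by apply/funext => s; rewrite raddfD.
by rewrite raddfD; exact: is_deriveD.
Qed.

Lemma rdiffN (c1 : R -> C) t l1 : rdiff c1 t l1 -> rdiff (fun s => - c1 s) t (- l1).
Proof.
move=> [h1 h2]; split.
  have -> : (fun s => complex.Re (- c1 s)) = - (fun s => complex.Re (c1 s)).
    by apply/funext => s; rewrite raddfN.
  by rewrite raddfN; exact: is_deriveN.
have -> : (fun s => complex.Im (- c1 s)) = - (fun s => complex.Im (c1 s)).
  by apply/funext => s; rewrite raddfN.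
by rewrite raddfN; exact: is_deriveN.
Qed.

Lemma rdiffB (c1 c2 : R -> C) t l1 l2 : rdiff c1 t l1 -> rdiff c2 t l2 ->
  rdiff (fun s => c1 s - c2 s) t (l1 - l2).
Proof. by move=> h1 h2; apply: rdiffD => //; exact: rdiffN. Qed.

Lemma rdiffZ (a : C) (g : R -> R) (t l : R) : is_derive t 1 g l ->
  rdiff (fun s => a * (g s)%:C) t (a * l%:C).
Proof.
move=> h; case: a => x y; split.
  have -> : (fun s => complex.Re ((x +i* y) * (g s)%:C)) = (x *: g).
    by apply/funext => s /=; rewrite mulr0 subr0.
  by rewrite /= mulr0 subr0; exact: is_deriveZ.
have -> : (fun s => complex.Im ((x +i* y) * (g s)%:C)) = (y *: g).
  by apply/funext => s /=; rewrite mulr0 add0r.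
by rewrite /= mulr0 add0r; exact: is_deriveZ.
Qed.

Lemma rdiff_cst (a : C) (t : R) : rdiff (fun=> a) t 0.
Proof. by split; exact: is_derive_cst. Qed.

Lemma rdiff_comp (f : C -> C) (c : R -> C) (t : R) (l m : C) :
  rdiff c t m -> cdiff f (c t) l -> rdiff (fun s => f (c s)) t (l * m).
Proof.
move=> /rdiff_epsP Hc Hf; apply/rdiff_epsP => e e0.
pose N := normc m + 1; have N0 : 0 < N by rewrite ltr_wpDl ?normc_ge0.
pose L := normc l + 1; have L0 : 0 < L by rewrite ltr_wpDl ?normc_ge0.
have e1 : 0 < e / 2 / N by rewrite divr_gt0// divr_gt0.
have e2 : 0 < Num.min 1 (e / 2 / L) by rewrite lt_min ltr01 divr_gt0// divr_gt0.
have [r1 r10 H1] := Hf _ e1; have [r2 r20 H2] := Hc _ e2.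
exists (Num.min r2 (r1 / N)) => [|h]; first by rewrite lt_min r20 divr_gt0.
rewrite lt_min => /andP[hr2 hr1]; have b2 := H2 h hr2.
set k := c (t + h) - c t in b2; have kE : c (t + h) = c t + k by rewrite /k addrCA subrr addr0.
have kN : normc k <= N * `|h|.
  have -> : k = (k - m * h%:C) + m * h%:C by rewrite subrK.
  apply: le_trans (le_normcD _ _) _; rewrite normcM normcR /N mulrDl addrC lerD2l.
  apply: le_trans b2 _; rewrite ler_wpM2r// ge_min lexx//.
have b1 : normc (f (c t + k) - f (c t) - l * k) <= e / 2 * `|h|.
  apply: le_trans (H1 k _) _.
    by apply: le_lt_trans kN _; rewrite mulrC -ltr_pdivlMr.
  apply: (le_trans (ler_wpM2l (ltW e1) kN)).
  by rewrite mulrA divfK ?gt_eqF.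
have b3 : normc (l * (k - m * h%:C)) <= e / 2 * `|h|.
  rewrite normcM; apply: (le_trans (y := L * (e / 2 / L * `|h|))).
    apply: ler_pM; rewrite ?normc_ge0// ?lerDl//.
    by apply: le_trans b2 _; rewrite ler_wpM2r// ge_min lexx orbT.
  by rewrite mulrA mulrCA divff ?gt_eqF// mulr1.
rewrite kE (_ : _ - _ = (f (c t + k) - f (c t) - l * k) + l * (k - m * h%:C)); last by ring.
by apply: le_trans (le_normcD _ _) _; lra.
Qed.

Lemma rdiff_line (f : C -> C) (a h l : C) (t : R) :
  cdiff f (a + h * t%:C) l -> rdiff (fun s => f (a + h * s%:C)) t (l * h).
Proof.
apply: (rdiff_comp (c := fun s => a + h * s%:C)).
rewrite -[X in rdiff _ _ X]add0r -[h in 0 + h]mulr1; apply: rdiffD; first exact: rdiff_cst.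
by apply: (@rdiffZ h id t 1); exact: is_derive_id.
Qed.

Definition ccont_on (A : set R) (c : R -> C) :=
  {within A, continuous (fun s => complex.Re (c s))} /\
  {within A, continuous (fun s => complex.Im (c s))}.

Lemma rdiff_ccont (A : interval R) (c dc : R -> C) :
  (forall t, t \in A -> rdiff c t (dc t)) -> ccont_on [set` A] c.
Proof.
move=> H; split; apply: derivable_within_continuous => t /H[h1 h2].
  exact: ex_derive.
exact: ex_derive.
Qed.

Lemma ccont_on_dist (A : interval R) (c : R -> C) :
  (forall t, t \in A -> forall e, 0 < e -> exists2 r, 0 < r &
    forall s, s \in A -> `|s - t| < r -> normc (c s - c t) <= e) -> ccont_on [set` A] c.
Proof.
move=> H; have key t : [set` A] t -> forall e, 0 < e ->
    \forall s \near within [set` A] (nbhs t), normc (c s - c t) <= e.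
  move=> tA e e0; have [r r0 Hr] := H t tA e e0.
  suff : nbhs t (fun s => [set` A] s -> normc (c s - c t) <= e) by [].
  apply/nbhs_ballP; exists r => // s; rewrite /ball/= distrC => h sA; exact: Hr.
split; apply/subspace_continuousP => t tA; apply/cvgrPdist_le => e e0;
  apply: filterS (key t tA e e0) => s;
  rewrite distrC -raddfB; apply: le_trans; [exact: normc_Re|exact: normc_Im].
Qed.

(* Projecting on the direction of the increment reduces to real functions. *)
Lemma mean_value_ineq (c c' : R -> C) (G g : R -> R) (a b : R) : a <= b ->
  ccont_on `[a, b] c -> {within `[a, b], continuous G} ->
  (forall t, a < t < b -> rdiff c t (c' t)) ->
  (forall t, a < t < b -> is_derive t 1 G (g t)) ->
  (forall t, a < t < b -> normc (c' t) <= g t) ->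
  normc (c b - c a) <= G b - G a.
Proof.
move=> ab [cre cim] cG dc dG bd.
set D := c b - c a; set p := complex.Re D; set q := complex.Im D.
have [D0|D0] := eqVneq D 0.
  rewrite D0 normc0 subr_ge0.
  have d1 (t : R) : t \in `]a, b[ -> derivable G t 1.
    by rewrite in_itv/= => /dG h; exact: ex_derive.
  have d2 (t : R) : t \in `]a, b[ -> 0 <= derive1 G t.
    rewrite in_itv/= => /[dup] /dG h /bd; rewrite derive1E derive_val.
    by apply: le_trans; exact: normc_ge0.
  apply: (ger0_derive1_le_cc d1 d2 cG) => //.
    by rewrite in_itv/= lexx.
  by rewrite in_itv/= lexx andbT.
set n := normc D.
have n0 : 0 < n by rewrite normc_gt0.
pose F := p *: (fun s => complex.Re (c s)) + q *: (fun s => complex.Im (c s)) - n *: G.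
have dF t : a < t < b ->
    is_derive t 1 F (p * complex.Re (c' t) + q * complex.Im (c' t) - n * g t).
  move=> h; have [h1 h2] := dc _ h.
  exact: (is_deriveB (is_deriveD (is_deriveZ p h1) (is_deriveZ q h2))
    (is_deriveZ n (dG _ h))).
have FD : F b <= F a.
  have d1 (t : R) : t \in `]a, b[ -> derivable F t 1.
    by rewrite in_itv/= => /dF h; exact: ex_derive.
  have d2 (t : R) : t \in `]a, b[ -> derive1 F t <= 0.
    rewrite in_itv/= => /[dup] /dF h /bd; rewrite derive1E derive_val.
    move=> h2; rewrite subr_le0; apply: le_trans (_ : _ <= n * normc (c' t)) _; last first.
      by rewrite ler_pM2l.
    (* Cauchy-Schwarz in the plane; the defect is the square of the determinant [x * v - y * u]. *)
    rewrite /n /p /q; case: (D) => x y; case: (c' t) => u v /=.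
    rewrite -sqrtrM ?addr_ge0 ?sqr_ge0//.
    apply: le_trans (ler_norm _) _; rewrite -sqrtr_sqr ler_wsqrtr//.
    by rewrite -subr_ge0 (_ : _ - _ = (x * v - y * u) ^+ 2) ?sqr_ge0//; ring.
  have cF : {within `[a, b], continuous F}.
    move=> t; apply: cvgB; first by apply: cvgD; apply: cvgZr; [exact: cre|exact: cim].
    by apply: cvgZr; exact: cG.
  apply: (ler0_derive1_le_cc d1 d2 cF) => //.
    by rewrite in_itv/= lexx andbT.
  by rewrite in_itv/= lexx.
have : n ^+ 2 <= n * (G b - G a).
  have -> : n ^+ 2 = p ^+ 2 + q ^+ 2.
    by rewrite /n /p /q; case: (D) => x y /=; rewrite sqr_sqrtr ?addr_ge0 ?sqr_ge0.
  have pE : p = complex.Re (c b) - complex.Re (c a) by rewrite /p /D raddfB.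
  have qE : q = complex.Im (c b) - complex.Im (c a) by rewrite /q /D raddfB.
  have -> : p ^+ 2 + q ^+ 2 = p * (complex.Re (c b) - complex.Re (c a)) +
      q * (complex.Im (c b) - complex.Im (c a)) by rewrite -pE -qE !expr2.
  have {}FD : p * complex.Re (c b) + q * complex.Im (c b) - n * G b <=
     p * complex.Re (c a) + q * complex.Im (c a) - n * G a by exact: FD.
  by lra.
by rewrite expr2 ler_pM2l.
Qed.

Lemma mean_value_ineq_lin (c c' : R -> C) (K a b : R) : a <= b ->
  (forall t, a <= t <= b -> rdiff c t (c' t)) ->
  (forall t, a <= t <= b -> normc (c' t) <= K) ->
  normc (c b - c a) <= K * (b - a).
Proof.
move=> ab dc bd; rewrite mulrBr.
apply: (@mean_value_ineq c c' (fun t => K * t) (fun=> K)) => //.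
- apply: (@rdiff_ccont `[a, b] c c') => t; rewrite in_itv/=; exact: dc.
- apply: derivable_within_continuous => t _; exact: ex_derive.
- by move=> t /andP[t1 t2]; apply: dc; rewrite !ltW.
- by move=> t _; apply: is_derive_eq; rewrite -[RHS]mulr1.
- by move=> t /andP[t1 t2]; apply: bd; rewrite !ltW.
Qed.

(** The integral from [a] has a two-sided derivative at points to the right of [a] only, hence the
    strict inequality; [a] is later placed to the left of the interval of interest. *)
Lemma primitive_exists (q : R -> R) (a : R) : continuous q ->
  exists P : R -> R, forall x, a < x -> is_derive x 1 P (q x).
Proof.
move=> cq; exists (fun x => \int[lebesgue_measure]_(t in `[a, x]) q t) => x ax.
have i1 : lebesgue_measure.-integrable `[a, x + 1] (EFin \o q).
  apply: continuous_compact_integrable; first exact: segment_compact.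
  exact: continuous_subspaceT.
have x1 : x < x + 1 by rewrite ltrDl.
have [H1 H2] := continuous_FTC1_closed x1 i1 ax (cq x).
by rewrite derive1E in H2; exact: DeriveDef H1 H2.
Qed.

Lemma cprimitive_exists (c : R -> C) (a : R) :
  continuous (fun s => complex.Re (c s)) -> continuous (fun s => complex.Im (c s)) ->
  exists P : R -> C, forall x, a < x -> rdiff P x (c x).
Proof.
move=> /(primitive_exists a)[P1 H1] /(primitive_exists a)[P2 H2].
exists (fun x => P1 x +i* P2 x) => x ax; split; [exact: H1|exact: H2].
Qed.

End curves.

(** * Goursat's theorem on rectangles *)

Section goursat.
Variable R : realType.
Local Notation C := R[i].

Definition cpt (x y : R) : C := x%:C + 'i * y%:C.

Lemma ReE_cpt x y : complex.Re (cpt x y) = x.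
Proof. by rewrite /cpt/=; ring. Qed.

Lemma ImE_cpt x y : complex.Im (cpt x y) = y.
Proof. by rewrite /cpt/=; ring. Qed.

Lemma normc_cpt x y : normc (cpt x y) <= `|x| + `|y|.
Proof. by apply: le_trans (normc_le_ReIm _) _; rewrite ReE_cpt ImE_cpt. Qed.

Lemma cptB x y x' y' : cpt x y - cpt x' y' = cpt (x - x') (y - y').
Proof. by rewrite /cpt !rmorphB/=; ring. Qed.

Lemma normc_i : normc ('i : C) = 1.
Proof. by rewrite /normc /= expr0n expr1n add0r sqrtr1. Qed.

Lemma is_derive_half_sqr (x0 x : R) :
  is_derive x 1 (fun s : R => (s - x0) ^+ 2 / 2) (x - x0).
Proof.
apply/is_derive_realP => e e0; exists e => // h he.
rewrite (_ : _ - _ - _ = h ^+ 2 / 2); last by field.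
rewrite normrM normrX (@ger0_norm _ 2^-1) ?invr_ge0//.
by have := normr_ge0 h; nra.
Qed.

Variables (f f' : C -> C).
Hypothesis df : forall w, cdiff f w (f' w).

Lemma cdiff_line_continuous (a h : C) :
  continuous (fun s : R => complex.Re (f (a + h * s%:C))) /\
  continuous (fun s : R => complex.Im (f (a + h * s%:C))).
Proof.
split=> t; apply: differentiable_continuous; apply/derivable1_diffP;
  have [? ?] := rdiff_line (df (a + h * t%:C)); exact: ex_derive.
Qed.

Variables (a0 : R) (H V : R -> R -> C).
Hypothesis dH : forall y x, a0 < x -> rdiff (H y) x (f (cpt x y)).
Hypothesis dV : forall x y, a0 < y -> rdiff (V x) y (f (cpt x y)).

(** The counterclockwise contour integral of [f] along the boundary of [[a, b] x [c, d]]. Writing it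
    with primitives along horizontal and vertical lines makes subdivision a ring identity. *)
Definition rect_integral (a b c d : R) : C :=
  (H c b - H c a) - (H d b - H d a) + 'i * ((V b d - V b c) - (V a d - V a c)).

(** [HA] and [VA] are primitives of the affine approximation of [f] at [cpt x0 y0], whose contour
    integral vanishes identically. Each of the four sides of the remainder contributes at most
    [e * (2 * s) * s]. *)
Lemma rect_local (a b c d x0 y0 s e : R) (l : C) :
  a0 < a -> a <= x0 -> x0 <= b -> a0 < c -> c <= y0 -> y0 <= d ->
  b - a <= s -> d - c <= s -> 0 <= e ->
  (forall h, normc h <= 2 * s ->
    normc (f (cpt x0 y0 + h) - f (cpt x0 y0) - l * h) <= e * normc h) ->
  normc (rect_integral a b c d) <= 8 * e * s ^+ 2.
Proof.
move=> a0a ax xb a0c cy yd bas dcs e0 Hf.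
have s0 : 0 <= s by lra.
set f0 := f (cpt x0 y0) in Hf *.
pose HA y x : C := (f0 + l * ('i * (y - y0)%:C)) * x%:C + l * ((x - x0) ^+ 2 / 2)%:C.
pose VA x y : C := (f0 + l * (x - x0)%:C) * y%:C + l * 'i * ((y - y0) ^+ 2 / 2)%:C.
pose A x y : C := f0 + l * cpt (x - x0) (y - y0).
have bdA x y : a <= x <= b -> c <= y <= d -> normc (f (cpt x y) - A x y) <= e * (2 * s).
  move=> /andP[x1 x2] /andP[y1 y2].
  have n1 : normc (cpt (x - x0) (y - y0)) <= 2 * s.
    apply: le_trans (normc_cpt _ _) _.
    have : `|x - x0| <= s by rewrite ler_norml; apply/andP; split; lra.
    have : `|y - y0| <= s by rewrite ler_norml; apply/andP; split; lra.
    by lra.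
  have := Hf _ n1; rewrite -cptB addrCA subrr addr0 => h.
  rewrite /A opprD addrA -cptB; apply: le_trans h _.
  by rewrite ler_wpM2l// cptB.
have dHA y x : rdiff (HA y) x (A x y).
  have -> : A x y = (f0 + l * ('i * (y - y0)%:C)) * 1%:C + l * (x - x0)%:C.
    by rewrite /A /cpt; ring.
  by apply: rdiffD; apply: rdiffZ; exact: is_derive_half_sqr.
have dVA x y : rdiff (VA x) y (A x y).
  have -> : A x y = (f0 + l * (x - x0)%:C) * 1%:C + l * 'i * (y - y0)%:C.
    by rewrite /A /cpt; ring.
  by apply: rdiffD; apply: rdiffZ; exact: is_derive_half_sqr.
have hE y : c <= y <= d ->
    normc ((H y b - HA y b) - (H y a - HA y a)) <= e * (2 * s) * s.
  move=> yI; have := @mean_value_ineq_lin _ (fun x => H y x - HA y x)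
    (fun x => f (cpt x y) - A x y) (e * (2 * s)) a b ltac:(lra).
  move=> /(_ _ _)/le_trans; apply.
  - move=> t /andP[t1 t2]; apply: rdiffB => //; apply: dH; lra.
  - by move=> t tI; exact: bdA.
  - by rewrite ler_wpM2l// mulr_ge0// mulr_ge0.
have vE x : a <= x <= b ->
    normc ((V x d - VA x d) - (V x c - VA x c)) <= e * (2 * s) * s.
  move=> xI; have := @mean_value_ineq_lin _ (fun y => V x y - VA x y)
    (fun y => f (cpt x y) - A x y) (e * (2 * s)) c d ltac:(lra).
  move=> /(_ _ _)/le_trans; apply.
  - move=> t /andP[t1 t2]; apply: rdiffB => //; apply: dV; lra.
  - by move=> t tI; exact: bdA.
  - by rewrite ler_wpM2l// mulr_ge0// mulr_ge0.
have -> : rect_integral a b c d =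
   ((H c b - HA c b) - (H c a - HA c a)) - ((H d b - HA d b) - (H d a - HA d a)) +
   'i * (((V b d - VA b d) - (V b c - VA b c)) - ((V a d - VA a d) - (V a c - VA a c))).
  rewrite /rect_integral /HA /VA !(rmorphM,rmorphB,rmorphXn,fmorphV)/=.
  by field.
have := hE c ltac:(lra); have := hE d ltac:(lra).
have := vE a ltac:(lra); have := vE b ltac:(lra).
move=> h1 h2 h3 h4.
apply: le_trans (le_normcD _ _) _; rewrite normcM normc_i mul1r.
apply: le_trans (lerD (normcB _ _) (normcB _ _)) _.
by lra.
Qed.

Lemma rect_split_h (m a b c d : R) :
  rect_integral a b c d = rect_integral a m c d + rect_integral m b c d.
Proof. by rewrite /rect_integral; ring. Qed.

Lemma rect_split_v (m a b c d : R) :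
  rect_integral a b c d = rect_integral a b c m + rect_integral a b m d.
Proof. by rewrite /rect_integral; ring. Qed.

Definition quarter (q : R * R * R * R) (i : bool * bool) : R * R * R * R :=
  let: (a, b, c, d) := q in
  let m := (a + b) / 2 in let n := (c + d) / 2 in
  (if i.1 then a else m, if i.1 then m else b, if i.2 then c else n, if i.2 then n else d).

Definition rect_int4 q : R := let: (a, b, c, d) := q in normc (rect_integral a b c d).

Lemma quarter_ex q : exists i, rect_int4 q / 4 <= rect_int4 (quarter q i).
Proof.
case: q => [[[a b] c] d].
set m := (a + b) / 2; set n := (c + d) / 2.
set K := rect_int4 _.
have E : K <= rect_int4 (quarter (a, b, c, d) (true, true)) +
  rect_int4 (quarter (a, b, c, d) (true, false)) +
  rect_int4 (quarter (a, b, c, d) (false, true)) +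
  rect_int4 (quarter (a, b, c, d) (false, false)).
  rewrite /K /= -/m -/n (rect_split_h m) (rect_split_v n a) (rect_split_v n m).
  apply: le_trans (le_normcD _ _) _; apply: le_trans (lerD (le_normcD _ _) (le_normcD _ _)) _.
  by rewrite addrA.
apply: contrapT => /forallNP NH.
have h (i : bool * bool) : rect_int4 (quarter (a, b, c, d) i) < K / 4.
  by have /negP := NH i; rewrite -ltNge.
have := h (true, true); have := h (true, false).
have := h (false, true); have := h (false, false).
by lra.
Qed.

Definition quarter_choice q := projT1 (cid (quarter_ex q)).

Definition rect_seq (q : R * R * R * R) (n : nat) :=
  iter n (fun q => quarter q (quarter_choice q)) q.

Lemma rect_seq_int q n : rect_int4 q / 4 ^+ n <= rect_int4 (rect_seq q n).
Proof.
elim: n => [|n IH]; first by rewrite expr0 divr1.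
rewrite /= -/(rect_seq q n).
set q' := rect_seq q n in IH *.
apply: le_trans (projT2 (cid (quarter_ex q'))).
by rewrite exprS invfM mulrCA [leLHS]mulrC ler_pM2r ?invr_gt0.
Qed.

Lemma rect_seq_wf (q : R * R * R * R) (s : R) (n : nat) :
  let: (a, b, c, d) := q in a <= b -> c <= d -> b - a <= s -> d - c <= s ->
  let: (a', b', c', d') := rect_seq q n in
  [/\ a' <= b', c' <= d', b' - a' <= s / 2 ^+ n & d' - c' <= s / 2 ^+ n].
Proof.
case: q => [[[a b] c] d] ab cd sa sc.
elim: n => [|n]; first by rewrite /= expr0 divr1.
rewrite /= -/(rect_seq (a, b, c, d) n).
case: (rect_seq _ n) => [[[a' b'] c'] d'] [h1 h2 h3 h4].
case: (quarter_choice _) => -[] [] /=; rewrite exprSr invfM mulrA; split; lra.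
Qed.

Lemma rect_seq_nested (q : R * R * R * R) (n k : nat) :
  let: (a, b, c, d) := q in a <= b -> c <= d ->
  let: (a1, b1, c1, d1) := rect_seq q n in
  let: (a2, b2, c2, d2) := rect_seq q (n + k) in
  [/\ a1 <= a2, b2 <= b1, c1 <= c2 & d2 <= d1].
Proof.
case: q => [[[a b] c] d] ab cd.
elim: k => [|k]; first by rewrite addn0; case: (rect_seq _ n) => [[[? ?] ?] ?].
rewrite addnS /= -/(rect_seq (a, b, c, d) (n + k)).
have := @rect_seq_wf (a, b, c, d) ((b - a) + (d - c)) (n + k) ab cd ltac:(lra) ltac:(lra).
case: (rect_seq _ n) => [[[a1 b1] c1] d1].
case: (rect_seq _ (n + k)) => [[[a2 b2] c2] d2] [h1 h2 _ _] [h3 h4 h5 h6].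
case: (quarter_choice _) => -[] [] /=; split; lra.
Qed.

(** Repeated bisection keeps at least the share [4^-n] of the integral, while differentiability at
    the common point of the nested rectangles bounds it by an arbitrarily small multiple of
    [4^-n]. *)
Lemma rect_integral0 (a b c d : R) : a0 < a -> a0 < c -> a <= b -> c <= d ->
  rect_integral a b c d = 0.
Proof.
move=> a0a a0c ab cd; apply: eq0_normc; apply/eqP.
rewrite eq_le normc_ge0 andbT; apply/ler_addgt0Pr => e0 e00; rewrite add0r.
(* [s] dominates both sides; the [+ 1] keeps it positive for a degenerate rectangle. *)
set q := (a, b, c, d); set s := (b - a) + (d - c) + 1.
have s0 : 0 < s by rewrite /s; lra.
pose A n := (rect_seq q n).1.1.1; pose B n := (rect_seq q n).1.1.2.
pose C' n := (rect_seq q n).1.2; pose D n := (rect_seq q n).2.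
have wf n : [/\ A n <= B n, C' n <= D n, B n - A n <= s / 2 ^+ n & D n - C' n <= s / 2 ^+ n].
  have := @rect_seq_wf q s n ab cd ltac:(rewrite /s; lra) ltac:(rewrite /s; lra).
  by rewrite /A /B /C' /D; case: (rect_seq q n) => [[[? ?] ?] ?].
have nest n k : [/\ A n <= A (n + k)%N, B (n + k)%N <= B n, C' n <= C' (n + k)%N &
    D (n + k)%N <= D n].
  have := @rect_seq_nested q n k ab cd; rewrite /A /B /C' /D.
  by case: (rect_seq q n) => [[[? ?] ?] ?]; case: (rect_seq q (n + k)) => [[[? ?] ?] ?].
have AB n m : A n <= B m.
  have [h1 _ _ _] := nest n m; have [_ h2 _ _] := nest m n.
  have [h3 _ _ _] := wf (n + m)%N; rewrite addnC in h2.
  by apply: le_trans h1 _; apply: le_trans h3 _.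
have CD n m : C' n <= D m.
  have [_ _ h1 _] := nest n m; have [_ _ _ h2] := nest m n.
  have [_ h3 _ _] := wf (n + m)%N; rewrite addnC in h2.
  by apply: le_trans h1 _; apply: le_trans h3 _.
pose x0 := sup (range A); pose y0 := sup (range C').
have Ax n : A n <= x0.
  apply: sup_upper_bound; last by exists n.
  by split; [exists (A 0%N); exists 0%N|exists (B 0%N) => _ [m _ <-]; exact: AB].
have xB n : x0 <= B n.
  by apply: ge_sup => [|_ [m _ <-]]; [exists (A 0%N); exists 0%N|exact: AB].
have Cy n : C' n <= y0.
  apply: sup_upper_bound; last by exists n.
  by split; [exists (C' 0%N); exists 0%N|exists (D 0%N) => _ [m _ <-]; exact: CD].
have yD n : y0 <= D n.
  by apply: ge_sup => [|_ [m _ <-]]; [exists (C' 0%N); exists 0%N|exact: CD].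
(* This tolerance cancels the factor [8 * s ^+ 2] of [rect_local], leaving [e0 / 4 ^+ n]. *)
have es : 0 < e0 / (8 * s ^+ 2) by rewrite divr_gt0// mulr_gt0// exprn_gt0.
have [r r0 Hr] := df (cpt x0 y0) es.
have [n Hn] : exists n : nat, 2 * (s / 2 ^+ n) < r.
  have [n hn] : exists n : nat, 2 * s / r < n%:R.
    exists (Num.truncn (2 * s / r)).+1; exact: truncnS_gt.
  exists n; have n2 : n%:R < 2 ^+ n :> R by rewrite -natrX ltr_nat ltn_expl.
  rewrite mulrA ltr_pdivrMr ?exprn_gt0// -ltr_pdivrMl// mulrC.
  exact: lt_trans hn n2.
have q0 : a0 < A n /\ a0 < C' n.
  have [h1 _ h2 _] := nest 0%N n; rewrite add0n in h1 h2.
  by split; [apply: lt_le_trans h1|apply: lt_le_trans h2].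
have [w1 w2 w3 w4] := wf n.
have := @rect_local (A n) (B n) (C' n) (D n) x0 y0 (s / 2 ^+ n) (e0 / (8 * s ^+ 2))
  (f' (cpt x0 y0)) q0.1 (Ax n) (xB n) q0.2 (Cy n) (yD n) w3 w4 (ltW es).
have Hs : forall h, normc h <= 2 * (s / 2 ^+ n) -> normc (f (cpt x0 y0 + h) - f (cpt x0 y0) -
   f' (cpt x0 y0) * h) <= e0 / (8 * s ^+ 2) * normc h.
  by move=> h /le_lt_trans/(_ Hn)/Hr.
move=> /(_ Hs) loc.
have := @rect_seq_int q n.
have -> : rect_int4 (rect_seq q n) = normc (rect_integral (A n) (B n) (C' n) (D n)).
  by rewrite /rect_int4 /A /B /C' /D; case: (rect_seq q n) => [[[? ?] ?] ?].
move=> /le_trans/(_ loc).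
rewrite ler_pdivrMr ?exprn_gt0// => /le_trans; apply.
rewrite le_eqVlt; apply/orP; left; apply/eqP.
have -> : 4 ^+ n = (2 ^+ n) ^+ 2 :> R by rewrite -exprM mulnC exprM; congr (_ ^+ _); ring.
field; rewrite gt_eqF//= gt_eqF// exprn_gt0//.
Qed.

End goursat.

(** * The complex exponential and Cauchy's estimate *)

Section cauchy_estimate.
Variable R : realType.
Local Notation C := R[i].

Lemma CexpD (a b : C) : Cexp (a + b) = Cexp a * Cexp b.
Proof.
case: a => x y; case: b => u v; rewrite /Cexp /= expRD cosD sinD.
by congr Complex; ring.
Qed.

Lemma Cexp0 : Cexp (0 : C) = 1.
Proof. by rewrite /Cexp /= expR0 cos0 sin0 mulr1 mulr0. Qed.

Lemma normc_Cexp (a : C) : normc (Cexp a) = expR (complex.Re a).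
Proof.
case: a => x y; rewrite /Cexp /= !exprMn -mulrDr cos2Dsin2 mulr1 sqrtr_sqr.
by rewrite ger0_norm// expR_ge0.
Qed.

Lemma CexpN (a : C) : Cexp a * Cexp (- a) = 1.
Proof. by rewrite -CexpD subrr Cexp0. Qed.

Lemma is_derive_eps0 (q : R -> R) (l e : R) : is_derive (0 : R) 1 q l -> 0 < e ->
  exists2 r : R, 0 < r & forall h, `|h| < r -> `|q h - q 0 - l * h| <= e * `|h|.
Proof.
move=> /is_derive_realP H /H[r r0 Hr]; exists r => // h /Hr.
by rewrite add0r.
Qed.

Lemma cdiff_Cexp0 : cdiff (@Cexp R) 0 1.
Proof.
move=> e e0.
have e16 : 0 < e / 16 by rewrite divr_gt0.
have k0 : 0 < Num.min (e / 16) 1 by rewrite lt_min e16 ltr01.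
have [r1 r10 H1] := is_derive_eps0 (is_derive_expR (0 : R)) k0.
have [r2 r20 H2] := is_derive_eps0 (is_derive_cos (0 : R)) e16.
have [r3 r30 H3] := is_derive_eps0 (is_derive_sin (0 : R)) e16.
pose r := Num.min (Num.min r1 r2) (Num.min r3 (Num.min (e / 16) (16^-1))).
have r0 : 0 < r by rewrite !lt_min r10 r20 r30 e16 invr_gt0 ltr0n.
exists r => // -[x y]; rewrite add0r mul1r Cexp0.
set N := normc _ => hr.
have hn : 0 <= N := normc_ge0 _.
have xn : `|x| <= N := normc_Re (x +i* y).
have yn : `|y| <= N := normc_Im (x +i* y).
have := le_lt_trans xn hr; have := le_lt_trans yn hr.
rewrite !lt_min => /andP[/andP[_ /H2 b1] /and3P[/H3 b2 b3 b4]].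
move=> /andP[/andP[/H1 a1 _] /and3P[_ a2 a3]].
rewrite expR0 mul1r in a1; rewrite cos0 sin0 oppr0 mul0r subr0 in b1.
rewrite cos0 sin0 subr0 mul1r in b2.
have EX : expR x = 1 + x + (expR x - 1 - x) by ring.
set E := expR x in a1 EX *; set c := cos y in b1 *; set s := sin y in b2 *.
have nx := normr_ge0 x; have ny := normr_ge0 y.
have e17 : `|E - 1 - x| <= `|x|.
  by apply: le_trans a1 _; rewrite ler_piMl// ge_min lexx orbT.
have {}a1 : `|E - 1 - x| <= e / 16 * `|x|.
  by apply: le_trans a1 _; rewrite ler_wpM2r// ge_min lexx.
have E2 : E <= 2.
  have := ler_norm (E - 1 - x); have := ler_norm x; lra.
have E0 : 0 <= E by rewrite /E expR_ge0.
have E1 : `|E - 1| <= e / 8.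
  have -> : E - 1 = (E - 1 - x) + x by ring.
  by apply: le_trans (ler_normD _ _) _; lra.
apply: le_trans (normc_le_ReIm _) _ => /=.
have -> : E * c - 1 - x = E * (c - 1) + (E - 1 - x) by ring.
have -> : E * s - 0 - y = E * (s - y) + (E - 1) * y by ring.
have h1 : `|E * (c - 1)| <= 2 * (e / 16 * `|y|).
  by rewrite normrM (ger0_norm E0) ler_pM.
have h2 : `|E * (s - y)| <= 2 * (e / 16 * `|y|).
  by rewrite normrM (ger0_norm E0) ler_pM.
have h3 : `|(E - 1) * y| <= e / 8 * `|y| by rewrite normrM ler_wpM2r.
apply: le_trans (lerD (ler_normD _ _) (ler_normD _ _)) _.
have : e / 16 * `|y| <= e / 16 * N by rewrite ler_wpM2l// ltW.
have : e / 16 * `|x| <= e / 16 * N by rewrite ler_wpM2l// ltW.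
have : 0 <= e * N by rewrite mulr_ge0// ltW.
by lra.
Qed.

Lemma cdiff_Cexp (w : C) : cdiff (@Cexp R) w (Cexp w).
Proof.
move=> e e0; have n0 : 0 < normc (Cexp w) by rewrite normc_Cexp expR_gt0.
have [|r r0 Hr] := @cdiff_Cexp0 (e / normc (Cexp w)); first by rewrite divr_gt0.
exists r => // h /Hr; rewrite add0r Cexp0 mul1r CexpD => H.
have -> : Cexp w * Cexp h - Cexp w - Cexp w * h = Cexp w * (Cexp h - 1 - h) by ring.
rewrite normcM; move: H; rewrite mulrAC ler_pdivlMr// mulrC.
by [].
Qed.

Lemma ReN_cpt (x y : R) : complex.Re (- cpt x y) = - x.
Proof. by rewrite -[in RHS](ReE_cpt x y). Qed.

Lemma ImN_cpt (x y : R) : complex.Im (- cpt x y) = - y.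
Proof. by rewrite -[in RHS](ImE_cpt x y). Qed.

(* Goursat applied to [s |-> f (w0 + e^s) e^-s], which is [2 pi i]-periodic: the
   first Fourier coefficient of [f] on circles around [w0] does not depend on the
   radius, and tends to [f'(w0)] when the radius tends to 0. *)
Lemma cauchy_estimate (f f' : C -> C) (w0 : C) (r M : R) :
  (forall w, cdiff f w (f' w)) -> 0 < r ->
  (forall h, normc h = r -> normc (f (w0 + h)) <= M) ->
  normc (f' w0) <= M / r.
Proof.
move=> df r0 fM; apply/ler_addgt0Pr => e e0.
have [dl dl0 Hdl] := df w0 e e0.
(* [s1] is the logarithm of the given radius, [s0] that of a radius where [f] is almost affine. [a0]
   lies to the left of both [s0] and 0, so that primitives starting there cover the log-radii and
   the angles. *)
pose s1 := ln r; pose s0 := Num.min s1 (ln (dl / 2)); pose a0 := Num.min s0 0 - 1.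
have s01 : s0 <= s1 by rewrite ge_min lexx.
have es0 : expR s0 < dl.
  apply: (@le_lt_trans _ _ (dl / 2)); last by lra.
  rewrite -[leRHS]lnK ?posrE ?divr_gt0// ler_expR.
  by rewrite ge_min lexx orbT.
have [m1 m2] : Num.min s0 0 <= s0 /\ Num.min s0 0 <= 0 :> R.
  by split; rewrite ge_min lexx ?orbT.
have as0 : a0 < s0 by rewrite /a0; lra.
have a00 : a0 < 0 by rewrite /a0; lra.
pose g (w : C) := f (w0 + Cexp w) * Cexp (- w).
have /choice[g' dg] : forall w, exists l, cdiff g w l.
  move=> w.
  have d1 : cdiff (fun w => f (w0 + Cexp w)) w (f' (w0 + Cexp w) * (0 + Cexp w)).
    apply: (cdiff_comp (g := fun w => w0 + Cexp w)) => //.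
    by apply: cdiffD; [exact: cdiff_cst|exact: cdiff_Cexp].
  have d2 : cdiff (fun w => Cexp (- w)) w (Cexp (- w) * (0 - 1)).
    apply: (cdiff_comp (g := fun w => - w)); last exact: cdiff_Cexp.
    have -> : (fun w : C => - w) = (fun w => 0 - w) by apply/funext => ?; rewrite sub0r.
    by apply: cdiffB; [exact: cdiff_cst|exact: cdiff_id].
  by eexists; exact: (cdiffM d1 d2).
have /choice[H dH] : forall y, exists P : R -> C,
    forall x, a0 < x -> rdiff P x (g (cpt x y)).
  move=> y.
  have [c1 c2] := cdiff_line_continuous dg ('i * y%:C) 1.
  have [P HP] := cprimitive_exists a0 c1 c2; exists P => x /HP.
  by rewrite mul1r addrC.
have /choice[V dV] : forall x, exists P : R -> C,
    forall y, a0 < y -> rdiff P y (g (cpt x y)).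
  move=> x.
  have [c1 c2] := cdiff_line_continuous dg x%:C 'i.
  by have [P HP] := cprimitive_exists a0 c1 c2; exists P => y /HP.
set tpi : R := pi *+ 2.
have tpi0 : 0 < tpi by rewrite mulrn_wgt0// pi_gt0.
have := rect_integral0 dg dH dV as0 a00 s01 (ltW tpi0).
rewrite /rect_integral.
have Cp x : Cexp (cpt x tpi) = Cexp (cpt x 0).
  by rewrite /Cexp !ReE_cpt !ImE_cpt cos2pi sin2pi cos0 sin0.
have Cpn x : Cexp (- cpt x tpi) = Cexp (- cpt x 0).
  rewrite -[LHS]mul1r -(CexpN (cpt x 0)) -{1}Cp mulrAC CexpN mul1r//.
(* By periodicity the integrals along the angles 0 and [2 pi] agree; only the two vertical sides,
   the circles, remain in the contour integral. *)
have hH : H 0 s1 - H 0 s0 = H tpi s1 - H tpi s0.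
  apply/eqP; rewrite -subr_eq0; apply/eqP/eq0_normc/eqP.
  rewrite eq_le normc_ge0 andbT.
  have := @mean_value_ineq_lin _ (fun x => H 0 x - H tpi x) (fun=> 0) 0 s0 s1 s01.
  rewrite mul0r (_ : _ - _ - _ = H 0 s1 - H 0 s0 - (H tpi s1 - H tpi s0)); last by ring.
  apply; last by move=> *; rewrite normc0.
  move=> t /andP[t1 t2]; have at0 : a0 < t by apply: lt_le_trans t1.
  have := rdiffB (dH 0 t at0) (dH tpi t at0).
  by rewrite /g Cp Cpn subrr.
rewrite hH subrr add0r => /eqP; rewrite mulf_eq0 => /orP[/eqP/(congr1 (@normc R))|].
  by rewrite normc_i normc0 => /eqP; rewrite oner_eq0.
rewrite subr_eq0 => /eqP JJ.
have J1 : normc (V s1 tpi - V s1 0) <= M / r * (tpi - 0).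
  apply: (@mean_value_ineq_lin _ (V s1) (fun y => g (cpt s1 y))); first exact: ltW.
    by move=> t /andP[t1 _]; apply: dV; exact: lt_le_trans t1.
  move=> t _; rewrite /g normcM !normc_Cexp ReN_cpt.
  rewrite expRN /s1 lnK ?posrE// ler_pM2r ?invr_gt0//; apply: fM.
  by rewrite normc_Cexp ReE_cpt lnK.
(* A primitive along the small circle of [(f w0 + f' w0 * e^s) * e^-s]; over one period its first
   two terms return to their start and it gains [2 pi * f' w0]. *)
pose K (y : R) : C := f w0 * (expR (- s0))%:C * (sin y)%:C +
   f w0 * (expR (- s0))%:C * 'i * (cos y)%:C + f' w0 * y%:C.
have dK (y : R) : rdiff K y (f w0 * Cexp (- cpt s0 y) + f' w0).
  have -> : f w0 * Cexp (- cpt s0 y) + f' w0 = f w0 * (expR (- s0))%:C * (cos y)%:C +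
     f w0 * (expR (- s0))%:C * 'i * (- sin y)%:C + f' w0 * 1%:C.
    rewrite mulr1; congr (_ + _); rewrite -!mulrA -mulrDr -mulrDr; congr (_ * _).
    rewrite /Cexp ReN_cpt ImN_cpt cosN sinN.
    by apply/eqP; rewrite eq_complex/=; apply/andP; split; apply/eqP; ring.
  by apply: rdiffD; [apply: rdiffD|]; apply: rdiffZ.
have J0 : normc ((V s0 tpi - K tpi) - (V s0 0 - K 0)) <= e * (tpi - 0).
  apply: (@mean_value_ineq_lin _ (fun y => V s0 y - K y)
    (fun y => g (cpt s0 y) - (f w0 * Cexp (- cpt s0 y) + f' w0))); first exact: ltW.
    by move=> t /andP[t1 _]; apply: rdiffB => //; apply: dV; exact: lt_le_trans t1.
  move=> t _; rewrite /g.
  have nE : normc (Cexp (cpt s0 t)) = expR s0 by rewrite normc_Cexp ReE_cpt.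
  have := Hdl (Cexp (cpt s0 t)); rewrite nE => /(_ es0) Hd.
  have -> : f (w0 + Cexp (cpt s0 t)) * Cexp (- cpt s0 t) -
    (f w0 * Cexp (- cpt s0 t) + f' w0) =
    (f (w0 + Cexp (cpt s0 t)) - f w0 - f' w0 * Cexp (cpt s0 t)) * Cexp (- cpt s0 t).
    rewrite !mulrBl -[f' w0 * _ * _]mulrA CexpN mulr1; ring.
  rewrite normcM normc_Cexp ReN_cpt expRN.
  by rewrite ler_pdivrMr ?expR_gt0.
have KK : K tpi - K 0 = f' w0 * tpi%:C.
  by rewrite /K cos2pi sin2pi cos0 sin0; rewrite (_ : 0%:C = 0)//; ring.
have : normc (f' w0 * tpi%:C) <= (M / r + e) * tpi.
  rewrite -KK.
  have -> : K tpi - K 0 = (V s1 tpi - V s1 0) - ((V s0 tpi - K tpi) - (V s0 0 - K 0)).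
    by rewrite JJ; ring.
  apply: le_trans (normcB _ _) _; rewrite subr0 in J0 J1.
  by rewrite mulrDl lerD.
by rewrite normcM normcR (ger0_norm (ltW tpi0)) ler_pM2r.
Qed.

End cauchy_estimate.

(** * Entire functions of one complex variable *)

Section entire_functions.
Variable R : realType.
Local Notation C := R[i].

Definition centire (f : C -> C) := forall w, exists l, cdiff f w l.

Definition cder (f : C -> C) (w : C) : C := xget 0 (cdiff f w).

Lemma cderP f : centire f -> forall w, cdiff f w (cder f w).
Proof. by move=> H w; have [l Hl] := H w; exact: (xgetI 0 Hl). Qed.

Lemma cder_val f w l : cdiff f w l -> cder f w = l.
Proof. by move=> H; apply: (cdiff_unique _ H); exact: (xgetI 0 H). Qed.

Lemma centireB f g : centire f -> centire g -> centire (fun w => f w - g w).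
Proof.
move=> F G w; exists (cder f w - cder g w).
by apply: cdiffB; exact: cderP.
Qed.

Lemma centireD f g : centire f -> centire g -> centire (fun w => f w + g w).
Proof.
move=> F G w; exists (cder f w + cder g w).
by apply: cdiffD; exact: cderP.
Qed.

Lemma centireM f g : centire f -> centire g -> centire (fun w => f w * g w).
Proof.
move=> F G w; eexists.
by apply: cdiffM; exact: cderP.
Qed.

Lemma centire_cst (c : C) : centire (fun=> c).
Proof. by move=> w; exists 0; exact: cdiff_cst. Qed.

Lemma centire_id : centire id.
Proof. by move=> w; exists 1; exact: cdiff_id. Qed.

Lemma cdiff_affine (a c w : C) : cdiff (fun w => a + w * c) w c.
Proof.
have := cdiffD (cdiff_cst a w) (cdiffM (cdiff_id w) (cdiff_cst c w)).
by rewrite mulr0 mulr1 !add0r.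
Qed.

Lemma centire_affine f (a c : C) : centire f -> centire (fun w => f (a + w * c)).
Proof.
move=> F w; exists (cder f (a + w * c) * c).
apply: (cdiff_comp (g := fun w => a + w * c)); first exact: cdiff_affine.
exact: cderP.
Qed.

Lemma centire_shift f (a : C) : centire f -> centire (fun w => f (a + w)).
Proof.
move=> /(centire_affine a 1) F w; have [l Hl] := F w; exists l.
by under eq_fun do rewrite -[X in _ + X]mulr1.
Qed.

Lemma cder_shift f (a w : C) : centire f -> cder (fun w => f (a + w)) w = cder f (a + w).
Proof.
move=> F; apply: cder_val => e e0; have [r r0 Hr] := cderP F (a + w) e0.
by exists r => // h /Hr; rewrite addrA.
Qed.

Lemma cder_bound f (w : C) (r M : R) : centire f -> 0 < r ->
  (forall h, normc h <= r -> normc (f (w + h)) <= M) -> normc (cder f w) <= M / r.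
Proof.
move=> F r0 fM; apply: (cauchy_estimate (f := f)) => //; first exact: cderP.
by move=> h hr; apply: fM; rewrite hr.
Qed.

Lemma centire_mean_value f (a h : C) (K : R) : centire f ->
  (forall k, normc k <= normc h -> normc (cder f (a + k)) <= K) ->
  normc (f (a + h) - f a) <= K * normc h.
Proof.
move=> F bd.
have := @mean_value_ineq_lin _ (fun t => f (a + h * t%:C))
  (fun t => cder f (a + h * t%:C) * h) (K * normc h) 0 1 ler01.
rewrite subr0 !mulr1 mulr0 addr0; apply.
- by move=> t _; apply: rdiff_line; exact: cderP.
- move=> t /andP[t0 t1]; rewrite normcM ler_wpM2r ?normc_ge0// bd//.
  by rewrite normcM normcR ger0_norm// ler_piMr// normc_ge0.
Qed.

Lemma centire_lip f (a h : C) (r M : R) : centire f -> 0 < r ->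
  (forall k, normc k <= 2 * r -> normc (f (a + k)) <= M) -> normc h <= r ->
  normc (f (a + h) - f a) <= M / r * normc h.
Proof.
move=> F r0 fM hr; apply: centire_mean_value => // k kh.
apply: cder_bound => // j jr; rewrite -addrA; apply: fM.
by apply: le_trans (le_normcD _ _) _; lra.
Qed.

(* The Cauchy estimate for [f (a + k + .) - f (a + .)] makes [f'] Lipschitz. *)
Lemma centire_taylor2 f (a h : C) (r M : R) : centire f -> 0 < r ->
  (forall k, normc k <= 3 * r -> normc (f (a + k)) <= M) -> normc h <= r ->
  normc (f (a + h) - f a - cder f a * h) <= M / r ^+ 2 * normc h ^+ 2.
Proof.
move=> F r0 fM hr.
have M0 : 0 <= M.
  by apply: le_trans (fM 0 _); rewrite ?normc_ge0// normc0 mulr_ge0// ltW.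
have der_lip k : normc k <= normc h -> normc (cder f (a + k) - cder f a) <= M / r ^+ 2 * normc h.
  move=> kh; pose g w := f (a + k + w) - f (a + w).
  have G : centire g by apply: centireB; exact: centire_shift.
  have -> : cder f (a + k) - cder f a = cder g 0.
    apply/esym/cder_val; have := cdiffB (cderP (centire_shift (a + k) F) 0)
      (cderP (centire_shift a F) 0).
    by rewrite !cder_shift// !addr0.
  have -> : M / r ^+ 2 * normc h = M / r * normc h / r.
    by field; rewrite gt_eqF.
  apply: cder_bound => // j jr; rewrite add0r /g.
  apply: le_trans (_ : M / r * normc k <= _); last by rewrite ler_wpM2l// divr_ge0// ltW.
  rewrite (addrC a k) -addrA (addrC k); apply: centire_lip => //; last first.
    exact: le_trans hr.
  move=> i ir; rewrite -addrA; apply: fM; apply: le_trans (le_normcD _ _) _; lra.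
pose g w := f w - cder f a * w.
have G : centire g.
  by apply: centireB => //; apply: centireM; [exact: centire_cst|exact: centire_id].
have -> : f (a + h) - f a - cder f a * h = g (a + h) - g a by rewrite /g; ring.
rewrite expr2 mulrA; apply: centire_mean_value => // k /der_lip.
have -> // : cder g (a + k) = cder f (a + k) - cder f a.
apply: cder_val; have := cdiffB (cderP F (a + k)) (cdiffM (cdiff_cst (cder f a) (a + k)) (cdiff_id (a + k))).
by rewrite mulr1 mulr0 addr0.
Qed.

(** A Cauchy family indexed by its own tolerance; the limit is the supremum of the lower estimates
    [u e - c * e], which gives the rate at once. *)
Lemma uniform_cauchy_limit (u : R -> R) (c : R) :
  (forall e e', 0 < e -> 0 < e' -> `|u e - u e'| <= c * (e + e')) ->
  exists L, forall e, 0 < e -> `|u e - L| <= c * e.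
Proof.
move=> H; pose S := [set u e - c * e | e in [set e | 0 < e]].
have ub e : 0 < e -> forall x, S x -> x <= u e + c * e.
  move=> e0 _ [e' /= e'0 <-]; have := H e' e e'0 e0.
  by rewrite ler_norml => /andP[_]; lra.
exists (sup S) => e e0.
have h1 : sup S <= u e + c * e.
  by apply: ge_sup => [|x /(ub e e0)//]; exists (u e - c * e); exists e.
have h2 : u e - c * e <= sup S.
  apply: sup_upper_bound; last by exists e.
  by split; [exists (u e - c * e); exists e|exists (u e + c * e) => x /(ub e e0)].
by rewrite ler_norml; apply/andP; split; lra.
Qed.

Lemma uniform_ccauchy_limit (u : R -> C) (c : R) :
  (forall e e', 0 < e -> 0 < e' -> normc (u e - u e') <= c * (e + e')) ->
  exists L, forall e, 0 < e -> normc (u e - L) <= 2 * c * e.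
Proof.
move=> H.
have [|L1 HL1] := @uniform_cauchy_limit (fun e => complex.Re (u e)) c.
  move=> e e' e0 e'0; apply: le_trans (H e e' e0 e'0).
  by rewrite -raddfB normc_Re.
have [|L2 HL2] := @uniform_cauchy_limit (fun e => complex.Im (u e)) c.
  move=> e e' e0 e'0; apply: le_trans (H e e' e0 e'0).
  by rewrite -raddfB normc_Im.
exists (L1 +i* L2) => e e0; apply: le_trans (normc_le_ReIm _) _.
rewrite !raddfB/=; have := HL1 e e0; have := HL2 e e0; lra.
Qed.

(** Weierstrass's theorem. Cauchy's estimate makes the derivatives of the approximants converge, and
    their second-order remainders have a common constant, so the remainder estimate passes to the
    limit. *)
Lemma centire_uniform_limit (f : C -> C) :
  (forall a, exists2 r : R, 0 < r & forall e : R, 0 < e ->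
    exists2 g, centire g & forall h, normc h <= r -> normc (g (a + h) - f (a + h)) <= e) ->
  centire f.
Proof.
move=> H a; have [r r0 Hr] := H a.
have [g1 G1 Hg1] := Hr 1 ltr01.
have [r1 r10 Hr1] := cdiff_continuous (cderP G1 a) ltr01.
(* [centire_taylor2] at radius [p] looks at the disc of radius [3 * p], which has to lie in both
   given discs; [r1 / 2] makes the second inclusion strict. *)
pose p := Num.min r (r1 / 2) / 3.
have p0 : 0 < p by rewrite divr_gt0// lt_min r0 divr_gt0.
have [p1 p2] : 3 * p <= r /\ 3 * p < r1.
  have e3 : 3 * p = Num.min r (r1 / 2) by rewrite /p; field.
  have m1 : Num.min r (r1 / 2) <= r by rewrite ge_min lexx.
  have m2 : Num.min r (r1 / 2) <= r1 / 2 by rewrite ge_min lexx orbT.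
  by split; lra.
(* A bound for all approximants of tolerance at most 1: one unit for each of the two approximations
   of [f], one for the variation of [g1] near [a]. *)
pose M := normc (g1 a) + 3.
have gM (e : R) (g : C -> C) : e <= 1 ->
    (forall h, normc h <= r -> normc (g (a + h) - f (a + h)) <= e) ->
    forall k, normc k <= 3 * p -> normc (g (a + k)) <= M.
  move=> e1 Hg k kp.
  have -> : g (a + k) = (g (a + k) - f (a + k)) - (g1 (a + k) - f (a + k)) +
     (g1 (a + k) - g1 a) + g1 a by ring.
  have h1 := Hg k (le_trans kp p1); have h2 := Hg1 k (le_trans kp p1).
  have h3 := Hr1 k (le_lt_trans kp p2).
  apply: le_trans (le_normcD _ _) _; rewrite /M [leRHS]addrC lerD2r.
  apply: le_trans (le_normcD _ _) _; have := normcB (g (a + k) - f (a + k)) (g1 (a + k) - f (a + k)).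
  by lra.
have /choice[g Hg] : forall e, exists g, 0 < e -> centire g /\
    forall h, normc h <= r -> normc (g (a + h) - f (a + h)) <= Num.min e 1.
  move=> e; have [e0|e0] := ltP 0 e; last by exists f.
  by have [|g ? ?] := Hr (Num.min e 1); [rewrite lt_min e0 ltr01|exists g].
have [L HL] : exists L, forall e, 0 < e -> normc (cder (g e) a - L) <= 2 * p^-1 * e.
  apply: uniform_ccauchy_limit => e e' e0 e'0.
  have [G He] := Hg e e0; have [G' He'] := Hg e' e'0.
  have -> : cder (g e) a - cder (g e') a = cder (fun w => g e w - g e' w) a.
    by apply/esym/cder_val/cdiffB; exact: cderP.
  rewrite mulrC; apply: cder_bound => //; first exact: centireB.
  move=> h hp; have hr : normc h <= r by lra.
  have -> : g e (a + h) - g e' (a + h) =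
    (g e (a + h) - f (a + h)) - (g e' (a + h) - f (a + h)) by ring.
  apply: le_trans (normcB _ _) _; apply: lerD.
    by apply: le_trans (He h hr) _; rewrite ge_min lexx.
  by apply: le_trans (He' h hr) _; rewrite ge_min lexx.
exists L; set K := M / p ^+ 2.
have K0 : 0 <= K.
  by rewrite /K divr_ge0 ?exprn_ge0// ?(ltW p0)// /M addr_ge0 ?normc_ge0.
have main h : normc h <= p -> normc (f (a + h) - f a - L * h) <= K * normc h ^+ 2.
  move=> hp; apply/ler_addgt0Pr => e' e'0.
  have c0 : 0 < 2 + 2 * p^-1 * normc h.
    by rewrite ltr_pwDl// mulr_ge0 ?normc_ge0// mulr_ge0// invr_ge0 ltW.
  set e := e' / (2 + 2 * p^-1 * normc h).
  have e0 : 0 < e by rewrite divr_gt0.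
  have [G He] := Hg e e0.
  have T := centire_taylor2 (h := h) G p0 (gM (Num.min e 1) (g e) ltac:(by rewrite ge_min lexx orbT) He) hp.
  have hr : normc h <= r by lra.
  have r0' : normc (0 : C) <= r by rewrite normc0 ltW.
  have := HL e e0 => HLe.
  have -> : f (a + h) - f a - L * h = (g e (a + h) - g e a - cder (g e) a * h)
     - (g e (a + h) - f (a + h)) + (g e (a + 0) - f (a + 0)) + (cder (g e) a - L) * h.
    by rewrite addr0; ring.
  have eE : e' = e + e + 2 * p^-1 * e * normc h.
    have := c0; rewrite /e; set c1 := 2 + _ => c10.
    by transitivity (e' / c1 * c1); [field; rewrite gt_eqF|rewrite {2}/c1; ring].
  have -> : K * normc h ^+ 2 + e' = K * normc h ^+ 2 + e + e + 2 * p^-1 * e * normc h.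
    by rewrite {1}eE !addrA.
  apply: le_trans (le_normcD _ _) _; apply: lerD; last first.
    by rewrite normcM ler_wpM2r// normc_ge0.
  apply: le_trans (le_normcD _ _) _; apply: lerD; last first.
    by apply: le_trans (He 0 r0') _; rewrite ge_min lexx.
  apply: le_trans (normcB _ _) _; apply: lerD => //.
  by apply: le_trans (He h hr) _; rewrite ge_min lexx.
move=> e e0; exists (Num.min p (e / (K + 1))).
  by rewrite lt_min p0 divr_gt0// ltr_wpDl.
move=> h; rewrite lt_min => /andP[/ltW /main h1]; rewrite ltr_pdivlMr ?ltr_wpDl// => h2.
apply: le_trans h1 _; rewrite expr2 mulrA ler_wpM2r ?normc_ge0//.
have := normc_ge0 h; nra.
Qed.

End entire_functions.

(** * Integration of complex-valued functions *)

Section real_integrable.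
Context dd (T : measurableType dd) (R : realType) (mu : {measure set T -> \bar R}).
Implicit Types f g : T -> R.

Definition rint f := mu.-integrable setT (EFin \o f).

Lemma rint_meas f : rint f -> measurable_fun setT f.
Proof. by move=> /integrableP[/measurable_EFinP]. Qed.

Lemma rint_le f g : measurable_fun setT f -> rint g ->
  (\forall x \ae mu, `|f x| <= g x) -> rint f.
Proof.
move=> mf ig H; apply/integrableP; split; first exact/measurable_EFinP.
have /integrableP[mg] := ig; apply: le_lt_trans.
apply: ae_ge0_le_integral => //.
- by apply: measurableT_comp => //; exact/measurable_EFinP.
- exact: measurableT_comp.
- apply: filterS H => x H _ /=; rewrite lee_fin.
  by apply: le_trans H _; exact: ler_norm.
Qed.

Lemma rintD f g : rint f -> rint g -> rint (fun x => f x + g x).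
Proof.
by move=> F G; apply: eq_integrable (integrableD measurableT F G).
Qed.

Lemma rintB f g : rint f -> rint g -> rint (fun x => f x - g x).
Proof.
by move=> F G; apply: eq_integrable (integrableB measurableT F G).
Qed.

Lemma rintZ (c : R) f : rint f -> rint (fun x => c * f x).
Proof.
by move=> F; apply: eq_integrable (integrableZl measurableT c F).
Qed.

Lemma rintN f : rint f -> rint (fun x => - f x).
Proof.
move=> /(rintZ (-1)) H; apply: eq_integrable H => // x _ /=.
by rewrite mulN1r.
Qed.

Lemma rint_norm f : rint f -> rint (fun x => `|f x|).
Proof. exact: integrable_norm. Qed.

Lemma rint0 : rint (fun=> 0).
Proof. exact: integrable0. Qed.

Lemma ae_le_Rintegral f g : rint f -> rint g -> (\forall x \ae mu, f x <= g x) ->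
  \int[mu]_x f x <= \int[mu]_x g x.
Proof.
move=> F G H; rewrite -subr_ge0 -RintegralB//.
have FG := rintB G F.
have -> : \int[mu]_x (g x - f x) = \int[mu]_x `|g x - f x|.
  congr fine; apply: ae_eq_integral => //.
  - exact: measurable_int FG.
  - exact/measurable_int/rint_norm.
  - by apply: filterS H => x H _ /=; rewrite ger0_norm// subr_ge0.
exact: Rintegral_ge0.
Qed.

Lemma ae_eq_Rintegral f g : rint f -> rint g -> (\forall x \ae mu, f x = g x) ->
  \int[mu]_x f x = \int[mu]_x g x.
Proof.
move=> F G H; apply/eqP; rewrite eq_le; apply/andP; split;
  apply: ae_le_Rintegral => //; by apply: filterS H => x ->.
Qed.

End real_integrable.

Section complex_measurable.
Context dd (T : measurableType dd) (R : realType).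
Local Notation C := R[i].
Implicit Types f g : T -> C.

Definition cmeas f := measurable_fun setT (fun x => complex.Re (f x)) /\
  measurable_fun setT (fun x => complex.Im (f x)).

Lemma cmeas_cst (c : C) : cmeas (fun=> c).
Proof. by split; exact: measurable_cst. Qed.

Lemma cmeasD f g : cmeas f -> cmeas g -> cmeas (fun x => f x + g x).
Proof.
move=> [f1 f2] [g1 g2]; split.
  by under eq_fun do rewrite raddfD; exact: measurable_funD.
by under eq_fun do rewrite raddfD; exact: measurable_funD.
Qed.

Lemma cmeasB f g : cmeas f -> cmeas g -> cmeas (fun x => f x - g x).
Proof.
move=> [f1 f2] [g1 g2]; split.
  by under eq_fun do rewrite raddfB; exact: measurable_funB.
by under eq_fun do rewrite raddfB; exact: measurable_funB.
Qed.

Lemma complex_ReM (a b : C) : complex.Re (a * b) =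
  complex.Re a * complex.Re b - complex.Im a * complex.Im b.
Proof. by case: a b => [? ?] [? ?]. Qed.

Lemma complex_ImM (a b : C) : complex.Im (a * b) =
  complex.Re a * complex.Im b + complex.Im a * complex.Re b.
Proof. by case: a b => [? ?] [? ?]. Qed.

Lemma cmeasM f g : cmeas f -> cmeas g -> cmeas (fun x => f x * g x).
Proof.
move=> [f1 f2] [g1 g2]; split.
  under eq_fun do rewrite complex_ReM.
  by apply: measurable_funB; exact: measurable_funM.
under eq_fun do rewrite complex_ImM.
by apply: measurable_funD; exact: measurable_funM.
Qed.

Lemma cmeasZ (c : C) f : cmeas f -> cmeas (fun x => c * f x).
Proof. by apply: cmeasM; exact: cmeas_cst. Qed.

Lemma cmeas_real (f : T -> R) : measurable_fun setT f -> cmeas (fun x => (f x)%:C).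
Proof. by move=> mf; split => //=; exact: measurable_cst. Qed.

Lemma cmeas_normc f : cmeas f -> measurable_fun setT (fun x => normc (f x)).
Proof.
move=> [f1 f2].
have -> : (fun x => normc (f x)) = @Num.sqrt R \o
  (fun x => complex.Re (f x) ^+ 2 + complex.Im (f x) ^+ 2).
  by apply/funext => x /=; case: (f x).
apply: measurableT_comp; first by apply: continuous_measurable_fun; exact: sqrt_continuous.
by apply: measurable_funD; exact: measurable_funX.
Qed.

Lemma cmeas_cvg (u : nat -> T -> C) f : (forall n, cmeas (u n)) ->
  (forall x e, 0 < e -> exists N, forall n, (N <= n)%N -> normc (u n x - f x) <= e) ->
  cmeas f.
Proof.
move=> mu H; split.
- apply: (measurable_fun_cvg (h := fun n x => complex.Re (u n x))) => //.
    by move=> n; have [] := mu n.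
  move=> x _; apply/cvgrPdist_le => e e0; have [N HN] := H x e e0.
  exists N => // n /= /HN; apply: le_trans.
  by rewrite distrC -raddfB normc_Re.
- apply: (measurable_fun_cvg (h := fun n x => complex.Im (u n x))) => //.
    by move=> n; have [] := mu n.
  move=> x _; apply/cvgrPdist_le => e e0; have [N HN] := H x e e0.
  exists N => // n /= /HN; apply: le_trans.
  by rewrite distrC -raddfB normc_Im.
Qed.

End complex_measurable.

Lemma cmeas_comp d1 d2 (T1 : measurableType d1) (T2 : measurableType d2) (R : realType)
  (f : T2 -> R[i]) (g : T1 -> T2) :
  measurable_fun setT g -> cmeas f -> cmeas (fun x => f (g x)).
Proof.
move=> mg [f1 f2]; split.
  by rewrite -[X in measurable_fun _ X]/((fun x => complex.Re (f x)) \o g); exact: measurableT_comp.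
by rewrite -[X in measurable_fun _ X]/((fun x => complex.Im (f x)) \o g); exact: measurableT_comp.
Qed.

(** * The space L^1 and its norm *)

Section L1_theory.
Context (R : realType) (d : nat).
Local Notation E := (Rd R d).
Local Notation C := R[i].
Local Notation mu := (lebesgue_Rd R d).
Local Notation L1 := (@L1 R d).
Implicit Types f g : E -> C.

Lemma L1_cmeas f : L1 f -> cmeas f.
Proof. by move=> [/rint_meas ? /rint_meas ?]. Qed.

Lemma L1_int f : L1 f -> rint mu (fun x => normc (f x)).
Proof.
move=> Lf; have [f1 f2] := Lf.
apply: rint_le (rintD (rint_norm f1) (rint_norm f2)) _.
  exact/cmeas_normc/L1_cmeas.
by apply: aeW => x; rewrite ger0_norm ?normc_ge0// normc_le_ReIm.
Qed.

Lemma L1_le f (g : E -> R) : cmeas f -> rint mu g ->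
  (\forall x \ae mu, normc (f x) <= g x) -> L1 f.
Proof.
move=> [f1 f2] G H; split; apply: rint_le G _ => //.
  by apply: filterS H => x; apply: le_trans; exact: normc_Re.
by apply: filterS H => x; apply: le_trans; exact: normc_Im.
Qed.

Lemma L1D f g : L1 f -> L1 g -> L1 (fun x => f x + g x).
Proof.
move=> F G; apply: L1_le (rintD (L1_int F) (L1_int G)) _.
  by apply: cmeasD; exact: L1_cmeas.
by apply: aeW => x; exact: le_normcD.
Qed.

Lemma L1Z (c : C) f : L1 f -> L1 (fun x => c * f x).
Proof.
move=> F; apply: L1_le (rintZ (normc c) (L1_int F)) _.
  by apply: cmeasZ; exact: L1_cmeas.
by apply: aeW => x; rewrite normcM.
Qed.

Lemma L1B f g : L1 f -> L1 g -> L1 (fun x => f x - g x).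
Proof.
move=> F /(L1Z (-1)) /(L1D F); congr L1.
by apply/funext => x; rewrite mulN1r.
Qed.

Lemma L1_0 : L1 (fun=> 0).
Proof. by split; exact: rint0. Qed.

Lemma L1_line f g w : L1 f -> L1 g -> L1 (line f g w).
Proof. by move=> F G; apply: L1D => //; exact: L1Z. Qed.

Lemma L1normE f : L1norm f = \int[mu]_x normc (f x).
Proof.
rewrite /L1norm Lnorm1 /Rintegral; congr fine; apply: eq_integral => x _ /=.
by rewrite ger0_norm// normc_ge0.
Qed.

Lemma L1norm_ge0 f : 0 <= L1norm f.
Proof. by rewrite L1normE; apply: Rintegral_ge0 => x _; exact: normc_ge0. Qed.

Lemma L1norm_le f (g : E -> R) : L1 f -> rint mu g ->
  (\forall x \ae mu, normc (f x) <= g x) -> L1norm f <= \int[mu]_x g x.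
Proof. by move=> F G H; rewrite L1normE; apply: ae_le_Rintegral => //; exact: L1_int. Qed.

Lemma L1normD f g : L1 f -> L1 g -> L1norm (fun x => f x + g x) <= L1norm f + L1norm g.
Proof.
move=> F G; rewrite [in leRHS]L1normE [in leRHS]L1normE.
rewrite -RintegralD//; [|exact: L1_int|exact: L1_int].
apply: L1norm_le; first exact: L1D.
  by apply: rintD; exact: L1_int.
by apply: aeW => x; exact: le_normcD.
Qed.

Lemma L1normZ (c : C) f : L1 f -> L1norm (fun x => c * f x) = normc c * L1norm f.
Proof.
move=> F; rewrite !L1normE -RintegralZl//; last exact: L1_int.
by apply: eq_Rintegral => x _; rewrite normcM.
Qed.

Lemma L1norm0 : L1norm (fun _ : E => 0 : C) = 0.
Proof.
rewrite L1normE; under eq_Rintegral do rewrite normc0.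
by rewrite Rintegral_cst// mul0r.
Qed.

Lemma L1norm_line f g w : L1 f -> L1 g -> L1norm (line f g w) <= L1norm f + normc w * L1norm g.
Proof. by move=> F G; rewrite -L1normZ//; apply: L1normD => //; exact: L1Z. Qed.

Lemma CintegralD f g : L1 f -> L1 g ->
  Cintegral (fun x => f x + g x) = Cintegral f + Cintegral g.
Proof.
move=> [f1 f2] [g1 g2]; rewrite /Cintegral.
under eq_Rintegral do rewrite raddfD.
under [X in _ +i* X]eq_Rintegral do rewrite raddfD.
by rewrite !RintegralD.
Qed.

Lemma CintegralZ (c : C) f : L1 f ->
  Cintegral (fun x => c * f x) = c * Cintegral f.
Proof.
move=> [f1 f2]; rewrite /Cintegral.
under eq_Rintegral do rewrite complex_ReM.
under [X in _ +i* X]eq_Rintegral do rewrite complex_ImM.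
rewrite RintegralB ?RintegralD; try exact: rintZ; try by [].
by rewrite !RintegralZl//; case: c => a b /=.
Qed.

Lemma CintegralB f g : L1 f -> L1 g ->
  Cintegral (fun x => f x - g x) = Cintegral f - Cintegral g.
Proof.
move=> F G; under [in LHS]eq_fun do rewrite -mulN1r.
by rewrite CintegralD// ?CintegralZ ?mulN1r//; exact: L1Z.
Qed.

Lemma Cintegral_ae f g : L1 f -> L1 g -> (\forall x \ae mu, f x = g x) ->
  Cintegral f = Cintegral g.
Proof.
move=> [f1 f2] [g1 g2] H; congr Complex; apply: ae_eq_Rintegral => //;
  by apply: filterS H => x ->.
Qed.

Lemma conjcM_normc (w : C) : w^*%C * w = (normc w ^+ 2)%:C.
Proof.
case: w => a b; rewrite /normc sqr_sqrtr ?addr_ge0 ?sqr_ge0//.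
by apply/eqP; rewrite eq_complex/=; apply/andP; split; apply/eqP; ring.
Qed.

Lemma normc_conj (w : C) : normc w^*%C = normc w.
Proof. by case: w => a b; rewrite /normc /= sqrrN. Qed.

(* [|I|^2 = int Re (conj I f)] for [I = int f] *)
Lemma normc_Cintegral f : L1 f -> normc (Cintegral f) <= L1norm f.
Proof.
move=> F; set I := Cintegral f.
have [I0|I0] := eqVneq I 0; first by rewrite I0 normc0 L1norm_ge0.
have n0 : 0 < normc I by rewrite normc_gt0.
have : normc I ^+ 2 <= normc I * L1norm f.
  have -> : normc I ^+ 2 = \int[mu]_x complex.Re (I^*%C * f x).
    by have := CintegralZ I^*%C F; rewrite conjcM_normc => /(congr1 (@complex.Re R)) /= <-.
  rewrite L1normE -RintegralZl//; last exact: L1_int.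
  apply: ae_le_Rintegral.
  - by have [] := L1Z I^*%C F.
  - by apply: rintZ; exact: L1_int.
  - apply: aeW => x; apply: le_trans (ler_norm _) _.
    by apply: le_trans (normc_Re _) _; rewrite normcM normc_conj.
by rewrite expr2 ler_pM2l.
Qed.

End L1_theory.

(** * Entire functionals and their variational derivatives *)

Section entire_functionals.
Context (R : realType) (d : nat).
Local Notation E := (Rd R d).
Local Notation C := R[i].
Local Notation mu := (lebesgue_Rd R d).
Local Notation L1 := (@L1 R d).
Implicit Types (B : (E -> C) -> C) (th h : E -> C).

(** The inequality [Enorm alpha B <= K] without extended reals. *)
Definition Ebound (alpha : R) B (K : R) := forall th, L1 th ->
  normc (B th) <= K * expR (alpha^-1 * L1norm th).

(** The directional derivative, later identified with the integral of [delta B(th; .) h]; all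
    estimates are made on it, before a density is known to exist. *)
Definition vder B th h : C := cder (fun w => B (line th h w)) 0.

Lemma line0 th h : line th h 0 = th.
Proof. by apply/funext => x; rewrite /line mul0r addr0. Qed.

Lemma line_shift th h a w : line th h (a + w) = line (line th h a) h w.
Proof. by apply/funext => x; rewrite /line; ring. Qed.

Lemma entire_line B th h : entire B -> L1 th -> L1 h ->
  centire (fun w => B (line th h w)).
Proof. by move=> [_ _ H] Lt Lh w; apply/derivable_cdiff; exact: H. Qed.

Variables (alpha : R) (B : (E -> C) -> C) (K : R).
Hypothesis alpha_gt0 : 0 < alpha.
Hypothesis B_entire : entire B.
Hypothesis BK : Ebound alpha B K.

Lemma Ebound_ge0 : 0 <= K.
Proof.
have := BK (L1_0 R d); rewrite L1norm0 mulr0 expR0 mulr1.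
by apply: le_trans; exact: normc_ge0.
Qed.

Definition Bball (r : R) := K * expR (alpha^-1 * r).

Lemma Bball_ge0 r : 0 <= Bball r.
Proof. by rewrite mulr_ge0 ?Ebound_ge0// expR_ge0. Qed.

Lemma Bball_le th r : L1 th -> L1norm th <= r -> normc (B th) <= Bball r.
Proof.
move=> Lt tr; apply: le_trans (BK Lt) _; rewrite ler_wpM2l ?Ebound_ge0//.
by rewrite ler_expR ler_pM2l// invr_gt0.
Qed.

Lemma Bline_le th h w r : L1 th -> L1 h -> L1norm th + normc w * L1norm h <= r ->
  normc (B (line th h w)) <= Bball r.
Proof.
move=> Lt Lh H; apply: Bball_le; first exact: L1_line.
by apply: le_trans H; exact: L1norm_line.
Qed.

Lemma vder_le th h r : L1 th -> L1 h -> 0 < r ->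
  normc (vder B th h) <= Bball (L1norm th + r * L1norm h) / r.
Proof.
move=> Lt Lh r0; apply: cder_bound => //; first exact: entire_line.
move=> w wr; rewrite add0r; apply: Bline_le => //.
by rewrite lerD2l ler_wpM2r// L1norm_ge0.
Qed.

(** In the direction [b - a], of norm at most [s], the disc of radius [2 / s] moves [a] by at most
    2, so Cauchy's estimate gains the factor [s]. A number [s > 0] replaces the norm, which may be
    zero. *)
Lemma entire_lip a b s : L1 a -> L1 b -> 0 < s -> s <= 1 ->
  L1norm (fun x => b x - a x) <= s ->
  normc (B b - B a) <= Bball (L1norm a + 2) * s.
Proof.
move=> La Lb s0 s1 ab.
have Lh := L1B Lb La; set h := fun x => _ in ab Lh.
have -> : b = line a h (0 + 1).
  by apply/funext => x; rewrite /line /h; ring.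
have -> : B a = B (line a h 0) by rewrite line0.
rewrite -[leRHS]mulr1 -{2}(normc1 R) -{1}[s]invrK.
apply: (@centire_lip _ (fun w => B (line a h w))).
- exact: entire_line.
- by rewrite invr_gt0.
- move=> k; rewrite add0r => ks; apply: Bline_le => //.
  rewrite lerD2l; apply: (le_trans (y := (2 * s^-1) * s)).
    by apply: ler_pM => //; [exact: normc_ge0|exact: L1norm_ge0].
  by rewrite mulfVK// gt_eqF.
- by rewrite normc1 invf_ge1.
Qed.

Lemma vder_taylor th h w rho : L1 th -> L1 h ->
  L1norm th + 3 * L1norm h <= rho -> normc w <= 1 ->
  normc (B (line th h w) - B th - vder B th h * w) <= Bball rho * normc w ^+ 2.
Proof.
move=> Lt Lh H w1.
have := @centire_taylor2 _ (fun w => B (line th h w)) 0 w 1 (Bball rho)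
  (entire_line B_entire Lt Lh) ltr01.
rewrite line0 add0r expr1n divr1; apply => // k k3.
rewrite add0r; apply: Bline_le => //; apply: le_trans H; rewrite lerD2l.
by rewrite ler_wpM2r ?L1norm_ge0//; rewrite mulr1 in k3.
Qed.

(** Holomorphy on complex lines does not give additivity directly. The increment along
    [t * (h1 + h2)] is compared with a step along [t * h1] followed by one along [t * h2]: three
    Taylor remainders and the displacement of the base point of the second derivative are each at
    most [M * t ^+ 2]. *)
Lemma vderD th h1 h2 : L1 th -> L1 h1 -> L1 h2 ->
  vder B th (fun x => h1 x + h2 x) = vder B th h1 + vder B th h2.
Proof.
move=> Lt L1h L2h; have L12 := L1D L1h L2h.
set h12 := fun x => _ in L12 *.
have [nt n1 n2] := And3 (L1norm_ge0 th) (L1norm_ge0 h1) (L1norm_ge0 h2).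
have n12 : L1norm h12 <= L1norm h1 + L1norm h2 by exact: L1normD.
pose rho := L1norm th + 3 * (L1norm h1 + L1norm h2).
set M := Bball rho; have M0 : 0 <= M := Bball_ge0 _.
apply/eqP; rewrite -subr_eq0; apply/eqP/eq0_normc/eqP.
rewrite eq_le normc_ge0 andbT.
suff main : forall t : R, 0 < t -> t <= 1 ->
    normc (vder B th h12 - (vder B th h1 + vder B th h2)) <= 4 * M * t.
  apply/ler_addgt0Pr => e e0; rewrite add0r.
  have c0 : 0 < 4 * M + 1 by lra.
  pose t := Num.min 1 (e / (4 * M + 1)).
  have t0 : 0 < t by rewrite /t lt_min ltr01 divr_gt0.
  have t1 : t <= 1 by rewrite /t ge_min lexx.
  apply: le_trans (main t t0 t1) _.
  apply: (le_trans (y := 4 * M * (e / (4 * M + 1)))).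
    apply: ler_wpM2l; first by rewrite mulr_ge0.
    by rewrite /t ge_min lexx orbT.
  by rewrite mulrA ler_pdivrMr//; nra.
move=> t t0 t1; set w : C := t%:C.
have nw : normc w = t by rewrite normcR ger0_norm// ltW.
have w1 : normc w <= 1 by rewrite nw.
have T12 := vder_taylor (rho := rho) Lt L12 ltac:(rewrite /rho; lra) w1.
have T1 := vder_taylor (rho := rho) Lt L1h ltac:(rewrite /rho; lra) w1.
have L1w : L1 (line th h1 w) by exact: L1_line.
have nl : L1norm (line th h1 w) <= L1norm th + L1norm h1.
  by apply: le_trans (L1norm_line w Lt L1h) _; rewrite nw lerD2l ler_piMl.
have T2 := vder_taylor (rho := rho) L1w L2h ltac:(rewrite /rho; lra) w1.
have D2 : normc (vder B (line th h1 w) h2 - vder B th h2) <= M * t.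
  rewrite /vder; have F1 := entire_line B_entire L1w L2h.
  have F2 := entire_line B_entire Lt L2h.
  have <- : cder (fun k => B (line (line th h1 w) h2 k) - B (line th h2 k)) 0 =
     cder (fun k => B (line (line th h1 w) h2 k)) 0 - cder (fun k => B (line th h2 k)) 0.
    by apply/cder_val/cdiffB; exact: cderP.
  rewrite -[leRHS]divr1; apply: cder_bound => //; first exact: centireB.
  move=> k k1; rewrite add0r.
  have -> : line (line th h1 w) h2 k = line (line th h2 k) h1 (0 + w).
    by apply/funext => x; rewrite /line; ring.
  have -> : B (line th h2 k) = B (line (line th h2 k) h1 0) by rewrite line0.
  rewrite -nw -[M in leRHS]divr1.
  have Lk : L1 (line th h2 k) by exact: L1_line.
  have nk : L1norm (line th h2 k) <= L1norm th + L1norm h2.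
    by apply: le_trans (L1norm_line k Lt L2h) _; rewrite lerD2l ler_piMl.
  apply: (@centire_lip _ (fun w => B (line (line th h2 k) h1 w)) 0 w 1 M) => //.
    exact: entire_line.
  move=> j; rewrite add0r mulr1 => j2; apply: Bline_le => //.
  have : normc j * L1norm h1 <= 2 * L1norm h1 by rewrite ler_wpM2r.
  by rewrite /rho; lra.
have E12 : line (line th h1 w) h2 w = line th h12 w.
  by apply/funext => x; rewrite /line /h12; ring.
rewrite E12 in T2.
rewrite -(ler_pM2r t0).
have -> : normc (vder B th h12 - (vder B th h1 + vder B th h2)) * t =
  normc ((vder B th h12 - (vder B th h1 + vder B th h2)) * w) by rewrite normcM nw.
have -> : (vder B th h12 - (vder B th h1 + vder B th h2)) * w =
   (B (line th h12 w) - B (line th h1 w) - vder B (line th h1 w) h2 * w)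
   + (B (line th h1 w) - B th - vder B th h1 * w)
   - (B (line th h12 w) - B th - vder B th h12 * w)
   + (vder B (line th h1 w) h2 - vder B th h2) * w by ring.
apply: le_trans (le_normcD _ _) _; rewrite normcM nw.
apply: le_trans (lerD (normcB _ _) (lexx _)) _.
apply: le_trans (lerD (lerD (le_normcD _ _) (lexx _)) (lexx _)) _.
rewrite nw in T1 T2 T12.
have D3 : normc (vder B (line th h1 w) h2 - vder B th h2) * t <= M * t * t.
  by rewrite ler_wpM2r// ltW.
rewrite -/M !expr2 in T1 T2 T12; nra.
Qed.

Lemma vderZ th h c : L1 th -> L1 h -> vder B th (fun x => c * h x) = c * vder B th h.
Proof.
move=> Lt Lh; apply: cder_val.
have -> : (fun w => B (line th (fun x => c * h x) w)) = (fun w => B (line th h (0 + w * c))).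
  apply/funext => w; congr (B _); apply/funext => x; rewrite /line add0r; ring.
rewrite mulrC; apply: (@cdiff_comp _ (fun w => B (line th h w)) (fun w => 0 + w * c)).
  exact: cdiff_affine.
by rewrite mul0r addr0; apply: cderP; exact: entire_line.
Qed.

(** Cauchy's estimate with a radius slightly below [1 / L1norm h]; the slack [e / (M + 1)] covers
    directions of norm zero and disappears with [e]. *)
Lemma vder_le_lin th h : L1 th -> L1 h ->
  normc (vder B th h) <= Bball (L1norm th + 1) * L1norm h.
Proof.
move=> Lt Lh; have n0 := L1norm_ge0 h; apply/ler_addgt0Pr => e e0.
set M := Bball _; have M0 : 0 <= M := Bball_ge0 _.
have M1 : 0 < M + 1 by lra.
pose s := L1norm h + e / (M + 1).
have s0 : 0 < s by rewrite ltr_wpDl// divr_gt0.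
apply: le_trans (vder_le (r := s^-1) Lt Lh _) _; first by rewrite invr_gt0.
rewrite invrK; apply: (le_trans (y := M * s)).
  rewrite ler_wpM2r ?(ltW s0)// ler_wpM2l ?Ebound_ge0// ler_expR ler_pM2l ?invr_gt0//.
  by rewrite lerD2l mulrC ler_pdivrMr// mul1r /s lerDl divr_ge0// ltW.
rewrite /s mulrDr lerD2l mulrA ler_pdivrMr//; nra.
Qed.

(** Difference quotients of [B] in the direction [h] are entire in [w] and converge locally
    uniformly, by the second-order remainder. *)
Lemma centire_vder t0 t1 h : L1 t0 -> L1 t1 -> L1 h ->
  centire (fun w => vder B (line t0 t1 w) h).
Proof.
move=> Lt0 Lt1 Lh; apply: centire_uniform_limit => a; exists 1 => // e e0.
pose rho := L1norm t0 + (normc a + 1) * L1norm t1 + 3 * L1norm h.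
set M := Bball rho; have M0 : 0 <= M := Bball_ge0 _.
pose s := Num.min 1 (e / (M + 1)).
have s0 : 0 < s by rewrite /s lt_min ltr01 divr_gt0//; lra.
have s1 : s <= 1 by rewrite /s ge_min lexx.
have sM : M * s <= e.
  apply: (le_trans (y := M * (e / (M + 1)))).
    by rewrite ler_wpM2l// /s ge_min lexx orbT.
  by rewrite mulrA ler_pdivrMr; nra.
have ns : normc s%:C = s by rewrite normcR ger0_norm// ltW.
exists (fun w => (B (line (line t0 t1 w) h s%:C) - B (line t0 t1 w)) * (s%:C)^-1).
  apply: centireM; last exact: centire_cst.
  apply: centireB; last exact: entire_line.
  have -> : (fun w => B (line (line t0 t1 w) h s%:C)) =
    (fun w => B (line (line t0 h s%:C) t1 w)).
    by apply/funext => w; congr (B _); apply/funext => x; rewrite /line; ring.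
  by apply: entire_line => //; exact: L1_line.
move=> k k1; have La : L1 (line t0 t1 (a + k)) by exact: L1_line.
have s00 : s%:C != 0 by rewrite -normc_gt0 ns.
rewrite -(ler_pM2r s0) -[X in _ * X <= _]ns -normcM mulrBl mulfVK//.
have := @vder_taylor _ h s%:C rho La Lh _ _.
rewrite ns expr2 mulrA => H; apply: le_trans (H _ s1) _.
  rewrite lerD2r; apply: le_trans (L1norm_line _ Lt0 Lt1) _.
  rewrite lerD2l ler_wpM2r ?L1norm_ge0//.
  by apply: le_trans (le_normcD _ _) _; rewrite lerD2l.
by rewrite ler_wpM2r// ltW.
Qed.

(** The generator pairs [delta B(theta)] with [theta] itself, so base point and direction move
    together; linearity in the direction separates them. *)
Lemma centire_vder_diag t0 t1 : L1 t0 -> L1 t1 ->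
  centire (fun w => vder B (line t0 t1 w) (line t0 t1 w)).
Proof.
move=> Lt0 Lt1.
have -> : (fun w => vder B (line t0 t1 w) (line t0 t1 w)) =
  (fun w => vder B (line t0 t1 w) t0 + w * vder B (line t0 t1 w) t1).
  apply/funext => w; have Lw := L1_line w Lt0 Lt1.
  by rewrite {2}/line vderD// ?vderZ//; exact: L1Z.
apply: centireD; first exact: centire_vder.
by apply: centireM; [exact: centire_id|exact: centire_vder].
Qed.

End entire_functionals.

(** * Bounded functionals on L^1 and their densities *)

Section dominated.
Context dd (T : measurableType dd) (R : realType) (mu : {measure set T -> \bar R}).

Lemma rint_dct (u : nat -> T -> R) (f g : T -> R) :
  (forall n, measurable_fun setT (u n)) -> rint mu g ->
  (forall n x, `|u n x| <= g x) -> (forall x, u n x @[n --> \oo] --> f x) ->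
  rint mu f /\ forall e, 0 < e -> exists N, forall n, (N <= n)%N ->
    \int[mu]_x `|u n x - f x| <= e.
Proof.
move=> mu_ ig ug uf.
have mf : measurable_fun setT f.
  by apply: (measurable_fun_cvg (h := u)) => // x _; exact: uf.
have [|||||] := @dominated_convergence _ _ _ mu setT measurableT
    (fun n => EFin \o u n) (EFin \o f) (EFin \o g).
- by move=> n; exact/measurable_EFinP.
- exact/measurable_EFinP.
- by apply: aeW => x _; apply: cvg_EFin; [exact: nearW|exact: uf].
- exact: ig.
- by apply: aeW => x n _ /=; rewrite lee_fin.
move=> if_ cv _; split => // e e0.
have : (fun n => \int[mu]_x `|u n x - f x|) @ \oo --> (0 : R).
  exact: (fine_cvg cv).
move=> /cvgrPdist_le/(_ e e0)[N _ HN]; exists N => n /HN.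
by rewrite sub0r normrN; apply: le_trans; exact: ler_norm.
Qed.

End dominated.

Section integrable_weight.
Context dd (T : measurableType dd) (R : realType).
Variable mu : {sigma_finite_measure set T -> \bar R}.

(** A series of indicators of a sigma-finite cover [F]: the coefficients [2^-(i+1) / (1 + mu (F i))]
    bound both the sum at each point and its integral by 1. *)
Lemma integrable_weight : exists2 w : T -> R, rint mu w & forall x, 0 < w x.
Proof.
have [F TF mF] := sigma_finiteT mu.
pose c i : R := (2 ^ i.+1)%:R^-1 / (1 + fine (mu (F i))).
have m0 i : 0 <= fine (mu (F i)) by rewrite fine_ge0.
have p0 i : 0 < 1 + fine (mu (F i)) by rewrite ltr_pwDl.
have q0 i : 0 < (2 ^ i.+1)%:R^-1 :> R by rewrite invr_gt0 ltr0n expn_gt0.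
have c0 i : 0 < c i by rewrite divr_gt0.
pose h i x : \bar R := (c i * \1_(F i) x)%:E.
have h0 i x : (0 <= h i x)%E by rewrite lee_fin mulr_ge0// ltW.
have mh i : measurable_fun setT (h i).
  apply/measurable_EFinP; apply: measurable_funM => //.
  by apply: measurable_indic; have [] := mF i.
pose W x := (\sum_(i <oo) h i x)%E.
have mW : measurable_fun setT W.
  exact: (@ge0_emeasurable_sum _ _ _ _ h predT).
have geom : (\sum_(i <oo) ((2 ^ i.+1)%:R^-1)%:E <= (1 : R)%:E)%E.
  have := @epsilon_trick0 R 1 predT ler01.
  by under eq_eseriesr do rewrite mul1r.
have Wle x : (W x <= 1%:E)%E.
  apply: le_trans geom; apply: lee_nneseries => // i _.
  rewrite lee_fin /c indicE; case: (_ \in _); rewrite ?mulr0 ?mulr1 ?(ltW (q0 i))//.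
  by rewrite ler_pdivrMr// ler_peMr ?(ltW (q0 i))// lerDl.
have Wfin x : W x \is a fin_num.
  rewrite ge0_fin_numE; first exact: le_lt_trans (Wle x) (ltry _).
  exact: nneseries_ge0.
exists (fine \o W); last first.
  move=> x; have [i _ Fix] : (\bigcup_i F i) x by rewrite -TF.
  rewrite /= -lte_fin fineK//; apply: (@lt_le_trans _ _ (h i x)).
    by rewrite lte_fin indicE mem_set// mulr1.
  apply: le_trans (nneseries_lim_ge i.+1 _) => //.
  by rewrite big_nat_recr//= leeDr// sume_ge0.
have -> : rint mu (fine \o W) = mu.-integrable setT W.
  by rewrite /rint; congr integrable; apply/funext => x /=; rewrite fineK.
apply/integrableP; split => //.
under eq_integral do rewrite gee0_abs ?nneseries_ge0//.
rewrite integral_nneseries//.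
apply: le_lt_trans (ltry 1); apply: le_trans geom.
apply: lee_nneseries => [i _ _|i _]; first exact: integral_ge0.
have [mFi Fioo] := mF i; rewrite /h.
under eq_integral do rewrite EFinM.
rewrite ge0_integralZl//; try by [apply/measurable_EFinP; exact: measurable_indic
  | move=> x _; rewrite lee_fin | rewrite lee_fin ltW].
rewrite integral_indic// setIT.
rewrite [X in (_ * X)%E](_ : _ = (fine (mu (F i)))%:E); last first.
  by rewrite fineK// ge0_fin_numE.
rewrite -EFinM lee_fin /c.
by rewrite mulrAC ler_pdivrMr// ler_wpM2l ?(ltW (q0 i))// lerDr.
Qed.

End integrable_weight.

Import HBNNSimple.

Section L1_dual.
Context dd (T : measurableType dd) (R : realType).
Variable mu : {sigma_finite_measure set T -> \bar R}.
Variables (lam : (T -> R) -> R) (A : R) (w : T -> R).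
Hypothesis lamD : forall f g, rint mu f -> rint mu g ->
  lam (fun x => f x + g x) = lam f + lam g.
Hypothesis lamZ : forall c f, rint mu f -> lam (fun x => c * f x) = c * lam f.
Hypothesis lam_le : forall f, rint mu f -> `|lam f| <= A * \int[mu]_x `|f x|.
Hypothesis A_ge0 : 0 <= A.
Hypothesis iw : rint mu w.
Hypothesis w_gt0 : forall x, 0 < w x.

Let lamB f g : rint mu f -> rint mu g -> lam (fun x => f x - g x) = lam f - lam g.
Proof.
move=> F G; under eq_fun do rewrite -mulN1r.
by rewrite lamD// ?lamZ ?mulN1r//; exact: rintZ.
Qed.

Let lam_le_pos f : rint mu f -> `|lam f| <= (`|A| + 1) * \int[mu]_x `|f x|.
Proof.
move=> F; apply: le_trans (lam_le F) _; rewrite ler_wpM2r//.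
  by apply: Rintegral_ge0 => x _.
by apply: le_trans (ler_norm _) _; rewrite lerDl.
Qed.

Let lam_dct (u : nat -> T -> R) (f g : T -> R) :
  (forall n, measurable_fun setT (u n)) -> rint mu g ->
  (forall n x, `|u n x| <= g x) -> (forall x, u n x @[n --> \oo] --> f x) ->
  lam (u n) @[n --> \oo] --> lam f.
Proof.
move=> mu_ ig ug uf; have [F H] := rint_dct mu_ ig ug uf.
have U n : rint mu (u n) by apply: rint_le ig _ => //; exact: aeW.
apply/cvgrPdist_le => e e0.
have A1 : 0 < `|A| + 1 by rewrite ltr_wpDl.
have [N HN] := H (e / (`|A| + 1)) ltac:(by rewrite divr_gt0).
exists N => // n /= /HN h; rewrite distrC -lamB//.
apply: le_trans (lam_le_pos (rintB (U n) F)) _.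
by rewrite mulrC -ler_pdivlMr.
Qed.

Let rint_windic S : measurable S -> rint mu (fun x => w x * \1_S x).
Proof.
move=> mS; apply: rint_le iw _.
  by apply: measurable_funM; [exact: rint_meas iw|exact: measurable_indic].
apply: aeW => x; rewrite normrM (gtr0_norm (w_gt0 x)) indicE.
by case: (_ \in _); rewrite ?normr1 ?normr0 ?mulr1 ?mulr0 ?(ltW (w_gt0 x)).
Qed.

Definition dual_charge (S : set T) : \bar R := (lam (fun x => w x * \1_S x))%:E.

Let dual_charge0 : dual_charge set0 = 0%E.
Proof.
rewrite /dual_charge; have -> : (fun x => w x * \1_(set0 : set T) x) = fun x => 0 * w x.
  by apply/funext => x; rewrite indic0 mulr0 mul0r.
by rewrite lamZ// mul0r.
Qed.

Let dual_charge_fin S : measurable S -> dual_charge S \is a fin_num.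
Proof. by []. Qed.

Let dual_charge_sigma_additive : semi_sigma_additive dual_charge.
Proof.
move=> F mF tF mUF.
pose u n x := w x * \1_(\bigcup_(i < n) F i) x.
have mU n : measurable (\bigcup_(i < n) F i) by exact: bigcup_measurable.
have uE : (fun n => \sum_(0 <= i < n) dual_charge (F i))%E = fun n => (lam (u n))%:E.
  apply/funext => n; elim: n => [|n IH].
    rewrite big_geq// /u; have -> : \bigcup_(i < 0) F i = set0 by apply: bigcup0.
    exact/esym/dual_charge0.
  rewrite big_nat_recr//= IH /dual_charge -EFinD -lamD ?(rint_windic (mU n)) ?rint_windic//.
  congr (lam _)%:E; apply/funext => x; rewrite /u -mulrDr; congr (_ * _).
  have -> : \bigcup_(i < n.+1) F i = \bigcup_(i < n) F i `|` F n.
    by rewrite !bigcup_mkord big_ord_recr.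
  rewrite !indicE in_setU.
  have [xn|xn] := boolP (x \in F n); last by rewrite orbF addr0.
  rewrite orbT; have [/set_mem[i /= ni Fi]|_] := boolP (x \in _); last by rewrite add0r.
  have := tF i n I I ltac:(by exists x; split => //; exact/set_mem) => iE.
  by move: ni; rewrite iE ltnn.
rewrite uE; apply: cvg_EFin; first exact: nearW.
apply: (lam_dct (g := w)) => //.
- by move=> n; exact: rint_meas (rint_windic (mU n)).
- move=> n x; rewrite normrM (gtr0_norm (w_gt0 x)) indicE.
  by case: (_ \in _); rewrite ?normr1 ?normr0 ?mulr1 ?mulr0 ?(ltW (w_gt0 x)).
- move=> x; have [[k _ Fk]|nF] := pselect ((\bigcup_i F i) x).
    apply/cvgrPdist_le => e e0; exists k.+1 => // n /= kn.
    rewrite /u !indicE !mem_set ?subrr ?normr0 ?(ltW e0)//.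
      by exists k.
    by exists k.
  apply/cvgrPdist_le => e e0; exists 0%N => // n /= _.
  rewrite /u !indicE !memNset ?subrr ?normr0 ?(ltW e0)//.
  by move=> [i _ Fi]; apply: nF; exists i.
Qed.

HB.instance Definition _ := isCharge.Build _ _ _ dual_charge
  dual_charge0 dual_charge_fin dual_charge_sigma_additive.

Let dual_charge_dominated : dual_charge `<< mu.
Proof.
apply/null_content_dominatesP => S mS S0; rewrite /dual_charge; congr EFin; apply/eqP; rewrite -normr_le0.
apply: le_trans (lam_le (rint_windic mS)) _.
have -> : \int[mu]_x `|w x * \1_S x| = \int[mu]_x 0.
  apply: ae_eq_Rintegral; [exact/rint_norm/rint_windic|exact: rint0|].
  exists S; split => // x /= H; apply: contrapT => nS; apply: H.
  by rewrite indicE memNset// mulr0 normr0.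
by rewrite Rintegral_cst// mul0r mulr0.
Qed.

Let rint_ge0_ae0 (k : T -> R) : rint mu k -> (forall x, 0 <= k x) ->
  \int[mu]_x k x <= 0 -> \forall x \ae mu, k x = 0.
Proof.
move=> ik k0 k_le; have mk := rint_meas ik.
have : (\int[mu]_x `|(EFin \o k) x| = 0)%E.
  under eq_integral do rewrite /= ger0_norm//.
  rewrite -[LHS]fineK; last exact: integrable_fin_num.
  congr EFin; apply/eqP; rewrite eq_le; apply/andP; split; first exact: k_le.
  exact: Rintegral_ge0.
move/ae_eq_integral_abs => /(_ measurableT (measurable_int _ ik)).
by apply: filterS => x /(_ I)[].
Qed.

Let dual_density : exists f : T -> R, rint mu f /\
  forall S, measurable S -> lam (fun x => w x * \1_S x) = \int[mu]_x (f x * \1_S x).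
Proof.
have nm := dual_charge_dominated.
pose RN := Radon_Nikodym (dual_charge : {charge set T -> \bar R}) mu.
have RNf x : RN x \is a fin_num by exact: Radon_Nikodym_fin_num.
have RNE : EFin \o (fine \o RN) = RN by apply/funext => x /=; rewrite fineK.
exists (fine \o RN); split.
  by rewrite /rint RNE; exact: Radon_Nikodym_integrable.
move=> S mS; have := Radon_Nikodym_integral nm mS.
rewrite -/RN -RNE => /(congr1 fine)/= ->.
rewrite -[LHS]/(\int[mu]_(x in S) (fine \o RN) x) Rintegral_mkcond.
by apply: eq_Rintegral => x _; rewrite patch_indic.
Qed.

Let rint_indic (f : T -> R) (S : set T) : rint mu f -> measurable S ->
  rint mu (fun x => f x * \1_S x).
Proof.
move=> F mS; apply: rint_le (rint_norm F) _.
  by apply: measurable_funM; [exact: rint_meas F|exact: measurable_indic].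
apply: aeW => x; rewrite normrM indicE.
by case: (_ \in _); rewrite ?normr1 ?normr0 ?mulr1 ?mulr0.
Qed.

Let lam_windic_le S : measurable S ->
  `|lam (fun x => w x * \1_S x)| <= A * \int[mu]_x (w x * \1_S x).
Proof.
move=> mS; apply: le_trans (lam_le (rint_windic mS)) _.
rewrite le_eqVlt; apply/orP; left; apply/eqP; congr (_ * _).
apply: eq_Rintegral => x _; rewrite ger0_norm// mulr_ge0 ?(ltW (w_gt0 x))//.
Qed.

(** Tested on the set [S] where the inequality fails, the nonnegative function [(f - A * w) * 1_S]
    has integral at most 0, hence vanishes almost everywhere. *)
Let ae_le_weight (f : T -> R) : rint mu f ->
  (forall S, measurable S -> \int[mu]_x (f x * \1_S x) <= A * \int[mu]_x (w x * \1_S x)) ->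
  \forall x \ae mu, f x <= A * w x.
Proof.
move=> F fS; pose S := [set x | A * w x < f x].
have mS : measurable S.
  have := measurable_fun_ltr (measurable_funM (measurable_cst A) (rint_meas iw)) (rint_meas F).
  by move=> /(_ measurableT [set true]); rewrite setTI; apply.
have iS : rint mu (fun x => (f x - A * w x) * \1_S x).
  by apply: rint_indic => //; apply: rintB => //; exact: rintZ.
have := @rint_ge0_ae0 (fun x => (f x - A * w x) * \1_S x) iS.
move=> /(_ _ _) H; have {}H : \forall x \ae mu, (f x - A * w x) * \1_S x = 0.
  apply: H.
    move=> x; rewrite indicE; have [/set_mem xS|_] := boolP (x \in S).
      by rewrite mulr1 subr_ge0 ltW.
    by rewrite mulr0.
  have -> : \int[mu]_x ((f x - A * w x) * \1_S x) =
      \int[mu]_x (f x * \1_S x - A * (w x * \1_S x)).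
    by apply: eq_Rintegral => x _; ring.
  rewrite RintegralB//; [|exact: rint_indic|exact/rintZ/rint_windic].
  by rewrite RintegralZl ?subr_le0 ?fS//; exact: rint_windic.
apply: filterS H => x; rewrite indicE; have [/set_mem xS|nS] := boolP (x \in S).
  by rewrite mulr1 => /eqP; rewrite subr_eq0 => /eqP ->.
by move=> _; rewrite leNgt; apply/negP => h; move/negP: nS; apply; exact/mem_set.
Qed.

(* Radon-Nikodym for the charge [S |-> lam (w 1_S)]; the weight [w > 0] makes it
   finite although [mu] is only sigma-finite. *)
Lemma L1_dual_weight : exists g : T -> R,
  [/\ measurable_fun setT g, forall x, `|g x| <= A &
  forall S, measurable S -> lam (fun x => w x * \1_S x) = \int[mu]_x (g x * (w x * \1_S x))].
Proof.
have [f [F fS]] := dual_density.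
have mf := rint_meas F; have mw := rint_meas iw.
have up : \forall x \ae mu, f x <= A * w x.
  apply: ae_le_weight => // S mS; rewrite -fS//.
  by apply: le_trans (ler_norm _) _; exact: lam_windic_le.
have lo : \forall x \ae mu, - (A * w x) <= f x.
  suff : \forall x \ae mu, - f x <= A * w x by apply: filterS => x; rewrite lerNl.
  apply: ae_le_weight => [|S mS]; first exact: rintN.
  under eq_Rintegral do rewrite mulNr -mulN1r.
  rewrite RintegralZl//; last exact: rint_indic.
  rewrite -fS// mulN1r; apply: le_trans (ler_norm _) _.
  by rewrite normrN; exact: lam_windic_le.
(* The density [f / w], truncated so that its bound holds at every point; by [up] and [lo] this
   changes it on a null set only. *)
pose g x := Num.max (- A) (Num.min A (f x * (w x)^-1)).
have mg : measurable_fun setT g.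
  apply: measurable_maxr => //; apply: measurable_minr => //.
  apply: measurable_funM => //.
  have -> : (fun x => (w x)^-1) = fun x => expR (- ln (w x)).
    by apply/funext => x; rewrite expRN lnK// posrE.
  apply: measurableT_comp; first exact: measurable_expR.
  by apply: measurableT_comp => //; apply: measurableT_comp; [exact: measurable_ln|].
have gA x : `|g x| <= A.
  rewrite ler_norml /g le_max lexx/= ge_max ge_min lexx/= andbT.
  by rewrite (le_trans _ A_ge0)// oppr_le0.
exists g; split => // S mS; rewrite fS//.
have ig : rint mu (fun x => g x * (w x * \1_S x)).
  apply: rint_le (rintZ A iw) _.
    by apply: measurable_funM => //; exact: rint_meas (rint_windic mS).
  apply: aeW => x; rewrite !normrM (gtr0_norm (w_gt0 x)); apply: ler_pM => //.
    by rewrite mulr_ge0// ltW.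
  by rewrite indicE; case: (_ \in _); rewrite ?normr1 ?normr0 ?mulr1 ?mulr0// ltW.
apply: ae_eq_Rintegral => //; first exact: rint_indic.
apply: filterS2 up lo => x h1 h2; rewrite mulrA; congr (_ * _).
rewrite /g; have wx := w_gt0 x.
have -> : Num.min A (f x * (w x)^-1) = f x * (w x)^-1.
  by apply/min_idPr; rewrite ler_pdivrMr.
have -> : Num.max (- A) (f x * (w x)^-1) = f x * (w x)^-1.
  by apply/max_idPr; rewrite ler_pdivlMr// mulNr.
by rewrite mulfVK// gt_eqF.
Qed.

Let lam_simple (g : T -> R) (N : nat) (c : nat -> R) (S : nat -> set T) :
  measurable_fun setT g -> (forall x, `|g x| <= A) -> (forall i, measurable (S i)) ->
  (forall S, measurable S -> lam (fun x => w x * \1_S x) = \int[mu]_x (g x * (w x * \1_S x))) ->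
  let u x := \sum_(i < N) c i * (w x * \1_(S i) x) in
  rint mu u /\ lam u = \int[mu]_x (g x * u x).
Proof.
move=> mg gA mS gS; elim: N => [|N [IH1 IH2]] /=.
  split; first by under eq_fun do rewrite big_ord0; exact: rint0.
  have -> : (fun x => \sum_(i < 0) c i * (w x * \1_(S i) x)) = (fun x => 0 * w x).
    by apply/funext => x; rewrite big_ord0 mul0r.
  rewrite lamZ// mul0r; under eq_Rintegral do rewrite big_ord0 mulr0.
  by rewrite Rintegral_cst// mul0r.
have wi := rint_windic (mS N).
have gint f : rint mu f -> rint mu (fun x => g x * f x).
  move=> F; apply: rint_le (rintZ A (rint_norm F)) _.
    by apply: measurable_funM => //; exact: rint_meas F.
  by apply: aeW => x; rewrite normrM; apply: ler_pM.
have -> : (fun x => \sum_(i < N.+1) c i * (w x * \1_(S i) x)) =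
  (fun x => \sum_(i < N) c i * (w x * \1_(S i) x) + c N * (w x * \1_(S N) x)).
  by apply/funext => x; rewrite big_ord_recr.
split; first by apply: rintD => //; exact: rintZ.
rewrite lamD//; last exact: rintZ.
rewrite lamZ// IH2 gS// -RintegralZl//; last exact: gint.
rewrite -RintegralD//; [|exact: gint|exact/rintZ/gint].
by apply: eq_Rintegral => x _; rewrite ?big_ord_recr/=; ring.
Qed.

(** The charge only sees functions [w * 1_S]. A nonnegative [h] is therefore reached through simple
    approximations of [h / w], multiplied back by [w] and dominated by [h]; positive and negative
    parts do the rest. *)
Lemma L1_dual_real : exists g : T -> R,
  [/\ measurable_fun setT g, forall x, `|g x| <= A &
  forall f, rint mu f -> lam f = \int[mu]_x (g x * f x)].
Proof.
have [g [mg gA gS]] := L1_dual_weight; exists g; split => // f F.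
have mw := rint_meas iw.
have gint h : rint mu h -> rint mu (fun x => g x * h x).
  move=> H; apply: rint_le (rintZ A (rint_norm H)) _.
    by apply: measurable_funM => //; exact: rint_meas H.
  by apply: aeW => x; rewrite normrM; apply: ler_pM.
have pos h : rint mu h -> (forall x, 0 <= h x) -> lam h = \int[mu]_x (g x * h x).
  move=> H h0; pose k x := (h x * expR (- ln (w x)))%:E.
  have kE x : w x * fine (k x) = h x.
    by rewrite /= expRN lnK ?posrE// mulrCA mulfV ?mulr1// gt_eqF.
  have mk : measurable_fun setT k.
    apply/measurable_EFinP; apply: measurable_funM; first exact: rint_meas H.
    apply: measurableT_comp; first exact: measurable_expR.
    by apply: measurableT_comp => //; apply: measurableT_comp; [exact: measurable_ln|].
  have k0 x : setT x -> (0 <= k x)%E by rewrite lee_fin mulr_ge0// expR_ge0.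
  pose s n := nnsfun_approx measurableT mk n.
  pose u n x := w x * s n x.
  have mu_ n : measurable_fun setT (u n) by exact: measurable_funM.
  have ub n x : `|u n x| <= h x.
    rewrite /u normrM (gtr0_norm (w_gt0 x)) -[leRHS]kE ler_pM2l//.
    rewrite ger0_norm// -lee_fin fineK//.
    by rewrite /s nnsfun_approxE; exact: le_approx.
  have cu x : u n x @[n --> \oo] --> h x.
    rewrite -kE; apply: cvgM; first exact: cvg_cst.
    have := @cvg_nnsfun_approx _ _ _ _ measurableT _ mk k0 x I.
    by move=> /fine_cvg.
  have lu n : lam (u n) = \int[mu]_x (g x * u n x).
    have E : u n = (fun x => \sum_(i < #|` fset_set (s n @` setT)|)
       (fset_set (s n @` setT))`_i * (w x * \1_(s n @^-1` [set (fset_set (s n @` setT))`_i]) x)).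
      apply/funext => x; rewrite /u {1}fimfunEord mulr_sumr.
      by apply: eq_bigr => i _; ring.
    rewrite E; have := @lam_simple g #|` fset_set (s n @` setT)|
      (fun i => (fset_set (s n @` setT))`_i)
      (fun i => s n @^-1` [set (fset_set (s n @` setT))`_i]) mg gA _ gS.
    by move=> /(_ _)[]// i; exact: measurable_sfunP.
  have c1 := lam_dct mu_ H ub cu.
  have [_ H2] := rint_dct mu_ H ub cu.
  have U n : rint mu (u n) by apply: rint_le H _ => //; exact: aeW.
  have c2 : lam (u n) @[n --> \oo] --> \int[mu]_x (g x * h x).
    apply/cvgrPdist_le => e e0.
    have A1 : 0 < A + 1 by rewrite ltr_wpDl.
    have [N HN] := H2 (e / (A + 1)) ltac:(by rewrite divr_gt0).
    exists N => // n /= /HN hN; rewrite lu distrC -RintegralB//; try exact: gint.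
    apply: le_trans (le_normr_Rintegral measurableT (rintB (gint _ (U n)) (gint _ H))) _.
    apply: le_trans (_ : _ <= (A + 1) * \int[mu]_x `|u n x - h x|) _; last first.
      by rewrite mulrC -ler_pdivlMr.
    rewrite -RintegralZl//; last exact/rint_norm/rintB.
    apply: ae_le_Rintegral.
    - by apply/rint_norm/rintB; exact: gint.
    - by apply/rintZ/rint_norm/rintB.
    - apply: aeW => x; rewrite -mulrBr normrM ler_wpM2r//.
      by apply: le_trans (gA x) _; rewrite lerDl.
  exact: (cvg_unique (@norm_hausdorff _ _) c1 c2).
pose fp x := 2^-1 * (`|f x| + f x); pose fm x := 2^-1 * (`|f x| - f x).
have Fp : rint mu fp by apply/rintZ/rintD => //; exact: rint_norm.
have Fm : rint mu fm by apply/rintZ/rintB => //; exact: rint_norm.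
have fE : f = (fun x => fp x - fm x) by apply/funext => x; rewrite /fp /fm; field.
have [fp0 fm0] : (forall x, 0 <= fp x) /\ (forall x, 0 <= fm x).
  by split=> x; rewrite mulr_ge0//; have := ler_norm (f x);
    have := ler_norm (- f x); rewrite normrN; lra.
rewrite [in LHS]fE lamB// !pos//.
rewrite -RintegralB//; try exact: gint.
by apply: eq_Rintegral => x _; rewrite [in RHS]fE; ring.
Qed.

End L1_dual.

Section essential_bounds.
Context dd (T : measurableType dd) (R : realType) (mu : {measure set T -> \bar R}).

Lemma Lnorm_oo_ae (f : T -> \bar R) (M : \bar R) : ('N[mu]_+oo[f] <= M)%E ->
  \forall x \ae mu, (`|f x| <= M)%E.
Proof.
rewrite unlock; case: ifPn => [_ /ess_supP//|].
(* For a measure of total mass zero the norm is 0 by convention, and the whole space serves as the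
   exceptional null set. *)
rewrite lt0e measure_ge0 andbT negbK => /eqP m0 _.
by exists setT; split.
Qed.

Lemma Lnorm_oo_le (f : T -> \bar R) (M : R) : 0 <= M ->
  (\forall x \ae mu, (`|f x| <= M%:E)%E) -> ('N[mu]_+oo[f] <= M%:E)%E.
Proof.
by move=> M0 H; rewrite unlock; case: ifPn => [_|_]; [exact/ess_supP|rewrite lee_fin].
Qed.

Lemma Lnorm_oo_ae_real (f : T -> \bar R) : ('N[mu]_+oo[f] < +oo)%E ->
  exists2 M : R, 0 <= M & \forall x \ae mu, (`|f x| <= M%:E)%E.
Proof.
move=> H; have N0 : (0 <= 'N[mu]_+oo[f])%E by exact: Lnorm_ge0.
exists (fine 'N[mu]_+oo[f]%E); first exact: fine_ge0.
by apply: Lnorm_oo_ae; rewrite fineK// ge0_fin_numE.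
Qed.

End essential_bounds.

Section variational.
Context (R : realType) (d : nat).
Local Notation E := (Rd R d).
Local Notation C := R[i].
Local Notation mu := (lebesgue_Rd R d).
Local Notation L1 := (@L1 R d).

Lemma Linfty_cmeas (g : E -> C) : Linfty g -> cmeas g.
Proof. by move=> [h1 h2 _]. Qed.

Lemma Linfty_bounded (g : E -> C) : Linfty g ->
  exists2 M : R, 0 <= M & \forall x \ae mu, normc (g x) <= M.
Proof.
move=> [_ _ /Lnorm_oo_ae_real[M M0 HM]]; exists M => //.
by apply: filterS HM => x /=; rewrite lee_fin ger0_norm// normc_ge0.
Qed.

Lemma cmeas_bounded_Linfty (g : E -> C) (M : R) : cmeas g ->
  (forall x, normc (g x) <= M) -> Linfty g.
Proof.
move=> [h1 h2] H; split => //.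
have M0 : 0 <= M by apply: le_trans (H [tuple 0 | i < d]); exact: normc_ge0.
apply: le_lt_trans (ltry M); apply: Lnorm_oo_le => //.
by apply: aeW => x /=; rewrite lee_fin ger0_norm ?normc_ge0.
Qed.

Lemma L1_Linfty (g f : E -> C) : Linfty g -> L1 f -> L1 (fun x => g x * f x).
Proof.
move=> Lg Lf; have [M M0 HM] := Linfty_bounded Lg.
apply: L1_le (rintZ M (L1_int Lf)) _.
  by apply: cmeasM; [exact: Linfty_cmeas|exact: L1_cmeas].
by apply: filterS HM => x HM; rewrite normcM ler_wpM2r// normc_ge0.
Qed.

Lemma L1_real (f : E -> R) : rint mu f -> L1 (fun x => (f x)%:C).
Proof. by move=> F; split => //=; exact: rint0. Qed.

Lemma L1norm_real (f : E -> R) : L1norm (fun x => (f x)%:C) = \int[mu]_x `|f x|.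
Proof. by rewrite L1normE; apply: eq_Rintegral => x _; rewrite normcR. Qed.

Variables (alpha : R) (B : (E -> C) -> C) (K : R).
Hypothesis alpha_gt0 : 0 < alpha.
Hypothesis B_entire : entire B.
Hypothesis BK : Ebound alpha B K.

(** The real duality is applied to the real and imaginary parts of [vder B th] on real functions;
    complex linearity in [h] then recombines them. *)
Lemma vder_representation (th : E -> C) : L1 th ->
  exists g, Linfty g /\ forall h, L1 h -> vder B th h = Cintegral (fun x => g x * h x).
Proof.
move=> Lt; have [w iw w0] := integrable_weight mu.
pose A := Bball alpha K (L1norm th + 1).
have A0 : 0 <= A by exact: Bball_ge0 BK _.
pose lam (f : E -> R) := vder B th (fun x => (f x)%:C).
have lamD f g : rint mu f -> rint mu g -> lam (fun x => f x + g x) = lam f + lam g.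
  move=> F G; rewrite /lam -(vderD alpha_gt0 B_entire BK Lt (L1_real F) (L1_real G)).
  by congr vder; apply/funext => x; rewrite rmorphD.
have lamZ (c : R) f : rint mu f -> lam (fun x => c * f x) = c%:C * lam f.
  move=> F; rewrite /lam -(vderZ B_entire c%:C Lt (L1_real F)).
  by congr vder; apply/funext => x; rewrite rmorphM.
have lam_le f : rint mu f -> normc (lam f) <= A * \int[mu]_x `|f x|.
  move=> F; rewrite -L1norm_real; exact: (vder_le_lin alpha_gt0 B_entire BK Lt (L1_real F)).
have [g1 [mg1 g1A g1E]] := @L1_dual_real _ _ _ mu (fun f => complex.Re (lam f)) A w
  ltac:(by move=> f g F G; rewrite /= lamD// raddfD)
  ltac:(by move=> c f F; rewrite /= lamZ// complex_ReM/= mul0r subr0)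
  ltac:(by move=> f F; apply: le_trans (lam_le f F); exact: normc_Re) A0 iw w0.
have [g2 [mg2 g2A g2E]] := @L1_dual_real _ _ _ mu (fun f => complex.Im (lam f)) A w
  ltac:(by move=> f g F G; rewrite /= lamD// raddfD)
  ltac:(by move=> c f F; rewrite /= lamZ// complex_ImM/= mul0r addr0)
  ltac:(by move=> f F; apply: le_trans (lam_le f F); exact: normc_Im) A0 iw w0.
pose g x := g1 x +i* g2 x; have Lg : Linfty g.
  apply: (@cmeas_bounded_Linfty _ (A + A)); first by split.
  by move=> x; apply: le_trans (normc_le_ReIm _) _; exact: lerD (g1A x) (g2A x).
exists g; split => // h Lh.
have real (f : E -> R) : rint mu f -> lam f = Cintegral (fun x => g x * (f x)%:C).
  move=> F; transitivity (complex.Re (lam f) +i* complex.Im (lam f)).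
    by case: (lam f).
  rewrite (g1E _ F) (g2E _ F) /Cintegral; congr Complex; apply: eq_Rintegral => x _ /=.
    by rewrite mulr0 subr0.
  by rewrite mulr0 add0r.
have [h1 h2] := Lh.
have hE : h = (fun x => (complex.Re (h x))%:C + 'i * (complex.Im (h x))%:C).
  by apply/funext => x; rewrite [LHS]complexE complexRe complexIm.
have L1h := L1_real h1; have L2h := L1_real h2.
rewrite {1}hE (vderD alpha_gt0 B_entire BK Lt L1h (L1Z 'i L2h)).
rewrite (vderZ B_entire 'i Lt L2h).
have := real _ h1; have := real _ h2; rewrite /lam => -> ->.
rewrite -CintegralZ; last exact: L1_Linfty.
rewrite -CintegralD; last 2 first.
- exact: L1_Linfty.
- by apply: L1Z; exact: L1_Linfty.
by congr Cintegral; apply/funext => x; rewrite [in RHS]hE; ring.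
Qed.

(** The representing density shows that the choice made by [xget] falls on a genuine derivative and
    not on the default value. *)
Lemma variational_derivativeP (th : E -> C) : L1 th ->
  Linfty (variational_derivative B th) /\
  forall h, L1 h -> Cintegral (fun x => variational_derivative B th x * h x) = vder B th h.
Proof.
move=> Lt; have [g [Lg gE]] := vder_representation Lt.
have vg : is_variational_derivative B th g.
  split => // h Lh; apply/cdiffP; rewrite -gE//.
  by apply: cderP; exact: entire_line.
have [Lv vE] := xgetI (fun=> 0) vg.
split => // h Lh; apply/esym/cder_val/cdiffP; exact: vE.
Qed.

End variational.

(** * Measurability of kernels *)
Import HBNNSimple.

Section strongly_measurable_kernels.
Context dd d2 (T : measurableType dd) (Y : measurableType d2) (R : realType).
Variable mu : {sigma_finite_measure set Y -> \bar R}.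
Implicit Types k : T -> Y -> R.

(* The range of the L^1-valued map [k] is separable. *)
Definition rsep k := exists2 G : nat -> Y -> R, (forall j, rint mu (G j)) &
  forall x e, 0 < e -> exists j, \int[mu]_y `|k x y - G j y| <= e.

Let pair_of (m : nat) : nat * nat := odflt (0, 0)%N (choice.unpickle m).

Let pair_ofK p : pair_of (choice.pickle p) = p.
Proof. by rewrite /pair_of choice.pickleK. Qed.

Lemma Rintegral_normD (f g : Y -> R) : rint mu f -> rint mu g ->
  \int[mu]_y `|f y + g y| <= \int[mu]_y `|f y| + \int[mu]_y `|g y|.
Proof.
move=> F G; rewrite -RintegralD//; try exact: rint_norm.
apply: ae_le_Rintegral.
- exact/rint_norm/rintD.
- by apply: rintD; exact: rint_norm.
- by apply: aeW => y; exact: ler_normD.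
Qed.

Lemma Rintegral_normD_le (h f g : Y -> R) a b : rint mu f -> rint mu g ->
  \int[mu]_y `|f y| <= a -> \int[mu]_y `|g y| <= b -> (forall y, h y = f y + g y) ->
  \int[mu]_y `|h y| <= a + b.
Proof.
move=> F G fa gb hE; under eq_Rintegral do rewrite hE.
by apply: le_trans (Rintegral_normD F G) _; exact: lerD.
Qed.

Lemma rsep_lim (k_ : nat -> T -> Y -> R) k :
  (forall n x, rint mu (k_ n x)) -> (forall x, rint mu (k x)) ->
  (forall n, rsep (k_ n)) ->
  (forall x e, 0 < e -> exists n, \int[mu]_y `|k_ n x y - k x y| <= e) -> rsep k.
Proof.
move=> ik_ ik /(_ _)/cid2-/all_sig2[G iG HG] H.
exists (fun m => G (pair_of m).1 (pair_of m).2) => [j//|x e e0].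
have [n Hn] := H x (e / 2) ltac:(by rewrite divr_gt0).
have [j Hj] := HG n x (e / 2) ltac:(by rewrite divr_gt0).
exists (choice.pickle (n, j)); rewrite pair_ofK /= [e]splitr.
apply: (Rintegral_normD_le (f := fun y => k x y - k_ n x y) (g := fun y => k_ n x y - G n j y)) => //.
- exact: rintB.
- exact: rintB.
- by under eq_Rintegral do rewrite distrC.
- by move=> y; ring.
Qed.

Lemma rsepD k1 k2 : (forall x, rint mu (k1 x)) -> (forall x, rint mu (k2 x)) ->
  rsep k1 -> rsep k2 -> rsep (fun x y => k1 x y + k2 x y).
Proof.
move=> i1 i2 [G1 iG1 H1] [G2 iG2 H2].
exists (fun m y => G1 (pair_of m).1 y + G2 (pair_of m).2 y) => [j|x e e0].
  exact: rintD.
have [m Hm] := H1 x (e / 2) ltac:(by rewrite divr_gt0).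
have [n Hn] := H2 x (e / 2) ltac:(by rewrite divr_gt0).
exists (choice.pickle (m, n)); rewrite pair_ofK /= [e]splitr.
apply: (Rintegral_normD_le (f := fun y => k1 x y - G1 m y) (g := fun y => k2 x y - G2 n y)) => //.
- exact: rintB.
- exact: rintB.
- by move=> y; ring.
Qed.

Lemma rsepZ (c : R) k : (forall x, rint mu (k x)) -> rsep k -> rsep (fun x y => c * k x y).
Proof.
move=> i1 [G iG H]; exists (fun m y => c * G m y) => [j|x e e0]; first exact: rintZ.
have c0 : 0 < `|c| + 1 by rewrite ltr_wpDl.
have [m Hm] := H x (e / (`|c| + 1)) ltac:(by rewrite divr_gt0).
exists m; under eq_Rintegral do rewrite -mulrBr normrM.
rewrite RintegralZl//; last exact/rint_norm/rintB.
apply: (le_trans (y := (`|c| + 1) * (e / (`|c| + 1)))).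
  by apply: ler_pM => //; [exact: Rintegral_ge0|rewrite lerDl].
by rewrite mulrCA divff ?mulr1// gt_eqF.
Qed.

Lemma rsep_sum (N : nat) (k_ : nat -> T -> Y -> R) :
  (forall n x, rint mu (k_ n x)) -> (forall n, rsep (k_ n)) ->
  (forall x, rint mu (fun y => \sum_(i < N) k_ i x y)) /\
  rsep (fun x y => \sum_(i < N) k_ i x y).
Proof.
move=> ik_ H; elim: N => [|N [IH1 IH2]].
  have E x : (fun y => \sum_(i < 0) k_ i x y) = fun=> 0.
    by apply/funext => y; rewrite big_ord0.
  split=> [x|]; first by rewrite E; exact: rint0.
  exists (fun _ _ => 0) => [j|x e e0]; first exact: rint0.
  exists 0%N; under eq_Rintegral do rewrite big_ord0 subrr normr0.
  by rewrite Rintegral_cst// mul0r ltW.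
have E x : (fun y => \sum_(i < N.+1) k_ i x y) =
  fun y => \sum_(i < N) k_ i x y + k_ N x y.
  by apply/funext => y; rewrite big_ord_recr.
split=> [x|]; first by rewrite E; exact: rintD.
have -> : (fun x y => \sum_(i < N.+1) k_ i x y) =
  fun x y => \sum_(i < N) k_ i x y + k_ N x y by apply/funext => x; exact: E.
exact: rsepD.
Qed.

Lemma rsep_dct (k_ : nat -> T -> Y -> R) k (g : T -> Y -> R) :
  (forall n x, measurable_fun setT (k_ n x)) -> (forall x, rint mu (g x)) ->
  (forall n x y, `|k_ n x y| <= g x y) -> (forall x y, k_ n x y @[n --> \oo] --> k x y) ->
  (forall n, rsep (k_ n)) -> (forall x, rint mu (k x)) /\ rsep k.
Proof.
move=> mk_ ig bk ck sk_.
have H x := rint_dct (fun n => mk_ n x) (ig x) (fun n => bk n x) (ck x).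
split=> [x|]; first by have [] := H x.
apply: rsep_lim sk_ _ => [n x|x|x e e0]; last first.
- by have [_ /(_ e e0)[N HN]] := H x; exists N; exact: HN.
- by have [] := H x.
- by apply: rint_le (ig x) _ => //; exact: aeW.
Qed.

Let w : Y -> R := sval (cid2 (integrable_weight mu)).
Let iw : rint mu w. Proof. exact: s2valP (cid2 (integrable_weight mu)). Qed.
Let w_gt0 y : 0 < w y. Proof. exact: s2valP' (cid2 (integrable_weight mu)) _. Qed.

Let windic_le (S : set (T * Y)) x y : `|\1_S (x, y) * w y| <= w y.
Proof.
rewrite normrM (gtr0_norm (w_gt0 y)) indicE.
by case: (_ \in _); rewrite ?normr1 ?normr0 ?mul1r ?mul0r// ltW.
Qed.

Let meas_section (f : T * Y -> R) x : measurable_fun setT f ->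
  measurable_fun setT (fun y => f (x, y)).
Proof. by move=> mf; apply: measurableT_comp => //; exact: pair1_measurable. Qed.

Let windic_meas (S : set (T * Y)) x : measurable S ->
  measurable_fun setT (fun y => \1_S (x, y) * w y).
Proof.
move=> mS; apply: measurable_funM; last exact: rint_meas iw.
by apply: (meas_section (f := \1_S)); exact: measurable_indic.
Qed.

Let windic_int (S : set (T * Y)) x : measurable S ->
  rint mu (fun y => \1_S (x, y) * w y).
Proof.
move=> mS; apply: rint_le iw _; first exact: windic_meas.
by apply: aeW => y; exact: windic_le.
Qed.

(** On a rectangle the L^1-valued map takes only the two values 0 and [1_B * w]. Dynkin's theorem
    extends this to all measurable sets, since complements are differences and disjoint unions are
    dominated limits of sums. *)
Let rsep_indic (S : set (T * Y)) : measurable S -> rsep (fun x y => \1_S (x, y) * w y).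
Proof.
pose C := [set A1 `*` A2 | A1 in [set A : set T | measurable A] &
  A2 in [set A : set Y | measurable A]].
have rect A B : measurable A -> measurable B -> rsep (fun x y => \1_(A `*` B) (x, y) * w y).
  move=> mA mB; have mAB : measurable (setT `*` B : set (T * Y)) by exact: measurableX.
  exists (fun j y => if j == 0%N then 0 else \1_B y * w y) => [[|j]|x e e0] /=.
  - exact: rint0.
  - apply: rint_le iw _.
      by apply: measurable_funM; [exact: measurable_indic|exact: rint_meas iw].
    apply: aeW => y; rewrite normrM (gtr0_norm (w_gt0 y)) indicE.
    by case: (_ \in _); rewrite ?normr1 ?normr0 ?mul1r ?mul0r// ltW.
  - have [xA|xA] := pselect (A x).
      exists 1%N; under eq_Rintegral => y _.
        have -> : \1_(A `*` B) (x, y) = \1_B y :> R.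
          rewrite !indicE; congr (nat_of_bool _)%:R.
          by apply/idP/idP => /set_mem; [case=> _ /mem_set|move=> By; apply/mem_set].
        rewrite /= subrr normr0; over.
      by rewrite Rintegral_cst// mul0r ltW.
    exists 0%N; under eq_Rintegral => y _.
      rewrite /= indicE memNset ?mul0r ?subrr ?normr0; last by case.
      over.
    by rewrite Rintegral_cst// mul0r ltW.
move=> mS; have sS : (<<s C >>) S by rewrite -measurable_prod_measurableType.
apply: (@dynkin_induction _ (T * Y)%type C
  (fun S => rsep (fun x y => \1_S (x, y) * w y)) _ _ _ _ _ _ S sS) => {S mS sS}.
- exact: measurable_prod_measurableType.
- move=> X Z [X1 mX1 [X2 mX2 <-{X}]] [Y1 mY1 [Y2 mY2 <-{Z}]].
  exists (X1 `&` Y1); first exact: measurableI.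
  by exists (X2 `&` Y2); [exact: measurableI|rewrite setXI].
- by rewrite -setXTT; exact: rect.
- by move=> X [X1 mX1 [X2 mX2 <-{X}]]; exact: rect.
- move=> X mX sX.
  have -> : (fun x y => \1_(~` X) (x, y) * w y) =
    (fun x y => \1_setT (x, y) * w y + (-1) * (\1_X (x, y) * w y)).
    apply/funext => x; apply/funext => y; rewrite !indicE in_setC in_setT.
    by case: (_ \in X) => /=; ring.
  apply: rsepD.
  - by move=> x; exact: windic_int.
  - by move=> x; apply/rintZ/windic_int.
  - by rewrite -setXTT; exact: rect.
  - by apply: rsepZ => // x; exact: windic_int.
- move=> F mF tF sF.
  pose k_ n x y := \sum_(i < n) (\1_(F i) (x, y) * w y).
  have kE n x y : k_ n x y = \1_(\bigcup_(i < n) F i) (x, y) * w y.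
    rewrite /k_ -mulr_suml; congr (_ * _).
    rewrite bigcup_mkord; elim: n => [|n IH]; first by rewrite !big_ord0 indic0.
    rewrite !big_ord_recr/= IH !indicE in_setU.
    have [xn|xn] := boolP ((x, y) \in F n); last by rewrite orbF addr0.
    rewrite orbT -bigcup_mkord.
    have [/set_mem[i /= ni Fi]|_] := boolP ((x, y) \in _); last by rewrite add0r.
    have := tF i n I I ltac:(by exists (x, y); split => //; exact/set_mem) => iE.
    by move: ni; rewrite iE ltnn.
  have mU n : measurable (\bigcup_(i < n) F i) by exact: bigcup_measurable.
  have [|||||_ //] := @rsep_dct k_ (fun x y => \1_(\bigcup_i F i) (x, y) * w y) (fun _ => w).
  - move=> n x; rewrite (_ : k_ n x = fun y => \1_(\bigcup_(i < n) F i) (x, y) * w y).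
      exact: windic_meas.
    by apply/funext => y; exact: kE.
  - by move=> x; exact: iw.
  - by move=> n x y; rewrite kE; exact: windic_le.
  - move=> x y; have [[j _ Fj]|nF] := pselect ((\bigcup_i F i) (x, y)).
      apply/cvgrPdist_le => e e0; exists j.+1 => // n /= jn.
      rewrite kE !indicE !mem_set ?subrr ?normr0 ?(ltW e0)//.
        by exists j.
      by exists j.
    apply/cvgrPdist_le => e e0; exists 0%N => // n /= _.
    rewrite kE !indicE !memNset ?subrr ?normr0 ?(ltW e0)//.
    by move=> [i _ Fi]; apply: nF; exists i.
  - move=> n; have [] // := @rsep_sum n (fun i x y => \1_(F i) (x, y) * w y).
    by move=> i x; exact: windic_int.
Qed.

Let rsep_ge0 k : measurable_fun setT (fun p : T * Y => k p.1 p.2) ->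
  (forall x y, 0 <= k x y) -> (forall x, rint mu (k x)) -> rsep k.
Proof.
move=> mk k0 ik.
pose h (p : T * Y) := (k p.1 p.2 * expR (- ln (w p.2)))%:E.
have hE x y : fine (h (x, y)) * w y = k x y.
  by rewrite /= expRN lnK ?posrE// mulfVK// gt_eqF.
have mw : measurable_fun setT (fun p : T * Y => w p.2).
  by apply: (measurableT_comp (f := w)) => //; exact: rint_meas iw.
have mh : measurable_fun setT h.
  apply/measurable_EFinP; apply: measurable_funM => //.
  apply: measurableT_comp; first exact: measurable_expR.
  by apply: measurableT_comp => //; apply: measurableT_comp; [exact: measurable_ln|].
have h0 p : setT p -> (0 <= h p)%E by rewrite lee_fin mulr_ge0// expR_ge0.
pose s n := nnsfun_approx measurableT mh n.
pose k_ n x y := s n (x, y) * w y.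
have [|||||_ //] := @rsep_dct k_ k k.
- move=> n x; apply: measurable_funM; last exact: rint_meas iw.
  by apply: (meas_section (f := s n)).
- exact: ik.
- move=> n x y; rewrite /k_ normrM (gtr0_norm (w_gt0 y)) -[leRHS]hE ler_pM2r//.
  rewrite ger0_norm// -lee_fin fineK//.
  by rewrite /s nnsfun_approxE; exact: le_approx.
- move=> x y; rewrite -hE; apply: cvgM; last exact: cvg_cst.
  have := @cvg_nnsfun_approx _ _ _ _ measurableT _ mh h0 (x, y) I.
  by move=> /fine_cvg.
- move=> n; set l := fset_set (s n @` setT).
  have -> : k_ n = fun x y => \sum_(i < #|` l|)
      (l`_i * (\1_(s n @^-1` [set l`_i]) (x, y) * w y)).
    apply/funext => x; apply/funext => y; rewrite /k_ fimfunEord mulr_suml.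
    by apply: eq_bigr => i _; rewrite mulrA.
  have mS i : measurable (s n @^-1` [set l`_i]) by exact: measurable_sfunP.
  have [] // := @rsep_sum #|` l| (fun i x y => l`_i * (\1_(s n @^-1` [set l`_i]) (x, y) * w y)).
  - by move=> i x; apply/rintZ/windic_int.
  - move=> i; apply: rsepZ; first by move=> x; exact: windic_int.
    exact: rsep_indic.
Qed.

Lemma measurable_kernel_rsep k : measurable_fun setT (fun p : T * Y => k p.1 p.2) ->
  (forall x, rint mu (k x)) -> rsep k.
Proof.
move=> mk ik.
have -> : k = fun x y => 2^-1 * (`|k x y| + k x y) + (- 2^-1) * (`|k x y| - k x y).
  by apply/funext => x; apply/funext => y; field.
have mn : measurable_fun setT (fun p : T * Y => `|k p.1 p.2|) by exact: measurableT_comp.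
have in_ x : rint mu (fun y => `|k x y|) by exact: rint_norm.
have ip x : rint mu (fun y => `|k x y| + k x y) by exact: rintD.
have im x : rint mu (fun y => `|k x y| - k x y) by exact: rintB.
apply: rsepD.
- by move=> x; exact: rintZ.
- by move=> x; exact: rintZ.
- apply: rsepZ => //; apply: rsep_ge0 => //; first exact: measurable_funD.
  by move=> x y; have := ler_norm (- k x y); rewrite normrN; lra.
- apply: rsepZ => //; apply: rsep_ge0 => //; first exact: measurable_funB.
  by move=> x y; have := ler_norm (k x y); lra.
Qed.

End strongly_measurable_kernels.

Section measurable_composition.
Context dd (T : measurableType dd).

Lemma measurable_nat_fun (R : realType) (j : T -> nat) (c : nat -> R) :
  (forall i, measurable [set x | j x = i]) -> measurable_fun setT (fun x => c (j x)).
Proof.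
move=> mj _ Y mY; rewrite setTI.
have -> : (fun x => c (j x)) @^-1` Y = \bigcup_(i in [set i | Y (c i)]) [set x | j x = i].
  by apply/seteqP; split => [x /= Yx|x [i /= Yi jx]]; [by exists (j x)|by rewrite jx].
by apply: bigcup_measurable => i _; exact: mj.
Qed.

Lemma measurable_Rintegral d2 (Y : measurableType d2) (R : realType)
    (mu : {sigma_finite_measure set Y -> \bar R}) (f : T * Y -> R) :
  measurable_fun setT f -> (forall p, 0 <= f p) ->
  measurable_fun setT (fun x => \int[mu]_y f (x, y)).
Proof.
move=> mf f0; apply: measurableT_comp => //.
apply: (@measurable_fun_fubini_tonelli_F _ _ T Y R mu (EFin \o f)).
  exact/measurable_EFinP.
by move=> p; rewrite lee_fin.
Qed.

Context (R : realType) (d : nat).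
Local Notation E := (Rd R d).
Local Notation C := R[i].
Local Notation mu := (lebesgue_Rd R d).
Local Notation L1 := (@L1 R d).

Lemma csep_kernel (k : T -> E -> C) : cmeas (fun p : T * E => k p.1 p.2) ->
  (forall x, L1 (k x)) ->
  exists2 G : nat -> E -> C, (forall j, L1 (G j)) &
    forall x e, 0 < e -> exists j, L1norm (fun y => k x y - G j y) <= e.
Proof.
move=> [m1 m2] Lk.
have [G1 iG1 H1] := measurable_kernel_rsep (mu := mu) m1 (fun x => (Lk x).1).
have [G2 iG2 H2] := measurable_kernel_rsep (mu := mu) m2 (fun x => (Lk x).2).
pose pr (m : nat) : nat * nat := odflt (0, 0)%N (choice.unpickle m).
exists (fun m y => G1 (pr m).1 y +i* G2 (pr m).2 y) => [j|x e e0].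
  by split; [exact: iG1|exact: iG2].
have [m Hm] := H1 x (e / 2) ltac:(by rewrite divr_gt0).
have [n Hn] := H2 x (e / 2) ltac:(by rewrite divr_gt0).
exists (choice.pickle (m, n)); rewrite /pr choice.pickleK /= [e]splitr.
have i1 := rintB (Lk x).1 (iG1 m); have i2 := rintB (Lk x).2 (iG2 n).
apply: le_trans (lerD Hm Hn); rewrite -RintegralD//; try exact: rint_norm.
apply: L1norm_le.
- by apply: L1B; [exact: Lk|split; [exact: iG1|exact: iG2]].
- by apply: rintD; exact: rint_norm.
- apply: aeW => y; apply: le_trans (normc_le_ReIm _) _.
  by rewrite !raddfB/=.
Qed.

Variables (alpha : R) (B : (E -> C) -> C) (K : R).
Hypothesis alpha_gt0 : 0 < alpha.
Hypothesis B_entire : entire B.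
Hypothesis BK : Ebound alpha B K.

(* [k] has separable range in L^1, so [B (k x)] is a limit of countably valued
   measurable functions, [B] being continuous. *)
Lemma cmeas_entire_kernel (k : T -> E -> C) : cmeas (fun p : T * E => k p.1 p.2) ->
  (forall x, L1 (k x)) -> cmeas (fun x => B (k x)).
Proof.
move=> mk Lk; have [G LG HG] := csep_kernel mk Lk.
pose N j x := L1norm (fun y => k x y - G j y).
have mN j : measurable_fun setT (N j).
  have -> : N j = fun x => \int[mu]_y (fun p : T * E => normc (k p.1 p.2 - G j p.2)) (x, y).
    by apply/funext => x; rewrite /N L1normE.
  apply: (@measurable_Rintegral _ E R mu (fun p : T * E => normc (k p.1 p.2 - G j p.2)))
    => [|p]; last exact: normc_ge0.
  apply/cmeas_normc/cmeasB => //.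
  by apply: (cmeas_comp (f := G j)) => //; exact: L1_cmeas.
have ex n x : exists j, N j x <= n.+1%:R^-1.
  by have [j Hj] := HG x n.+1%:R^-1 ltac:(by rewrite invr_gt0); exists j.
(* The least index, so that its level sets are differences of the measurable sets where [N j] is at
   most [1 / (n + 1)]. *)
pose J n x := ex_minn (ex n x).
have JP n x : N (J n x) x <= n.+1%:R^-1 by rewrite /J; case: ex_minnP.
have mJ n i : measurable [set x | J n x = i].
  have mA j : measurable [set x | N j x <= n.+1%:R^-1].
    have := measurable_fun_ler (mN j) (@measurable_cst _ _ T _ setT (n.+1%:R^-1 : R)).
    by move=> /(_ measurableT [set true]); rewrite setTI; apply.
  have -> : [set x | J n x = i] = [set x | N i x <= n.+1%:R^-1] `\`
     \bigcup_(j < i) [set x | N j x <= n.+1%:R^-1].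
    apply/seteqP; split=> x /=.
      move=> <-; split; first exact: JP.
      move=> [j /= + Hj]; rewrite /J; case: ex_minnP => m _ /(_ _ Hj) mj.
      by rewrite ltnNge mj.
    move=> [Hi Hn]; rewrite /J; case: ex_minnP => m Hm Hmin.
    apply/eqP; rewrite eqn_leq Hmin//= leqNgt; apply/negP => mi.
    by apply: Hn; exists m.
  by apply: measurableD => //; exact: bigcup_measurable.
apply: (@cmeas_cvg _ _ _ (fun n x => B (G (J n x)))) => [n|x e e0].
  split.
    exact: (@measurable_nat_fun _ (J n) (fun j => complex.Re (B (G j)))).
  exact: (@measurable_nat_fun _ (J n) (fun j => complex.Im (B (G j)))).
set M := Bball alpha K (L1norm (k x) + 2); have M0 : 0 <= M := Bball_ge0 BK _.
have M1 : 0 < M + 1 by lra.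
exists (Num.truncn ((M + 1) / e)) => n Hn.
have s0 : 0 < n.+1%:R^-1 :> R by rewrite invr_gt0.
apply: le_trans (@entire_lip _ _ _ _ _ alpha_gt0 B_entire BK (k x) (G (J n x)) (n.+1%:R^-1) _ _ s0 _ _) _ => //.
- by rewrite invf_le1// ler1n.
- apply: le_trans (JP n x); rewrite /N !L1normE le_eqVlt; apply/orP; left; apply/eqP.
  by apply: eq_Rintegral => y _; rewrite normc_distC.
rewrite -/M ler_pdivrMr//.
have h : (M + 1) / e < n.+1%:R.
  apply: lt_le_trans (truncnS_gt _) _; by rewrite ler_nat ltnS.
move: h; rewrite ltr_pdivrMr// => h; rewrite mulrC; lra.
Qed.

End measurable_composition.

(** * Invariance of Lebesgue measure under [y |-> x - y] *)

Section reflection_invariance.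
Variable R : realType.

Lemma lebesgue_measure_refl (x : R) (A : set (measurableTypeR R)) : measurable A ->
  lebesgue_measure ((fun a : measurableTypeR R => x - a : measurableTypeR R) @^-1` A) =
  lebesgue_measure A.
Proof.
have mr : measurable_fun setT (fun a : measurableTypeR R => x - a : measurableTypeR R).
  exact: measurable_funB.
pose phi : {mfun _ >-> _} := HB.pack (fun a : measurableTypeR R => x - a : measurableTypeR R)
  (isMeasurableFun.Build _ _ _ _ _ mr).
move=> mA; apply/esym.
apply: (@lebesgue_measure_unique R (pushforward lebesgue_measure phi)) => // _ [[a b] /= ab <-].
rewrite /pushforward.
have -> : phi @^-1` `]a, b] = `[x - b, x - a[%classic.
  by apply/seteqP; split => c /=; rewrite !in_itv/= => /andP[h1 h2]; apply/andP; split; lra.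
rewrite !lebesgue_measure_itv/= !lte_fin.
have -> : (x - b < x - a) = (a < b) by apply/idP/idP => ?; lra.
by case: ifP => // _; rewrite -!EFinD; congr EFin; lra.
Qed.

Lemma ge0_integral_refl1 (x : R) (f : measurableTypeR R -> \bar R) :
  measurable_fun setT f -> (forall a, 0 <= f a)%E ->
  (\int[lebesgue_measure]_a f (x - a)%R = \int[lebesgue_measure]_a f a)%E.
Proof.
move=> mf f0.
have mr : measurable_fun setT (fun a : measurableTypeR R => x - a : measurableTypeR R).
  exact: measurable_funB.
have := @ge0_integral_pushforward _ _ _ _ R _ mr lebesgue_measure setT f measurableT mf
  (fun y _ => f0 y).
rewrite preimage_setT => <-.
by apply: eq_measure_integral => A mA _; exact: lebesgue_measure_refl.
Qed.

Lemma measurable_Rdsub (d : nat) :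
  measurable_fun setT (fun p : Rd R d * Rd R d => Rdsub p.1 p.2).
Proof.
apply/measurable_fun_tnthP => i.
rewrite (_ : _ \o _ = (fun p : Rd R d * Rd R d => (tnth p.1 i : R) - (tnth p.2 i : R))).
  apply: measurable_funB.
    by apply: (measurableT_comp (f := fun t : Rd R d => tnth t i)) => //; exact: measurable_tnth.
  by apply: (measurableT_comp (f := fun t : Rd R d => tnth t i)) => //; exact: measurable_tnth.
by apply/funext => p /=; rewrite tnth_mktuple.
Qed.

Lemma measurable_Rdsubr (d : nat) (x : Rd R d) : measurable_fun setT (Rdsub x).
Proof.
apply: (measurableT_comp (f := fun p : Rd R d * Rd R d => Rdsub p.1 p.2) (g := fun y => (x, y))).
  exact: measurable_Rdsub.
exact: pair1_measurable.
Qed.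

Lemma Rdsub_cons (d : nat) (x : Rd R d.+1) (p : measurableTypeR R * Rd R d) :
  Rdsub x (Rdcons p) = Rdcons ((tnth x ord0 : R) - (p.1 : R), Rdsub [tuple of behead x] p.2).
Proof.
apply: eq_from_tnth => i; rewrite tnth_mktuple; have [j ->|->] := unliftP ord0 i.
  rewrite /Rdcons !tnthS tnth_mktuple; congr (_ - _).
  by rewrite tnth_behead; congr tnth; apply: val_inj; rewrite /= inordK// ltnS.
by rewrite /Rdcons !tnth0.
Qed.

Lemma ge0_integral_lebesgue_cons (d : nat) (f : Rd R d.+1 -> \bar R) :
  measurable_fun setT f -> (forall x, 0 <= f x)%E ->
  (\int[lebesgue_Rd R d.+1]_x f x =
   \int[lebesgue_measure]_a \int[lebesgue_Rd R d]_y f (Rdcons (a, y)))%E.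
Proof.
move=> mf f0.
have mc := @measurable_Rdcons R d.
have := @ge0_integral_pushforward _ _ _ _ R _ mc (@lebesgue_measure R \x lebesgue_Rd R d)%E
  setT f measurableT mf (fun y _ => f0 y).
rewrite preimage_setT => E.
transitivity (\int[(lebesgue_measure \x lebesgue_Rd R d)%E]_p (f \o @Rdcons R d) p)%E.
  rewrite -E; by apply: eq_measure_integral => A mA _.
rewrite fubini_tonelli1//; first exact: measurableT_comp.
by move=> p; exact: f0.
Qed.

(** [Rdcons] splits off one coordinate and Tonelli lets the one-dimensional invariance and the
    induction hypothesis act separately. *)
Lemma ge0_integral_refl (d : nat) (x : Rd R d) (f : Rd R d -> \bar R) :
  measurable_fun setT f -> (forall y, 0 <= f y)%E ->
  (\int[lebesgue_Rd R d]_y f (Rdsub x y) = \int[lebesgue_Rd R d]_y f y)%E.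
Proof.
elim: d x f => [|d IH] x f mf f0.
  by apply: eq_integral => y _; congr f; rewrite [LHS]tuple0 [RHS]tuple0.
have mfs : measurable_fun setT (fun y => f (Rdsub x y)).
  by apply: measurableT_comp => //; exact: measurable_Rdsubr.
rewrite (ge0_integral_lebesgue_cons mf f0) (ge0_integral_lebesgue_cons mfs (fun y => f0 _)).
have mfc : measurable_fun setT (fun p => f (Rdcons p)).
  by apply: measurableT_comp => //; exact: measurable_Rdcons.
pose g (a : measurableTypeR R) := (\int[lebesgue_Rd R d]_y f (Rdcons (a, y)))%E.
rewrite -(@ge0_integral_refl1 (tnth x ord0) g).
- apply: eq_integral => a _; rewrite /g.
  rewrite -[RHS](IH [tuple of behead x]).
  + by apply: eq_integral => y _; rewrite Rdsub_cons.
  + by apply: (measurableT_comp mfc); exact: pair1_measurable.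
  + by move=> y; exact: f0.
- by apply: (@measurable_fun_fubini_tonelli_F _ _ _ _ R (lebesgue_Rd R d) (fun p => f (Rdcons p))).
- by move=> a; apply: integral_ge0.
Qed.

(** Transfers finiteness and boundedness of [phi] almost everywhere to [phi (x - .)], for every
    single [x]. *)
Lemma ae_refl (d : nat) (x : Rd R d) (P : set (Rd R d)) :
  (\forall y \ae lebesgue_Rd R d, P y) -> \forall y \ae lebesgue_Rd R d, P (Rdsub x y).
Proof.
move=> [N [mN N0 PN]]; exists (Rdsub x @^-1` N).
have mp : measurable (Rdsub x @^-1` N).
  by rewrite -[X in measurable X]setTI; exact: (measurable_Rdsubr x).
split => //; last by move=> y /= H; apply: PN.
transitivity (\int[lebesgue_Rd R d]_y (\1_N (Rdsub x y))%:E)%E.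
  by rewrite -[X in lebesgue_Rd R d X]setIT -integral_indic.
rewrite (@ge0_integral_refl d x (fun y => (\1_N y)%:E)).
- by rewrite integral_indic// setIT.
- by apply/measurable_EFinP; exact: measurable_indic.
- by move=> y; rewrite lee_fin.
Qed.

End reflection_invariance.

(** * The generators on the spaces E_alpha *)

Section parameter_integral.
Context (R : realType) (d : nat).
Local Notation E := (Rd R d).
Local Notation C := R[i].
Local Notation mu := (lebesgue_Rd R d).
Local Notation L1 := (@L1 R d).

(** Differentiation under the integral: Cauchy's estimate turns the domination of [q] on discs into
    an integrable bound for the derivative and for the second-order remainder. *)
Lemma centire_Cintegral (q : E -> C -> C) (m : R -> E -> R) :
  (forall x, centire (q x)) -> (forall w, cmeas (fun x => q x w)) ->
  (forall r, rint mu (m r)) ->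
  (forall r x w, normc w <= r -> normc (q x w) <= m r x) ->
  centire (fun w => Cintegral (fun x => q x w)).
Proof.
move=> cq mq im qm w.
have Lq v : L1 (fun x => q x v).
  by apply: L1_le (im (normc v)) _ => //; apply: aeW => x; exact: qm.
(* [centire_taylor2] at radius 1 requires a bound on the disc of radius 3 around [w]. *)
pose r := normc w + 3.
have tay x h : normc h <= 1 ->
    normc (q x (w + h) - q x w - cder (q x) w * h) <= m r x * normc h ^+ 2.
  move=> h1; have := @centire_taylor2 _ (q x) w h 1 (m r x) (cq x) ltr01.
  rewrite expr1n divr1; apply => // k; rewrite mulr1 => k3.
  by apply: qm; apply: le_trans (le_normcD _ _) _; rewrite lerD2l.
have md : cmeas (fun x => cder (q x) w).
  pose h n : R := n.+1%:R^-1.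
  have h0 n : 0 < h n by rewrite invr_gt0.
  have h1 n : h n <= 1 by rewrite invf_le1// ler1n.
  apply: (@cmeas_cvg _ _ _ (fun n x => ((h n)%:C)^-1 * (q x (w + (h n)%:C) - q x w))).
    by move=> n; apply/cmeasZ/cmeasB.
  move=> x e e0; have m0 : 0 <= m r x.
    by apply: le_trans (normc_ge0 _) (qm r x w _); rewrite /r lerDl.
  exists (Num.truncn ((m r x + 1) / e)) => n Hn.
  have hn : normc (h n)%:C = h n by rewrite normcR ger0_norm// ltW.
  have hn0 : (h n)%:C != 0 by rewrite -normc_gt0 hn.
  rewrite -(ler_pM2r (h0 n)) -[X in _ * X <= _]hn -normcM mulrBl mulrC mulrA divff// mul1r.
  apply: le_trans (tay x _ _) _; first by rewrite hn.
  rewrite hn expr2 mulrA ler_pM2r// /h ler_pdivrMr//.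
  have h2 : (m r x + 1) / e < n.+1%:R.
    by apply: lt_le_trans (truncnS_gt _) _; rewrite ler_nat ltnS.
  by move: h2; rewrite ltr_pdivrMr// => h2; rewrite mulrC; lra.
have Ld : L1 (fun x => cder (q x) w).
  apply: L1_le (im (normc w + 1)) _ => //; apply: aeW => x.
  rewrite -[leRHS]divr1; apply: cder_bound => // k k1; apply: qm.
  by apply: le_trans (le_normcD _ _) _; rewrite lerD2l.
exists (Cintegral (fun x => cder (q x) w)) => e e0.
pose I := \int[mu]_x m r x.
have I0 : 0 <= I.
  apply: Rintegral_ge0 => x _.
  by apply: le_trans (normc_ge0 _) (qm r x w _); rewrite /r lerDl.
exists (Num.min 1 (e / (I + 1))); first by rewrite lt_min ltr01 divr_gt0// ltr_wpDl.
move=> h; rewrite lt_min => /andP[/ltW h1]; rewrite ltr_pdivlMr ?ltr_wpDl// => h2.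
have -> : Cintegral (fun x => q x (w + h)) - Cintegral (fun x => q x w) -
    Cintegral (fun x => cder (q x) w) * h =
    Cintegral (fun x => q x (w + h) - q x w - h * cder (q x) w).
  rewrite (CintegralB (L1B (Lq _) (Lq _)) (L1Z h Ld)) (CintegralB (Lq _) (Lq _)).
  by rewrite (CintegralZ h Ld) [h * _]mulrC.
have Lt := L1B (L1B (Lq (w + h)) (Lq w)) (L1Z h Ld).
have := L1norm_le Lt (rintZ (normc h ^+ 2) (im r)).
rewrite RintegralZl//; last exact: im.
rewrite -/I => HI; apply: le_trans (le_trans (normc_Cintegral Lt) (HI _)) _.
  by apply: aeW => x; rewrite mulrC [leRHS]mulrC; exact: tay.
by have := normc_ge0 h; rewrite expr2; nra.
Qed.

End parameter_integral.

Section operator.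
Context (R : realType) (d : nat).
Local Notation E := (Rd R d).
Local Notation C := R[i].
Local Notation mu := (lebesgue_Rd R d).
Local Notation L1 := (@L1 R d).

Lemma entire_locally_bounded alpha (B : (E -> C) -> C) K : 0 < alpha ->
  Ebound alpha B K -> locally_bounded B.
Proof.
move=> a0 BK th0 L0; exists 1, (Bball alpha K (L1norm th0 + 1)); split => // th Lt h.
apply: (Bball_le a0 BK) => //.
have -> : th = (fun x => th0 x + (th x - th0 x)) by apply/funext => x; rewrite addrC subrK.
by apply: le_trans (L1normD L0 (L1B Lt L0)) _; rewrite lerD2l ltW.
Qed.

Lemma entire_lin (B1 B2 : (E -> C) -> C) c : entire B1 -> entire B2 ->
  entire (fun th => B1 th + c * B2 th).
Proof.
move=> e1 e2; have [a1 l1 d1] := e1; have [a2 l2 d2] := e2; split.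
- by move=> th th' Lt Lt' H; rewrite (a1 _ _ Lt Lt' H) (a2 _ _ Lt Lt' H).
- move=> th L0; have [r1 [M1 [r10 H1]]] := l1 th L0; have [r2 [M2 [r20 H2]]] := l2 th L0.
  exists (Num.min r1 r2), (M1 + normc c * M2); split; first by rewrite lt_min r10.
  move=> t Lt; rewrite lt_min => /andP[/(H1 _ Lt) h1 /(H2 _ Lt) h2].
  apply: le_trans (le_normcD _ _) _; apply: lerD => //.
  by rewrite normcM ler_wpM2l// normc_ge0.
- move=> t0 t1 L0 L1' w; apply/derivable_cdiff.
  apply: (@centireD _ (fun w => B1 (line t0 t1 w)) (fun w => c * B2 (line t0 t1 w))).
    exact: entire_line.
  by apply: centireM; [exact: centire_cst|exact: entire_line].
Qed.

Lemma Ebound_lin alpha (B1 B2 : (E -> C) -> C) c K1 K2 :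
  Ebound alpha B1 K1 -> Ebound alpha B2 K2 ->
  Ebound alpha (fun th => B1 th + c * B2 th) (K1 + normc c * K2).
Proof.
move=> b1 b2 th Lt; apply: le_trans (le_normcD _ _) _.
rewrite mulrDl; apply: lerD; first exact: b1.
by rewrite normcM -mulrA ler_wpM2l ?normc_ge0// b2.
Qed.

Variables (z Phi : R) (b c : E -> E -> R).
Hypothesis z_gt0 : 0 < z.
Hypothesis Phi_ge0 : 0 <= Phi.

(** [Phi] is uniform in [x]: the argument of [B] grows in norm by at most [Phi], which is the origin
    of the exponential in [M]. *)
Definition kernel_ok :=
  [/\ measurable_fun setT (fun p : E * E => b p.1 p.2),
      measurable_fun setT (fun p : E * E => c p.1 p.2),
      forall x y, 0 <= b x y <= 1,
      forall x, rint mu (c x) &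
      forall x, \int[mu]_y `|c x y| <= Phi].

Hypothesis ok : kernel_ok.

Definition affine_kernel (th : E -> C) (x y : E) : C := th y * (b x y)%:C + (c x y)%:C.

(* [Lren] is the case [b = e^{-eps phi}], [c = (b - 1) / eps]; [LV] is [b = 1], [c = - phi]. *)
Definition Lgen (B : (E -> C) -> C) : (E -> C) -> C := fun th =>
  - Cintegral (fun x => th x * (variational_derivative B th x - z%:C * B (affine_kernel th x))).

Let bmeas x : measurable_fun setT (b x).
Proof.
have [mb _ _ _ _] := ok.
by apply: (measurableT_comp (f := fun p : E * E => b p.1 p.2) (g := fun y => (x, y))) => //;
  exact: pair1_measurable.
Qed.

Let bnorm x y : `|b x y| <= 1.
Proof. by have [_ _ /(_ x y)/andP[h1 h2] _ _] := ok; rewrite ger0_norm. Qed.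

Lemma L1_mulb th x : L1 th -> L1 (fun y => th y * (b x y)%:C).
Proof.
move=> Lt; apply: L1_le (L1_int Lt) _.
  by apply: cmeasM; [exact: L1_cmeas|exact/cmeas_real].
by apply: aeW => y; rewrite normcM normcR ler_piMr ?normc_ge0.
Qed.

Lemma L1norm_mulb th x : L1 th -> L1norm (fun y => th y * (b x y)%:C) <= L1norm th.
Proof.
move=> Lt; rewrite [leRHS]L1normE; apply: L1norm_le.
- exact: L1_mulb.
- exact: L1_int.
- by apply: aeW => y; rewrite normcM normcR ler_piMr ?normc_ge0.
Qed.

Lemma L1_affine_kernel th x : L1 th -> L1 (affine_kernel th x).
Proof.
by move=> Lt; apply: L1D; [exact: L1_mulb|apply: L1_real; have [] := ok].
Qed.

Lemma L1norm_affine_kernel th x : L1 th -> L1norm (affine_kernel th x) <= L1norm th + Phi.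
Proof.
have [_ _ _ ic Ic] := ok.
move=> Lt; apply: le_trans (L1normD (L1_mulb x Lt) (L1_real (ic x))) _.
apply: lerD; first exact: L1norm_mulb.
by rewrite L1norm_real; exact: Ic.
Qed.

Lemma cmeas_affine_kernel th : L1 th -> cmeas (fun p : E * E => affine_kernel th p.1 p.2).
Proof.
have [mb mc _ _ _] := ok.
move=> Lt; apply: cmeasD; last exact: cmeas_real.
apply: cmeasM; last exact: cmeas_real.
by apply: (cmeas_comp (f := th)) => //; exact: L1_cmeas.
Qed.

Lemma affine_kernel_line t0 t1 w x : affine_kernel (line t0 t1 w) x =
  line (affine_kernel t0 x) (fun y => t1 y * (b x y)%:C) w.
Proof. by apply/funext => y; rewrite /affine_kernel /line; ring. Qed.

Section one_functional.
Variables (alpha : R) (B : (E -> C) -> C) (K : R).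
Hypothesis alpha_gt0 : 0 < alpha.
Hypothesis B_entire : entire B.
Hypothesis BK : Ebound alpha B K.

Lemma cmeas_B_affine th : L1 th -> cmeas (fun x => B (affine_kernel th x)).
Proof.
move=> Lt; apply: (cmeas_entire_kernel alpha_gt0 B_entire BK).
  exact: cmeas_affine_kernel.
by move=> x; exact: L1_affine_kernel.
Qed.

Lemma B_affine_le th x r : L1 th -> L1norm th <= r ->
  normc (B (affine_kernel th x)) <= Bball alpha K (r + Phi).
Proof.
move=> Lt tr; apply: (Bball_le alpha_gt0 BK); first exact: L1_affine_kernel.
by apply: le_trans (L1norm_affine_kernel x Lt) _; rewrite lerD2r.
Qed.

Lemma Linfty_B_affine th : L1 th -> Linfty (fun x => B (affine_kernel th x)).
Proof.
move=> Lt; apply: (@cmeas_bounded_Linfty _ _ _ (Bball alpha K (L1norm th + Phi))).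
  exact: cmeas_B_affine.
by move=> x; exact: B_affine_le.
Qed.

Lemma L1_th_B_affine th h : L1 th -> L1 h -> L1 (fun x => th x * B (affine_kernel h x)).
Proof.
move=> Lt Lh; have := L1_Linfty (Linfty_B_affine Lh) Lt.
by congr L1; apply/funext => x; rewrite mulrC.
Qed.

Lemma LgenE th : L1 th -> Lgen B th =
  - (vder B th th - z%:C * Cintegral (fun x => th x * B (affine_kernel th x))).
Proof.
move=> Lt; have [Lv vE] := variational_derivativeP alpha_gt0 B_entire BK Lt.
rewrite /Lgen -vE// -CintegralZ; last exact: L1_th_B_affine.
rewrite -CintegralB; last 2 first.
- exact: L1_Linfty.
- exact/L1Z/L1_th_B_affine.
by congr (- Cintegral _); apply/funext => x; ring.
Qed.

(** The numerator involves only the outer indices [a] and [a0], so the same constant serves all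
    intermediate pairs when [L] is iterated. *)
Lemma Lgen_le (a a0 alpha' : R) : 0 < a -> a <= alpha' -> alpha' < alpha -> alpha <= a0 ->
  Ebound alpha' (Lgen B)
    (K * (a0 * (1 + z * a0 * expR (Phi / a - 1)) / (alpha - alpha'))).
Proof.
move=> a_gt0 aa' a'a aa0 th Lt.
have K0 : 0 <= K := Ebound_ge0 BK.
have a'0 : 0 < alpha' by lra.
have D0 : 0 < alpha - alpha' by lra.
have n0 := L1norm_ge0 th; set N := L1norm th in n0 *.
rewrite LgenE// normcN.
set X := expR (alpha'^-1 * N); have X0 : 0 < X := expR_gt0 _.
have h1 : normc (vder B th th) <= K * X * (alpha' / (alpha - alpha')).
  (* With this radius [(1 + r) / alpha = 1 / alpha'], so Cauchy's bound grows exactly as functionals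
     of index [alpha'] may. *)
  have r0 : 0 < (alpha - alpha') / alpha' by rewrite divr_gt0.
  apply: le_trans (vder_le alpha_gt0 B_entire BK Lt Lt r0) _.
  rewrite invf_div ler_wpM2r ?divr_ge0 ?(ltW a'0) ?(ltW D0)//.
  rewrite /Bball ler_wpM2l// ler_expR -/N le_eqVlt; apply/orP; left; apply/eqP.
  by field; rewrite !gt_eqF.
have e1 (s k : R) : 0 <= s -> 0 < k -> s <= expR (s * k - 1) / k.
  by move=> s0 k0; rewrite ler_pdivlMr//; have := expR_ge1Dx (s * k - 1); lra.
have h2 : normc (Cintegral (fun x => th x * B (affine_kernel th x))) <=
    N * (K * expR (alpha^-1 * (N + Phi))).
  apply: le_trans (normc_Cintegral (L1_th_B_affine Lt Lt)) _.
  rewrite mulrC [X in _ * X]L1normE -RintegralZl//; last exact: L1_int.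
  apply: L1norm_le; [exact: L1_th_B_affine|by apply: rintZ; exact: L1_int|].
  apply: aeW => x; rewrite normcM mulrC ler_wpM2r ?normc_ge0//.
  exact: B_affine_le.
pose k := alpha'^-1 - alpha^-1.
have kE : k = (alpha - alpha') / (alpha * alpha') by rewrite /k; field; rewrite !gt_eqF.
have k0 : 0 < k by rewrite kE divr_gt0// mulr_gt0.
(* The shift of the argument costs [e^(Phi / alpha)], at most [e^(Phi / a)]; with the factor [e^-1]
   from [e1] it becomes the exponential in [M]. *)
have h3 : N * expR (alpha^-1 * (N + Phi)) <=
    X * (expR (Phi / a - 1) * (a0 * alpha' / (alpha - alpha'))).
  apply: (le_trans (y := expR (N * k - 1) / k * expR (alpha^-1 * (N + Phi)))).
    by rewrite ler_wpM2r ?expR_ge0// e1.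
  have -> : expR (N * k - 1) / k * expR (alpha^-1 * (N + Phi)) =
     X * (expR (Phi / alpha - 1) * (alpha * alpha' / (alpha - alpha'))).
    rewrite mulrAC -expRD /X mulrA -expRD kE invf_div; congr (expR _ * _).
    by rewrite /k; field; rewrite !gt_eqF.
  rewrite ler_pM2l//; apply: ler_pM; rewrite ?expR_ge0//.
  - by rewrite divr_ge0 ?(ltW D0)// mulr_ge0 ?(ltW a'0)// ltW.
  - by rewrite ler_expR lerD2r ler_wpM2l// lef_pV2 ?posrE//; lra.
  - by rewrite ler_wpM2r ?invr_ge0 ?(ltW D0)// ler_wpM2r ?(ltW a'0).
apply: le_trans (normcB _ _) _; rewrite normcM normcR (gtr0_norm z_gt0).
set e := expR (Phi / a - 1) in h3 *; have e0 : 0 < e := expR_gt0 _.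
apply: (le_trans (y := K * X * (alpha' / (alpha - alpha')) +
   z * (K * (X * (e * (a0 * alpha' / (alpha - alpha'))))))).
  apply: lerD => //; rewrite ler_pM2l//; apply: le_trans h2 _.
  by rewrite mulrCA ler_wpM2l.
have -> : K * X * (alpha' / (alpha - alpha')) +
   z * (K * (X * (e * (a0 * alpha' / (alpha - alpha'))))) =
   K * X * ((1 + z * a0 * e) * alpha' / (alpha - alpha')).
  by field; rewrite gt_eqF.
rewrite [leRHS]mulrAC ler_wpM2l ?mulr_ge0 ?(ltW X0)//.
have y0 : 0 <= 1 + z * a0 * e.
  by rewrite addr_ge0// !mulr_ge0// ?(ltW e0) ?(ltW z_gt0)//; lra.
rewrite ler_wpM2r ?invr_ge0 ?(ltW D0)// mulrC; apply: ler_wpM2r => //; lra.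
Qed.

Lemma Lgen_entire : entire (Lgen B).
Proof.
have [Bae _ _] := B_entire; split.
- move=> th th' Lt Lt' H; rewrite !LgenE//; congr (- (_ - _ * _)).
    rewrite /vder; congr cder; apply/funext => w; apply: Bae; try exact: L1_line.
    by apply: filterS H => x Hx _; rewrite /line Hx.
  apply: Cintegral_ae; try exact: L1_th_B_affine.
  apply: filterS (H) => x Hx; rewrite Hx//; congr (_ * _).
  apply: Bae; try exact: L1_affine_kernel.
  by apply: filterS H => y Hy _; rewrite /affine_kernel Hy.
(* Local boundedness does not see the loss of index, so any index below [alpha] serves. *)
- have a2 : 0 < alpha / 2 by rewrite divr_gt0.
  apply: (entire_locally_bounded a2 (Lgen_le (a := alpha / 2) (a0 := alpha) _ _ _ _)) => //.
  by lra.
- move=> t0 t1 L0 L1' w; apply/derivable_cdiff; move: w.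
  have -> : (fun w => Lgen B (line t0 t1 w)) = (fun w =>
     - 1 * (vder B (line t0 t1 w) (line t0 t1 w) - z%:C *
      Cintegral (fun x => line t0 t1 w x * B (affine_kernel (line t0 t1 w) x)))).
    by apply/funext => w; rewrite LgenE ?mulN1r//; exact: L1_line.
  rewrite -/(centire _); apply: centireM; first exact: centire_cst.
  apply: centireB; first exact: (centire_vder_diag alpha_gt0 B_entire BK).
  apply: centireM; first exact: centire_cst.
  apply: (@centire_Cintegral _ _ (fun x w => line t0 t1 w x * B (affine_kernel (line t0 t1 w) x))
    (fun r x => Bball alpha K (L1norm t0 + r * L1norm t1 + Phi) *
      (normc (t0 x) + r * normc (t1 x)))).
  + move=> x; apply: centireM.
      by move=> w; exists (t1 x); exact: cdiff_affine.
    have -> : (fun w => B (affine_kernel (line t0 t1 w) x)) =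
      (fun w => B (line (affine_kernel t0 x) (fun y => t1 y * (b x y)%:C) w)).
      by apply/funext => w; rewrite affine_kernel_line.
    by apply: entire_line => //; [exact: L1_affine_kernel|exact: L1_mulb].
  + move=> w; apply: L1_cmeas; apply: L1_th_B_affine; exact: L1_line.
  + by move=> r; apply: rintZ; apply: rintD; [|apply: rintZ]; exact: L1_int.
  + move=> r x w wr; rewrite normcM mulrC; apply: ler_pM; rewrite ?normc_ge0//.
      apply: B_affine_le; first exact: L1_line.
      apply: le_trans (L1norm_line w L0 L1') _; rewrite lerD2l ler_wpM2r// L1norm_ge0//.
    apply: le_trans (le_normcD _ _) _; rewrite lerD2l normcM ler_wpM2r// normc_ge0//.
Qed.

End one_functional.

Lemma Lgen_lin alpha (B1 B2 : (E -> C) -> C) k K1 K2 th : 0 < alpha ->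
  entire B1 -> entire B2 -> Ebound alpha B1 K1 -> Ebound alpha B2 K2 -> L1 th ->
  Lgen (fun th => B1 th + k * B2 th) th = Lgen B1 th + k * Lgen B2 th.
Proof.
move=> a0 e1 e2 b1 b2 Lt.
rewrite (LgenE a0 (entire_lin k e1 e2) (Ebound_lin k b1 b2) Lt).
rewrite (LgenE a0 e1 b1 Lt) (LgenE a0 e2 b2 Lt).
have -> : vder (fun th => B1 th + k * B2 th) th th = vder B1 th th + k * vder B2 th th.
  apply: cder_val; have c1 := cderP (entire_line e1 Lt Lt) 0.
  have := cdiffD c1 (cdiffM (cdiff_cst k 0) (cderP (entire_line e2 Lt Lt) 0)).
  by rewrite mulr0 addr0.
have l1 := L1_th_B_affine a0 e1 b1 Lt Lt; have l2 := L1_th_B_affine a0 e2 b2 Lt Lt.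
have -> : Cintegral (fun x => th x * (B1 (affine_kernel th x) + k * B2 (affine_kernel th x))) =
  Cintegral (fun x => th x * B1 (affine_kernel th x)) +
  k * Cintegral (fun x => th x * B2 (affine_kernel th x)).
  rewrite -CintegralZ// -CintegralD//; last exact: L1Z.
  by congr Cintegral; apply/funext => x; ring.
ring.
Qed.

End operator.

(** * Taylor expansion of solutions *)

Section stability.
Context (R : realType) (d : nat).
Local Notation E := (Rd R d).
Local Notation C := R[i].
Local Notation L1 := (@L1 R d).

Lemma Ebound_le (a a' : R) (B : (E -> C) -> C) K K' : 0 < a' -> a' <= a -> 0 <= K' ->
  K <= K' -> Ebound a B K -> Ebound a' B K'.
Proof.
move=> a0 aa K0 KK H th Lt; apply: le_trans (H th Lt) _.
apply: (le_trans (y := K' * expR (a^-1 * L1norm th))).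
  by rewrite ler_wpM2r// expR_ge0.
rewrite ler_wpM2l// ler_expR ler_wpM2r ?L1norm_ge0//.
by rewrite lef_pV2// posrE//; apply: lt_le_trans aa.
Qed.

Variables (z Phi : R) (b c : E -> E -> R).
Hypothesis z_gt0 : 0 < z.
Hypothesis Phi_ge0 : 0 <= Phi.
Hypothesis ok : kernel_ok Phi b c.
Local Notation L := (Lgen z b c).

Definition Mop (a a0 : R) := a0 * (1 + z * a0 * expR (Phi / a - 1)).

Lemma Mop_gt0 a a0 : 0 < a0 -> 0 < Mop a a0.
Proof.
by move=> h; rewrite mulr_gt0// addr_gt0// !mulr_gt0// expR_gt0.
Qed.

Variables (V F : R -> (E -> C) -> C) (al be t0 t1 A m m' k : R).
Hypothesis be_gt0 : 0 < be.
Hypothesis be_al : be < al.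
Hypothesis k_gt0 : 0 < k.
Hypothesis kM : 4 * Mop be al * k <= 2^-1.
Hypothesis V_entire : forall t, t0 <= t <= t1 -> entire (V t).
Hypothesis VA : forall t, t0 <= t <= t1 -> Ebound al (V t) A.
Hypothesis V_cont : forall th, L1 th -> ccont_on `[t0, t1] (fun t => V t th).
Hypothesis V_eq : forall th t, L1 th -> t0 < t < t1 ->
  rdiff (fun s => V s th) t (L (V t) th + F t th).
Hypothesis V0 : Ebound al (V t0) m.
Hypothesis Fm : forall t, t0 < t < t1 -> Ebound al (F t) m'.
Hypothesis m'_ge0 : 0 <= m'.

Let al_gt0 : 0 < al. Proof. by apply: lt_trans be_al. Qed.
Let m_ge0 : 0 <= m. Proof. exact: Ebound_ge0 V0. Qed.

(** Equals 1 at [t0] and blows up when the time budget [k * (al - be')] of the index [be'] is used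
    up. *)
Definition stab_weight (be' t : R) := (al - be') / (al - be' - (t - t0) / k).

Let weight_bound (N : R) := forall be' t, be <= be' -> be' < al -> t0 <= t <= t1 ->
  (t - t0) / k < al - be' -> Ebound be' (V t) (N * stab_weight be' t).

Let weight_ge1 be' t : t0 <= t -> (t - t0) / k < al - be' -> 1 <= stab_weight be' t.
Proof.
move=> t0t h; rewrite ler_pdivlMr ?mul1r; last by rewrite subr_gt0.
by rewrite gerBl divr_ge0 ?subr_ge0// ltW.
Qed.

(* Ovsyannikov's trick: a bound weighted by [stab_weight] is improved by applying
   [L] from the intermediate space [be'' = (al + be' - (s - t0) / k) / 2] to [be']. *)
Let weight_step (N : R) : 0 <= N -> weight_bound N -> weight_bound (m + m' * (t1 - t0) + N / 2).
Proof.
move=> N0 PN be' t bb ba /andP[t0t tt1] tk th Lt.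
have be'0 : 0 < be' by apply: lt_le_trans bb.
set X := expR _; have X0 : 0 < X := expR_gt0 _.
pose D := al - be'; pose sg s := (s - t0) / k.
have D0 : 0 < D by rewrite /D; lra.
have sgt : sg t < D by [].
have sg_le s : s <= t -> sg s < D.
  move=> st; apply: le_lt_trans sgt; rewrite /sg ler_wpM2r ?invr_ge0 ?(ltW k_gt0)//; lra.
have sg_ge0 s : t0 <= s -> 0 <= sg s by move=> h; rewrite /sg divr_ge0 ?subr_ge0// ltW.
have M0 : 0 < Mop be al := Mop_gt0 _ al_gt0; set M := Mop be al in M0.
have kM' : 4 * M * k <= 2^-1 := kM.
pose g s := X * (4 * N * M * D * (D - sg s) ^- 2 + m').
pose G s := X * (4 * N * M * D * k * (D - sg s)^-1 + m' * (s - t0)).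
have dG s : s <= t -> is_derive s 1 G (g s).
  move=> st; have Ds : D - sg s != 0 by rewrite gt_eqF// subr_gt0 sg_le.
  have h1 : is_derive s 1 (fun s => D - sg s) (- k^-1).
    have -> : (fun s => D - sg s) = cst (D + t0 / k) - (k^-1 *: id).
      by apply/funext => x; rewrite /sg !fctE /=; rewrite -[k^-1 *: x]/(k^-1 * x); ring.
    apply: is_derive_eq; by rewrite sub0r -[k^-1 *: 1]/(k^-1 * 1) mulr1.
  have h2 := @is_deriveV R (fun s => D - sg s) s (- k^-1) 1 Ds h1.
  have h3 : is_derive s 1 (fun s => m' * (s - t0)) m'.
    have -> : (fun s => m' * (s - t0)) = m' *: (id - cst t0) by [].
    by apply: is_derive_eq; rewrite subr0 -[m' *: 1]/(m' * 1) mulr1.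
  have h4 : is_derive s 1 G _ := is_deriveZ X (is_deriveD (is_deriveZ (4 * N * M * D * k) h2) h3).
  apply: (is_derive_eq h4); rewrite /g.
  rewrite -![_ *: _]/(_ * _); congr (_ * (_ + _)).
  by field; rewrite Ds gt_eqF.
have bound s : t0 < s < t -> normc (L (V s) th + F s th) <= g s.
  move=> /andP[t0s st]; have sI : t0 <= s <= t1 by apply/andP; split; lra.
  have s1 := sg_le s (ltW st); have s0 := sg_ge0 s (ltW t0s).
  pose b2 := (al + be' - sg s) / 2.
  have [c1 c2] : be' < b2 /\ b2 < al by rewrite /b2; rewrite /D in s1; split; lra.
  have c3 : al - b2 = (D + sg s) / 2 by rewrite /b2 /D; field.
  have c4 : b2 - be' = (D - sg s) / 2 by rewrite /b2 /D; field.
  have H := PN b2 s ltac:(lra) c2 sI ltac:(rewrite c3 -/(sg s); lra).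
  have b20 : 0 < b2 by lra.
  have H2 := Lgen_le z_gt0 Phi_ge0 ok b20 (V_entire sI) H be_gt0 bb c1 (ltW c2).
  have wE : stab_weight b2 s = (D + sg s) / (D - sg s).
    by rewrite /stab_weight c3 -/(sg s); field; rewrite !gt_eqF//; lra.
  apply: le_trans (le_normcD _ _) _; rewrite /g mulrDr; apply: lerD.
    apply: le_trans (H2 th Lt) _; rewrite -/X mulrC ler_pM2l// wE c4 -/(Mop be al) -/M.
    have -> : N * ((D + sg s) / (D - sg s)) * (M / ((D - sg s) / 2)) =
      2 * N * M * (D + sg s) * (D - sg s) ^- 2 by field; rewrite gt_eqF//; lra.
    have -> : 4 * N * M * D * (D - sg s) ^- 2 = 2 * N * M * (D + D) * (D - sg s) ^- 2 by ring.
    have r1 : 0 <= (D - sg s) ^- 2 by rewrite invr_ge0 exprn_ge0//; lra.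
    apply: ler_wpM2r => //; apply: ler_wpM2l.
      by apply: mulr_ge0 (ltW M0); exact: mulr_ge0.
    by rewrite lerD2l ltW.
  have FI : t0 < s < t1 by apply/andP; split; lra.
  by rewrite mulrC; apply: (Ebound_le be'0 (ltW ba) m'_ge0 (lexx _) (Fm FI)).
have contG : {within `[t0, t], continuous G}.
  by apply: derivable_within_continuous => s; rewrite in_itv/= => /andP[_ /dG h]; exact: ex_derive.
have contV : ccont_on `[t0, t] (fun s => V s th).
  have sub : `[t0, t]%classic `<=` `[t0, t1]%classic by apply: subset_itvl; rewrite bnd_simp.
  have [h1 h2] := V_cont Lt.
  by split; apply: continuous_subspaceW; [exact: sub|exact: h1|exact: sub|exact: h2].
have := @mean_value_ineq _ (fun s => V s th) (fun s => L (V s) th + F s th) G g t0 t t0t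
  contV contG.
have dV s : t0 < s < t -> rdiff (fun s => V s th) s (L (V s) th + F s th).
  by move=> /andP[h1 h2]; apply: V_eq => //; apply/andP; split; lra.
have dG' s : t0 < s < t -> is_derive s 1 G (g s) by move=> /andP[_ /ltW]; exact: dG.
move=> /(_ dV dG' bound) H.
have -> : V t th = (V t th - V t0 th) + V t0 th by rewrite subrK.
apply: le_trans (le_normcD _ _) _; apply: le_trans (lerD H (lexx _)) _.
have H0 : normc (V t0 th) <= m * X.
  exact: (Ebound_le be'0 (ltW ba) m_ge0 (lexx _) V0).
apply: le_trans (lerD (lexx _) H0) _.
have Y1 := weight_ge1 t0t tk.
have YE : stab_weight be' t = D * (D - sg t)^-1 by [].
have sg0 : sg t0 = 0 by rewrite /sg subrr mul0r.
set Y := stab_weight be' t in Y1 YE *.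
have -> : G t - G t0 = X * (4 * M * k * N * Y - 4 * M * k * N + m' * (t - t0)).
  rewrite YE /G sg0 subr0 subrr; field; rewrite !gt_eqF//; lra.
(* Here the choice of [k], that is [4 * M * k <= 2^-1], halves the previous constant. *)
have q1 : 4 * M * k * N * Y <= N / 2 * Y.
  rewrite ler_wpM2r//; first by lra.
  by rewrite mulrC ler_wpM2l.
have q2 : 0 <= 4 * M * k * N.
  by apply: mulr_ge0 => //; apply: mulr_ge0 (ltW k_gt0); exact: mulr_ge0 (ltW M0).
have q3 : m' * (t - t0) <= m' * (t1 - t0) * Y.
  apply: (le_trans (y := m' * (t1 - t0))); first by rewrite ler_wpM2l//; lra.
  by rewrite ler_peMr// mulr_ge0//; lra.
have q4 : m <= m * Y by rewrite ler_peMr.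
by rewrite mulrC -mulrDl ler_pM2r// !mulrDl; lra.
Qed.

(** The a priori bound [A] only starts the iteration [N |-> mb + N / 2]: its contribution is halved
    at each pass, and the fixed point is [2 * mb], which depends on the data alone. *)
Lemma ode_stability t : t0 <= t <= t1 -> (t - t0) / k < al - be ->
  Ebound be (V t) (2 * (m + m' * (t1 - t0)) * stab_weight be t).
Proof.
move=> /[dup] tI /andP[t0t tt1] tk.
have A0 : 0 <= A by apply: Ebound_ge0 (VA _) => //; exact: tI.
set mb := m + m' * (t1 - t0).
have mb0 : 0 <= mb by rewrite addr_ge0// mulr_ge0// subr_ge0; lra.
have W n : weight_bound (2 * mb + A / 2 ^+ n).
  elim: n => [|n IH].
    move=> be' s bb ba sI sk; have [t0s _] := andP sI.
    have be'0 : 0 < be' by exact: lt_le_trans bb.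
    have w1 := weight_ge1 t0s sk.
    rewrite expr0 divr1.
    have q0 : 0 <= 2 * mb by rewrite mulr_ge0.
    have w0 : 0 <= stab_weight be' s by apply: le_trans w1.
    have q1 : A <= 2 * mb + A by rewrite lerDr.
    apply: (Ebound_le be'0 (ltW ba) _ _ (VA sI)).
      by apply: mulr_ge0 => //; exact: le_trans q1.
    apply: (le_trans (y := A * stab_weight be' s)); first by rewrite ler_peMr.
    exact: ler_wpM2r.
  have := weight_step _ IH; have -> : m + m' * (t1 - t0) + (2 * mb + A / 2 ^+ n) / 2 =
      2 * mb + A / 2 ^+ n.+1.
    by rewrite -/mb exprS; field; rewrite gt_eqF// exprn_gt0.
  apply; rewrite addr_ge0 ?mulr_ge0// invr_ge0 exprn_ge0//.
move=> th Lt; set X := expR _; have X0 : 0 < X := expR_gt0 _.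
have Y1 := weight_ge1 t0t tk; set Y := stab_weight be t in Y1 *.
apply/ler_addgt0Pr => e e0.
pose n := Num.truncn (A * Y * X / e).
have := W n be t (lexx _) be_al tI tk th Lt; rewrite -/X -/Y => /le_trans; apply.
rewrite mulrDl mulrDl lerD2l.
rewrite -(mulrA A) -!(mulrA A) -mulrA mulrCA.
have h : A * Y * X / e < 2 ^+ n.
  apply: lt_le_trans (truncnS_gt _) _.
  by rewrite -natrX ler_nat -/n ltn_expl.
have p0 : 0 < 2 ^+ n :> R by rewrite exprn_gt0.
rewrite ler_pdivrMl//; move: h; rewrite ltr_pdivrMr// => h.
by rewrite mulrA ltW.
Qed.

End stability.

(** * Geometric decay *)

Section geometric_decay.
Variable R : realType.

(** Equivalently, [(1 - r) * (1 + r + ... + r^n)] is at least [(1 - r) * (n + 1) * r^n], because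
    [r^n] is the smallest term of the sum. *)
Lemma geometric_weighted_le (r : R) n : 0 <= r -> r <= 1 ->
  (1 - r) * n.+1%:R * r ^+ n + r ^+ n.+1 <= 1.
Proof.
move=> r0 r1; elim: n => [|n IH]; first by rewrite expr0 expr1; lra.
have -> : (1 - r) * n.+2%:R * r ^+ n.+1 + r ^+ n.+2 =
    r * ((1 - r) * n.+1%:R * r ^+ n + r ^+ n.+1) + (1 - r) * r ^+ n.+1.
  by rewrite [n.+2%:R]mulrS !exprS; ring.
have h1 : r ^+ n.+1 <= 1 by rewrite exprn_ile1.
have h2 : r * ((1 - r) * n.+1%:R * r ^+ n + r ^+ n.+1) <= r * 1 by rewrite ler_wpM2l.
have h3 : (1 - r) * r ^+ n.+1 <= (1 - r) * 1 by rewrite ler_wpM2l// subr_ge0.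
lra.
Qed.

Lemma geometric_le (r : R) n : 0 <= r -> r < 1 -> r ^+ n <= (1 - r)^-1 / n.+1%:R.
Proof.
move=> r0 r1; have d0 : 0 < 1 - r by rewrite subr_gt0.
rewrite ler_pdivlMr ?ltr0n// -[leRHS]mul1r ler_pdivlMr//.
have := geometric_weighted_le n r0 (ltW r1); have : 0 <= r ^+ n.+1 by rewrite exprn_ge0.
by lra.
Qed.

(** With [q = r ^+ 2], one factor [r ^+ n] absorbs [n + 1] and the other provides the decay. *)
Lemma geometric_n_le (q : R) : 0 <= q -> q < 1 ->
  exists2 D, 0 <= D & forall n, n.+1%:R * q ^+ n <= D / n.+1%:R.
Proof.
move=> q0 q1; pose r := Num.sqrt q.
have r0 : 0 <= r by exact: sqrtr_ge0.
have r1 : r < 1 by rewrite -sqrtr1 ltr_sqrt.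
have d0 : 0 < 1 - r by rewrite subr_gt0.
exists ((1 - r)^-1 * (1 - r)^-1) => [|n]; first by rewrite mulr_ge0// invr_ge0 ltW.
have -> : q ^+ n = r ^+ n * r ^+ n by rewrite -exprMn -expr2 sqr_sqrtr.
have h := geometric_le n r0 r1; have n0 : 0 < n.+1%:R :> R by rewrite ltr0n.
have h2 : n.+1%:R * r ^+ n <= (1 - r)^-1.
  by apply: le_trans (ler_wpM2l (ltW n0) h) _; rewrite mulrCA divff ?mulr1// gt_eqF.
rewrite mulrA -[leRHS]mulrA; apply: ler_pM => //; last exact: exprn_ge0.
by rewrite mulr_ge0// ?exprn_ge0// ltW.
Qed.

Lemma geometric_sum_le (q : R) n m : 0 <= q -> q < 1 ->
  \sum_(n <= i < m) q ^+ i <= q ^+ n / (1 - q).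
Proof.
move=> q0 q1; have d0 : 0 < 1 - q by rewrite subr_gt0.
have [mn|nm] := leqP m n; first by rewrite big_geq// divr_ge0 ?exprn_ge0// ltW.
rewrite ler_pdivlMr// mulrC.
have -> : (1 - q) * \sum_(n <= i < m) q ^+ i = q ^+ n - q ^+ m.
  elim: m nm => // m IH; rewrite ltnS => nm; rewrite big_nat_recr//= mulrDr.
  have [e|nm'] := eqVneq n m; first by rewrite e big_geq// exprS; ring.
  by rewrite IH ?ltn_neqAle ?nm'// exprS; ring.
by rewrite gerBl exprn_ge0.
Qed.

(** The left side is one term of the series of [e^n]. This is where the [e] in [delta] comes
    from. *)
Lemma natpow_fact_le n : (n%:R ^+ n / n`!%:R : R) <= expR 1 ^+ n.
Proof.
case: n => [|n]; first by rewrite !expr0 fact0 divr1.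
rewrite -expRM_natl mulr_natl.
by have := @expR_ge1Dxn R n.+1%:R n (ler0n _ _); lra.
Qed.

End geometric_decay.

(** * The Taylor series of a solution *)

Section taylor_series.
Context (R : realType) (d : nat).
Local Notation E := (Rd R d).
Local Notation C := R[i].
Local Notation L1 := (@L1 R d).

(* Differentiability in time is only required after evaluation at each [th]: this is
   easily checked for exponential functionals, and still implies uniqueness. *)
Definition pointwise_solution (L : ((E -> C) -> C) -> (E -> C) -> C) (al T : R)
    (B0 : (E -> C) -> C) (u : R -> (E -> C) -> C) :=
  [/\ forall t, 0 <= t < T -> entire (u t),
      forall T1, 0 <= T1 -> T1 < T ->
        exists A, forall t, 0 <= t <= T1 -> Ebound al (u t) A,
      forall th T1, L1 th -> 0 <= T1 -> T1 < T -> ccont_on `[0, T1] (fun t => u t th),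
      forall th t, L1 th -> 0 < t < T -> rdiff (fun s => u s th) t (L (u t) th) &
      forall th, L1 th -> u 0 th = B0 th].

Variables (z Phi : R) (b c : E -> E -> R).
Hypothesis z_gt0 : 0 < z.
Hypothesis Phi_ge0 : 0 <= Phi.
Hypothesis ok : kernel_ok Phi b c.
Local Notation L := (Lgen z b c).

Variables (al al0 : R) (B0 : (E -> C) -> C) (K0 : R).
Hypothesis al_gt0 : 0 < al.
Hypothesis al_lt : al < al0.
Hypothesis B0_entire : entire B0.
Hypothesis B0K : Ebound al0 B0 K0.

Let M := Mop z Phi al al0.
Let T := (al0 - al) / (expR 1 * M).
Let al0_gt0 : 0 < al0. Proof. exact: lt_trans al_lt. Qed.
Let K0_ge0 : 0 <= K0. Proof. exact: Ebound_ge0 B0K. Qed.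
Let M_gt0 : 0 < M. Proof. exact: Mop_gt0. Qed.
Let T_gt0 : 0 < T.
Proof. by rewrite divr_gt0 ?subr_gt0// mulr_gt0// expR_gt0. Qed.

Let iterL n := iter n L B0.

(** The gap [al0 - al] is divided into [n] equal steps [h], one for each application of [L], and
    each costs the factor [M / h]. *)
Let iterL_steps n k : (0 < n)%N -> (k <= n)%N -> entire (iterL k) /\
  Ebound (al0 - k%:R * ((al0 - al) / n%:R)) (iterL k) (K0 * (M / ((al0 - al) / n%:R)) ^+ k).
Proof.
move=> n0; set h := (al0 - al) / n%:R.
have nR : 0 < n%:R :> R by rewrite ltr0n.
have h0 : 0 < h by rewrite divr_gt0// subr_gt0.
have hn : n%:R * h = al0 - al by rewrite mulrCA divff ?mulr1// gt_eqF.
elim: k => [|k IH] kn.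
  by rewrite mul0r subr0 expr0 mulr1; split.
have [e1 b1] := IH (ltnW kn).
have k1 : k.+1%:R * h <= n%:R * h by rewrite ler_wpM2r ?(ltW h0)// ler_nat.
have k2 : k.+1%:R * h = k%:R * h + h by rewrite mulrSr mulrDl mul1r.
have alt := al_lt; have agt := al_gt0.
have a1 : 0 < al0 - k%:R * h by lra.
have k3 : 0 <= k%:R * h by rewrite mulr_ge0// ltW.
split; first exact: (Lgen_entire z_gt0 Phi_ge0 ok a1 e1 b1).
have := @Lgen_le _ _ _ _ _ _ z_gt0 Phi_ge0 ok _ _ _ a1 e1 b1 al al0 (al0 - k.+1%:R * h).
move=> /(_ al_gt0 ltac:(lra) ltac:(lra) ltac:(lra)).
have -> : al0 - k%:R * h - (al0 - k.+1%:R * h) = h by rewrite k2; ring.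
by move=> H; rewrite exprSr mulrA; exact: H.
Qed.

Let iterL_entire n : entire (iterL n).
Proof. by have [] := @iterL_steps n.+1 n (ltn0Sn _) (leqnSn _). Qed.

(** The summands of [psum]. Their bounds have ratio [t / T], which explains the length [T] of the
    time interval. *)
Let term t n : (E -> C) -> C := fun th => (t ^+ n / n`!%:R)%:C * iterL n th.

Lemma term_Ebound t n : 0 <= t -> Ebound al (term t n) (K0 * (t / T) ^+ n).
Proof.
move=> t0.
have c0 : 0 <= t ^+ n / n`!%:R by rewrite divr_ge0// exprn_ge0.
have base K : 0 <= K -> Ebound al (iterL n) K -> Ebound al (term t n) (t ^+ n / n`!%:R * K).
  move=> K1 H th Lt; rewrite normcM normcR ger0_norm// -[leRHS]mulrA ler_wpM2l//; exact: H.
(* For [n = 0] there is no step length [(al0 - al) / n]; the bound is then the embedding of index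
   [al0] into index [al]. *)
case: n c0 base => [|n] c0 base.
  rewrite !expr0 mulr1.
  have := base K0 K0_ge0; rewrite expr0 fact0 divr1 mul1r; apply.
  exact: (Ebound_le al_gt0 (ltW al_lt) K0_ge0 (lexx _) B0K).
set N := n.+1 in c0 base *.
have nR : 0 < N%:R :> R by rewrite ltr0n.
have a0 : 0 < al0 - al by rewrite subr_gt0.
have [_ H] := @iterL_steps N N (ltn0Sn _) (leqnn _).
have hE : al0 - N%:R * ((al0 - al) / N%:R) = al by field; rewrite gt_eqF.
rewrite hE in H.
have K1 : 0 <= K0 * (M / ((al0 - al) / N%:R)) ^+ N := Ebound_ge0 H.
apply: (Ebound_le al_gt0 (lexx _) _ _ (base _ K1 H)).
  by rewrite mulr_ge0// exprn_ge0// divr_ge0// ltW.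
have -> : t ^+ N / N`!%:R * (K0 * (M / ((al0 - al) / N%:R)) ^+ N) =
   K0 * ((t * M / (al0 - al)) ^+ N * (N%:R ^+ N / N`!%:R)).
  have -> : M / ((al0 - al) / N%:R) = M / (al0 - al) * N%:R by field; rewrite !gt_eqF.
  have -> : t * M / (al0 - al) = t * (M / (al0 - al)) by rewrite -[LHS]mulrA.
  rewrite !exprMn; ring.
rewrite ler_wpM2l//.
have -> : (t / T) ^+ N = (t * M / (al0 - al)) ^+ N * expR 1 ^+ N.
  rewrite -exprMn; congr (_ ^+ _); rewrite /T; field.
  by rewrite !gt_eqF// expR_gt0.
apply: ler_wpM2l; last exact: natpow_fact_le.
by rewrite exprn_ge0// divr_ge0 ?(ltW a0)// mulr_ge0// ltW.
Qed.

Definition psum (N : nat) (t : R) : (E -> C) -> C := fun th =>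
  \sum_(n < N) (t ^+ n / n`!%:R)%:C * iter n L B0 th.

Lemma psumS N t th : psum N.+1 t th = psum N t th + term t N th.
Proof. by rewrite /psum big_ord_recr. Qed.

Let zero_entire : entire (fun _ : E -> C => 0 : C).
Proof.
split.
- by [].
- by move=> th _; exists 1, 0; split => // *; rewrite normc0.
- by move=> t0 t1 _ _ w; apply/derivable_cdiff; exists 0; exact: cdiff_cst.
Qed.

Lemma psum_entire N t : entire (psum N t).
Proof.
elim: N => [|N IH].
  by have -> : psum 0 t = fun=> 0 by apply/funext => th; rewrite /psum big_ord0.
have -> : psum N.+1 t = fun th => psum N t th + (t ^+ N / N`!%:R)%:C * iterL N th.
  by apply/funext => th; rewrite psumS.
exact: entire_lin _ IH (iterL_entire N).
Qed.

Lemma psum_tail N N' t th : 0 <= t -> t < T -> L1 th -> (N <= N')%N ->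
  normc (psum N' t th - psum N t th) <= K0 * (t / T) ^+ N / (1 - t / T) * expR (al^-1 * L1norm th).
Proof.
move=> t0 tT Lt NN.
have q0 : 0 <= t / T by rewrite divr_ge0// ltW.
have q1 : t / T < 1 by rewrite ltr_pdivrMr// mul1r.
apply: (le_trans (y := K0 * (\sum_(N <= i < N') (t / T) ^+ i) * expR (al^-1 * L1norm th))).
  elim: N' NN => [|N' IH]; first by rewrite leqn0 => /eqP ->; rewrite subrr normc0 big_geq// mulr0 mul0r.
  rewrite leq_eqVlt => /predU1P[<-|]; first by rewrite subrr normc0 big_geq// mulr0 mul0r.
  rewrite ltnS => NN; rewrite psumS big_nat_recr//= mulrDr mulrDl.
  rewrite addrAC; apply: le_trans (le_normcD _ _) _; apply: lerD; first exact: IH.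
  exact: term_Ebound.
by rewrite ler_wpM2r ?expR_ge0// -[leRHS]mulrA ler_wpM2l// geometric_sum_le.
Qed.

Lemma psum_Ebound N t : 0 <= t -> t < T -> Ebound al (psum N t) (K0 / (1 - t / T)).
Proof.
move=> t0 tT th Lt; have := psum_tail t0 tT Lt (leq0n N).
by rewrite expr0 mulr1 {2}/psum big_ord0 subr0.
Qed.

Lemma L_psum N t th : 0 <= t -> t < T -> L1 th ->
  L (psum N t) th = \sum_(n < N) (t ^+ n / n`!%:R)%:C * iter n.+1 L B0 th.
Proof.
move=> t0 tT Lt; elim: N => [|N IH].
  (* The zero functional equals itself minus itself, so linearity alone gives the value 0. *)
  rewrite big_ord0; have b0 := psum_Ebound 0 t0 tT.
  have := Lgen_lin z ok (-1) al_gt0 (psum_entire 0 t) (psum_entire 0 t) b0 b0 Lt.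
  have -> : (fun th => psum 0 t th + -1 * psum 0 t th) = psum 0 t.
    by apply/funext => h; rewrite /psum big_ord0 mulr0 addr0.
  by move=> ->; rewrite mulN1r subrr.
rewrite big_ord_recr /= -IH.
have -> : psum N.+1 t = fun th => psum N t th + (t ^+ N / N`!%:R)%:C * iterL N th.
  by apply/funext => h; rewrite psumS.
(* Read off from [term_Ebound] at [t = T], where the coefficient in front of the iterate is
   positive. *)
have [K1 b1] : exists K1, Ebound al (iterL N) K1.
  exists (K0 * (T / T) ^+ N / (T ^+ N / N`!%:R)) => h Lh.
  have f0 : 0 < T ^+ N / N`!%:R by rewrite divr_gt0 ?exprn_gt0// ltr0n fact_gt0.
  have := term_Ebound N (ltW T_gt0) Lh; rewrite normcM normcR gtr0_norm//.
  by rewrite -ler_pdivlMl// => /le_trans; apply; rewrite [leRHS]mulrAC mulrC.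
by rewrite (Lgen_lin z ok _ al_gt0 (psum_entire N t) (iterL_entire N) (psum_Ebound N t0 tT) b1 Lt).
Qed.

(** Differentiation lowers the order by one, so [psum N.+1] solves the equation up to the single
    residual [t^N / N! L^(N+1) B0], the source term of the stability argument. *)
Lemma rdiff_psum N t th : 0 <= t -> t < T -> L1 th ->
  rdiff (fun s => psum N.+1 s th) t (L (psum N t) th).
Proof.
move=> t0 tT Lt; rewrite L_psum//; elim: N => [|N IH].
  have -> : (fun s => psum 1 s th) = fun=> B0 th.
    by apply/funext => s; rewrite /psum big_ord1 expr0 fact0 divr1 mul1r.
  by rewrite big_ord0; exact: rdiff_cst.
have -> : (fun s => psum N.+2 s th) = fun s => psum N.+1 s th + iterL N.+1 th * (s ^+ N.+1 / N.+1`!%:R)%:C.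
  by apply/funext => s; rewrite psumS /term [X in _ + X]mulrC.
rewrite big_ord_recr; apply: (rdiffD IH); rewrite [X in rdiff _ _ X]mulrC.
apply: rdiffZ.
have h0 : is_derive t 1 (id ^+ N.+1 : R -> R) (N.+1%:R * t ^+ N).
  by apply: is_derive_eq; rewrite /= -[_ *: _]/(_ * _) mulr1 mulr_natl.
have fN : N.+1`!%:R = N.+1%:R * N`!%:R :> R by rewrite factS natrM.
have h1 := is_deriveZ (N.+1`!%:R^-1) h0.
have -> : (fun s : R => s ^+ N.+1 / N.+1`!%:R) = (N.+1`!%:R^-1) *: (id ^+ N.+1 : R -> R).
  have -> : (id ^+ N.+1 : R -> R) = fun s => s ^+ N.+1.
    elim: N.+1 => [|n IHn]; first by rewrite expr0; apply/funext => s; rewrite expr0.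
    by rewrite exprS IHn; apply/funext => s; rewrite exprS.
  by apply/funext => s; rewrite mulrC.
apply: (is_derive_eq h1); rewrite -[_ *: _]/(_ * _).
by rewrite fN invfM mulrACA mulVf ?pnatr_eq0// mul1r mulrC.
Qed.

End taylor_series.

Lemma ccont_onB (R : realType) (A : set R) (c1 c2 : R -> R[i]) :
  ccont_on A c1 -> ccont_on A c2 -> ccont_on A (fun s => c1 s + -1 * c2 s).
Proof.
move=> [h1 h2] [h3 h4]; split.
  have -> : (fun s => complex.Re (c1 s + -1 * c2 s)) =
      (fun s => complex.Re (c1 s)) - (fun s => complex.Re (c2 s)).
    by apply/funext => s; rewrite mulN1r raddfB.
  by move=> x; apply: cvgB; [exact: h1|exact: h3].
have -> : (fun s => complex.Im (c1 s + -1 * c2 s)) =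
    (fun s => complex.Im (c1 s)) - (fun s => complex.Im (c2 s)).
  by apply/funext => s; rewrite mulN1r raddfB.
by move=> x; apply: cvgB; [exact: h2|exact: h4].
Qed.

Section solution_taylor.
Context (R : realType) (d : nat).
Local Notation E := (Rd R d).
Local Notation C := R[i].
Local Notation L1 := (@L1 R d).

Variables (z Phi : R) (b c : E -> E -> R).
Hypothesis z_gt0 : 0 < z.
Hypothesis Phi_ge0 : 0 <= Phi.
Hypothesis ok : kernel_ok Phi b c.
Local Notation L := (Lgen z b c).

Variables (al al0 : R) (B0 : (E -> C) -> C) (K0 : R).
Hypothesis al_gt0 : 0 < al.
Hypothesis al_lt : al < al0.
Hypothesis B0_entire : entire B0.
Hypothesis B0K : Ebound al0 B0 K0.

Let T := (al0 - al) / (expR 1 * Mop z Phi al al0).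
Let K0_ge0 : 0 <= K0. Proof. exact: Ebound_ge0 B0K. Qed.
Let T_gt0 : 0 < T.
Proof.
rewrite divr_gt0 ?subr_gt0// mulr_gt0// ?expR_gt0//; apply: Mop_gt0 => //.
exact: lt_trans al_lt.
Qed.

Local Notation psum := (psum z b c B0).

Variable u : R -> (E -> C) -> C.
Hypothesis u_sol : pointwise_solution L al T B0 u.

(* The Taylor series converges at time [t]; propagated by steps of length [tau], which
   may be taken uniform because [u] stays bounded in the fixed space of index [al]. *)
Let CL t := forall th, L1 th -> forall e, 0 < e ->
  exists N0, forall N, (N0 <= N)%N -> normc (u t th - psum N t th) <= e.

(** Convergence at each [th], at whatever rate, already yields the quantitative tail at the full
    index [al]; this undoes the loss of index in [CL_step_bound]. *)
Let CL_tail t : 0 <= t -> t < T -> CL t -> forall N,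
  Ebound al (fun th => u t th + -1 * psum N t th) (K0 * (t / T) ^+ N / (1 - t / T)).
Proof.
move=> t0 tT H N th Lt; apply/ler_addgt0Pr => e e0.
have [N0 HN] := H th Lt e e0.
have := HN (maxn N0 N) (leq_maxl _ _) => h1.
have h2 := psum_tail z_gt0 Phi_ge0 ok al_gt0 al_lt B0_entire B0K t0 tT Lt (leq_maxr N0 N).
have -> : u t th + -1 * psum N t th = (u t th - psum (maxn N0 N) t th) +
  (psum (maxn N0 N) t th - psum N t th) by ring.
by rewrite addrC; apply: le_trans (le_normcD _ _) _; apply: lerD.
Qed.

(** [k] turns the condition [kM] into an equality, and [tau] is half of the time budget
    [k * (al - be)], so that the stability weight stays at most 2. *)
Let be := al / 2.
Let k := (8 * Mop z Phi be al)^-1.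
Let tau := k * (al / 4).

Let be_gt0 : 0 < be. Proof. by rewrite divr_gt0. Qed.
Let be_al : be < al. Proof. by have := al_gt0; rewrite /be; lra. Qed.
Let M1_gt0 : 0 < Mop z Phi be al. Proof. exact: Mop_gt0. Qed.
Let k_gt0 : 0 < k. Proof. by rewrite invr_gt0 mulr_gt0. Qed.
Let tau_gt0 : 0 < tau. Proof. by rewrite mulr_gt0// divr_gt0. Qed.
Let kM : 4 * Mop z Phi be al * k <= 2^-1.
Proof.
rewrite /k le_eqVlt; apply/orP; left; apply/eqP; field.
by rewrite gt_eqF.
Qed.

Variable T1 : R.
Hypothesis T1_gt0 : 0 < T1.
Hypothesis T1_lt : T1 < T.
Let q := T1 / T.
Let q_ge0 : 0 <= q. Proof. by rewrite divr_ge0// ltW. Qed.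
Let q_lt1 : q < 1. Proof. by rewrite ltr_pdivrMr// mul1r. Qed.

(** [ode_stability] applied to the error from time [a] on: its initial value is a series tail, its
    source a single Taylor term, and the factor 4 is the constant 2 times the weight bound 2. *)
Let CL_step_bound a t N : 0 <= a -> a <= t -> t <= T1 -> t - a <= tau -> CL a ->
  Ebound be (fun th => u t th + -1 * psum N.+1 t th)
    (4 * (K0 * q ^+ N.+1 / (1 - q) + N.+1%:R / T1 * (K0 * q ^+ N.+1) * (t - a))).
Proof.
move=> a0 at_ tT1 ttau Ca.
have [uE uA uC uD u0] := u_sol.
have inT s : a <= s <= t -> 0 <= s /\ s < T.
  by move=> /andP[h1 h2]; split; [exact: le_trans h1|apply: le_lt_trans T1_lt; exact: le_trans tT1].
have sq s : a <= s <= t -> s / T <= q.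
  by move=> /andP[_ h]; rewrite ler_wpM2r ?invr_ge0 ?(ltW T_gt0)//; exact: le_trans tT1.
have pE := psum_entire z_gt0 Phi_ge0 ok al_gt0 al_lt B0_entire B0K.
have pB := psum_Ebound z_gt0 Phi_ge0 ok al_gt0 al_lt B0_entire B0K.
have [A uA1] := uA T1 (ltW T1_gt0) T1_lt.
have sT1 s : a <= s <= t -> 0 <= s <= T1.
  by move=> /andP[h1 h2]; apply/andP; split; [exact: le_trans h1|exact: le_trans tT1].
have d1 : 0 < 1 - q by rewrite subr_gt0.
have dle s : a <= s <= t -> (1 - s / T)^-1 <= (1 - q)^-1.
  move=> sI; rewrite lef_pV2 ?posrE// ?subr_gt0; first by rewrite lerB// sq.
  by apply: le_lt_trans q_lt1; exact: sq.
pose V s := fun th => u s th + -1 * psum N.+1 s th.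
pose F s := fun th => (s ^+ N / N`!%:R)%:C * iter N.+1 L B0 th.
have V_entire s : a <= s <= t -> entire (V s).
  move=> /inT[s0 sT]; apply: entire_lin; last exact: pE.
  by apply: uE; rewrite s0 sT.
have pB1 s : a <= s <= t -> Ebound al (psum N.+1 s) (K0 / (1 - q)).
  move=> sI; have [s0 sT] := inT s sI; apply: Ebound_le (pB N.+1 s s0 sT) => //.
    by rewrite divr_ge0// ltW.
  by rewrite ler_wpM2l// dle.
have VA s : a <= s <= t -> Ebound al (V s) (A + normc (-1 : C) * (K0 / (1 - q))).
  by move=> sI; apply: Ebound_lin; [apply: uA1; exact: sT1|exact: pB1].
have dp s th : a <= s <= t -> L1 th ->
    rdiff (fun s => psum N.+1 s th) s (L (psum N s) th).
  move=> /inT[s0 sT] Lt.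
  exact: (rdiff_psum z_gt0 Phi_ge0 ok al_gt0 al_lt B0_entire B0K).
have V_cont th : L1 th -> ccont_on `[a, t] (fun s => V s th).
  move=> Lt; apply: ccont_onB; last first.
    by apply: (@rdiff_ccont _ `[a, t] _ (fun s => L (psum N s) th)) => s; rewrite in_itv/= => sI; exact: dp.
  have [c1 c2] := uC th T1 Lt (ltW T1_gt0) T1_lt.
  have sub : `[a, t]%classic `<=` `[0, T1]%classic.
    by move=> s /=; rewrite !in_itv/= => sI; exact: sT1.
  by split; apply: continuous_subspaceW; [exact: sub|exact: c1|exact: sub|exact: c2].
have V_eq th s : L1 th -> a < s < t -> rdiff (fun s => V s th) s (L (V s) th + F s th).
  move=> Lt /andP[as_ st]; have sI : a <= s <= t by rewrite !ltW.
  have [s0 sT] := inT s sI.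
  have s0' : 0 < s < T by rewrite sT andbT; exact: le_lt_trans as_.
  have := rdiffB (uD th s Lt s0') (dp s th sI Lt).
  have -> : (fun s => u s th - psum N.+1 s th) = (fun s => V s th).
    by apply/funext => r; rewrite /V mulN1r.
  have := Lgen_lin z ok (-1) al_gt0 (uE s _) (pE N.+1 s) (uA1 s (sT1 s sI)) (pB1 s sI) Lt.
  rewrite -/(V s) => ->; last by rewrite s0 sT.
  have LpE := L_psum z_gt0 Phi_ge0 ok al_gt0 al_lt B0_entire B0K.
  rewrite [L (psum N.+1 s) th]LpE// big_ord_recr /= -LpE// -/(F s th).
  by congr rdiff; rewrite mulN1r opprD addrA subrK.
have V0 : Ebound al (V a) (K0 * q ^+ N.+1 / (1 - q)).
  have aI : a <= a <= t by rewrite lexx at_.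
  have [_ aT] := inT a aI.
  apply: Ebound_le (CL_tail a0 aT Ca N.+1) => //.
    by rewrite divr_ge0 ?(ltW d1)// mulr_ge0// exprn_ge0.
  apply: ler_pM; rewrite ?dle ?invr_ge0 ?subr_ge0//.
  - by rewrite mulr_ge0// exprn_ge0// divr_ge0// ltW.
  - by apply: le_trans (ltW q_lt1); exact: sq.
  - by rewrite ler_wpM2l// lerXn2r ?nnegrE ?sq// divr_ge0// ltW.
have m'0 : 0 <= N.+1%:R / T1 * (K0 * q ^+ N.+1).
  by rewrite !mulr_ge0 ?invr_ge0 ?exprn_ge0 ?(ltW T1_gt0).
(* The coefficient of [F s] is the time derivative of that of the Taylor term [N.+1]; at [T1], where
   it is largest, it is [N.+1 / T1] times the latter. *)
have Fm s : a < s < t -> Ebound al (F s) (N.+1%:R / T1 * (K0 * q ^+ N.+1)).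
  move=> /andP[as_ st] th Lt.
  have s0 : 0 <= s by apply: le_trans a0 _; exact: ltW.
  have sT1' : s <= T1 by apply: le_trans tT1; exact: ltW.
  have fN : 0 < N`!%:R :> R by rewrite ltr0n fact_gt0.
  have := term_Ebound z_gt0 Phi_ge0 ok al_gt0 al_lt B0_entire B0K N.+1 (ltW T1_gt0) Lt.
  rewrite -/q !normcM !normcR => H.
  apply: (le_trans (y := N.+1%:R / T1 * (`|T1 ^+ N.+1 / N.+1`!%:R| * normc (iter N.+1 L B0 th)))).
    rewrite mulrA ler_wpM2r ?normc_ge0//.
    rewrite !ger0_norm ?divr_ge0 ?exprn_ge0// ?(ltW T1_gt0)//.
    have -> : N.+1%:R / T1 * (T1 ^+ N.+1 / N.+1`!%:R) = T1 ^+ N / N`!%:R.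
      rewrite factS natrM exprS; field.
      by rewrite !gt_eqF//= ltr0n.
    by rewrite ler_wpM2r ?invr_ge0 ?(ltW fN)// lerXn2r ?nnegrE// ltW.
  rewrite -[leRHS]mulrA ler_wpM2l// divr_ge0// ltW//.
have tI : a <= t <= t by rewrite at_ lexx.
have tk : (t - a) / k < al - be.
  apply: (@le_lt_trans _ _ (al / 4)).
    by rewrite ler_pdivrMr// mulrC.
  by have := al_gt0; rewrite /be; lra.
have := ode_stability z_gt0 Phi_ge0 ok be_gt0 be_al k_gt0 kM V_entire VA V_cont V_eq V0 Fm
  m'0 tI tk.
set m := K0 * q ^+ N.+1 / (1 - q) + _.
have m0 : 0 <= m.
  apply: addr_ge0; first by rewrite divr_ge0 ?(ltW d1)// mulr_ge0// exprn_ge0.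
  by rewrite mulr_ge0// subr_ge0.
apply: Ebound_le => //; first by rewrite mulr_ge0.
have tk4 : (t - a) / k <= al / 4 by rewrite ler_pdivrMr// mulrC.
have agt := al_gt0; have beE : be = al / 2 by [].
have w2 : stab_weight al a k be t <= 2.
  rewrite /stab_weight ler_pdivrMr; last by rewrite subr_gt0.
  by rewrite beE; lra.
have -> : 4 * m = 2 * m * 2 by ring.
by rewrite ler_wpM2l// mulr_ge0.
Qed.

Let CL_step a t : 0 <= a -> a <= t -> t <= T1 -> t - a <= tau -> CL a -> CL t.
Proof.
move=> a0 at_ tT1 ttau Ca th Lt e e0.
have [D D0 HD] := geometric_n_le q_ge0 q_lt1.
have d1 : 0 < 1 - q by rewrite subr_gt0.
set X := expR (be^-1 * L1norm th); have X0 : 0 < X := expR_gt0 _.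
pose Q := 4 * (K0 * (1 - q)^-1 + K0) * D * X.
exists (Num.truncn (Q / e)).+1 => -[//|N]; rewrite ltnS => HN.
have := CL_step_bound N a0 at_ tT1 ttau Ca Lt; rewrite -/X mulN1r.
move=> /le_trans; apply.
have N2 : 0 < N.+2%:R :> R by rewrite ltr0n.
have qN := HD N.+1; have qN0 : 0 <= q ^+ N.+1 by rewrite exprn_ge0.
have q1N : q ^+ N.+1 <= D / N.+2%:R.
  by apply: le_trans qN; rewrite ler_peMl// ler1n.
have q2N : N.+1%:R * q ^+ N.+1 <= D / N.+2%:R.
  by apply: le_trans qN; rewrite ler_wpM2r// ler_nat.
have tT : (t - a) / T1 <= 1 by rewrite ler_pdivrMr// mul1r; lra.
have tT0 : 0 <= (t - a) / T1 by rewrite divr_ge0 ?subr_ge0// ltW.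
apply: (le_trans (y := 4 * (K0 * (1 - q)^-1 * (D / N.+2%:R) + K0 * (D / N.+2%:R)) * X)).
  rewrite ler_wpM2r ?(ltW X0)// ler_wpM2l//; apply: lerD.
    by rewrite mulrAC ler_wpM2l// mulr_ge0// invr_ge0 ltW.
  have -> : N.+1%:R / T1 * (K0 * q ^+ N.+1) * (t - a) =
     K0 * ((N.+1%:R * q ^+ N.+1) * ((t - a) / T1)) by ring.
  rewrite ler_wpM2l//; apply: (le_trans (y := N.+1%:R * q ^+ N.+1 * 1)).
    by rewrite ler_wpM2l// mulr_ge0.
  by rewrite mulr1.
have -> : 4 * (K0 * (1 - q)^-1 * (D / N.+2%:R) + K0 * (D / N.+2%:R)) * X = Q / N.+2%:R.
  by rewrite /Q; ring.
rewrite ler_pdivrMr// -ler_pdivrMl// mulrC.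
apply: ltW; apply: lt_le_trans (truncnS_gt _) _.
by rewrite ler_nat !ltnS; apply: leq_trans HN _.
Qed.

Let CL_all (t : R) : 0 <= t -> t <= T1 -> CL t.
Proof.
suff H : forall j t, 0 <= t -> t <= T1 -> t <= j%:R * tau -> CL t.
  move=> t0 tT1; apply: (H (Num.truncn (t / tau)).+1) => //.
  by rewrite -ler_pdivrMr//; apply/ltW/truncnS_gt.
elim=> [|j IH] {}t t0 tT1.
  rewrite mul0r => tle; have -> : t = 0 by apply/eqP; rewrite eq_le tle.
  move=> th Lt e e0; exists 1%N => -[//|N] _.
  have [_ _ _ _ u0] := u_sol; rewrite u0// /psum big_ord_recl big1 => [|i _].
    by rewrite expr0 fact0 divr1 mul1r addr0 subrr normc0 ltW.
  by rewrite /= exprS !mul0r.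
move=> tj; have [tj'|tj'] := leP t (j%:R * tau); first exact: IH.
have jt : 0 <= j%:R * tau by rewrite mulr_ge0// ltW.
apply: (@CL_step (j%:R * tau)) => //; first exact: ltW.
  by move: tj; rewrite -[j.+1%:R]natr1 mulrDl mul1r; lra.
apply: IH => //; apply: le_trans tT1; exact: ltW.
Qed.

Lemma solution_taylor_lt N t : 0 <= t -> t <= T1 ->
  Ebound al (fun th => u t th + -1 * psum N t th) (K0 * (t / T) ^+ N / (1 - t / T)).
Proof.
move=> t0 tT1; apply: CL_tail => //; last exact: CL_all.
exact: le_lt_trans T1_lt.
Qed.

End solution_taylor.

Lemma solution_taylor (R : realType) (d : nat) (z Phi : R) (b c : Rd R d -> Rd R d -> R)
    (al al0 K0 : R) (B0 : (Rd R d -> R[i]) -> R[i]) (u : R -> (Rd R d -> R[i]) -> R[i]) :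
  0 < z -> 0 <= Phi -> kernel_ok Phi b c -> 0 < al -> al < al0 ->
  entire B0 -> Ebound al0 B0 K0 ->
  let T := (al0 - al) / (expR 1 * Mop z Phi al al0) in
  pointwise_solution (Lgen z b c) al T B0 u ->
  forall N t, 0 <= t < T ->
  Ebound al (fun th => u t th + -1 * psum z b c B0 N t th) (K0 * (t / T) ^+ N / (1 - t / T)).
Proof.
move=> z0 P0 ok a0 a1 eB bB T su N t /andP[t0 tT].
have T0 : 0 < T by apply: le_lt_trans tT.
(* A horizon strictly between [t] and [T], because uniform bounds on [u] are available on closed
   subintervals only. *)
have h1 : 0 < (t + T) / 2 by rewrite divr_gt0// ltr_wpDl.
have h2 : (t + T) / 2 < T by lra.
apply: (solution_taylor_lt z0 P0 ok a0 a1 eB bB su h1 h2) => //; lra.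
Qed.

(** * The convergence of solutions *)

Section Enorm_bounds.
Context (R : realType) (d : nat).
Local Notation E := (Rd R d).
Local Notation C := R[i].
Local Notation L1 := (@L1 R d).
Implicit Types B : (E -> C) -> C.

Lemma Enorm_ge0 (al : R) B : (0 <= Enorm al B)%E.
Proof.
apply: (@le_trans _ _ (normc (B (fun=> 0)) * expR (- (al^-1 * L1norm (fun _ : E => 0 : C))))%:E).
  by rewrite lee_fin mulr_ge0 ?normc_ge0 ?expR_ge0.
by apply: ereal_sup_ubound; exists (fun=> 0) => //; exact: L1_0.
Qed.

Lemma Enorm_le (al : R) B K : Ebound al B K -> (Enorm al B <= K%:E)%E.
Proof.
move=> H; apply: ge_ereal_sup => _ [th Lt <-]; rewrite lee_fin expRN.
by rewrite ler_pdivrMr ?expR_gt0//; exact: H.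
Qed.

Lemma Ebound_Enorm (al : R) B K : (Enorm al B <= K%:E)%E -> Ebound al B K.
Proof.
move=> H th Lt; rewrite -ler_pdivrMr ?expR_gt0// -expRN -lee_fin.
by apply: le_trans H; apply: ereal_sup_ubound; exists th.
Qed.

Lemma Espace_Ebound (al : R) B : Espace al B -> exists K, Ebound al B K.
Proof.
move=> [_ H]; exists (fine (Enorm al B)); apply: Ebound_Enorm.
by rewrite fineK// ge0_fin_numE// Enorm_ge0.
Qed.

Lemma Enorm_cvg0P (al : R) (T : Type) (F : set_system T) (FF : Filter F)
    (f : T -> (E -> C) -> C) :
  (Enorm al (f s) @[s --> F] --> 0%E) <->
  forall e : R, 0 < e -> \forall s \near F, Ebound al (f s) e.
Proof.
split.
- move=> /fine_cvgP[fin cv] e e0.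
  move/cvgrPdist_le: cv => /(_ e e0) H; near=> s.
  apply: Ebound_Enorm; rewrite -[leLHS]fineK; last by near: s.
  have h : `|0 - fine (Enorm al (f s))| <= e by near: s.
  by move: h; rewrite lee_fin sub0r normrN ger0_norm// fine_ge0// Enorm_ge0.
- move=> H; apply/fine_cvgP; split.
    near=> s; rewrite ge0_fin_numE ?Enorm_ge0//.
    apply: (@le_lt_trans _ _ 1%:E); last exact: ltry.
    by apply: Enorm_le; near: s; exact: H.
  apply/cvgrPdist_le => e e0; near=> s.
  rewrite sub0r normrN ger0_norm ?fine_ge0 ?Enorm_ge0//.
  have h : (Enorm al (f s) <= e%:E)%E by apply: Enorm_le; near: s; exact: H.
  rewrite -lee_fin fineK// ge0_fin_numE ?Enorm_ge0//.
  exact: le_lt_trans h (ltry _).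
Unshelve. all: by end_near. Qed.

End Enorm_bounds.

(** * The kernels attached to the potential *)

Section potential_kernels.
Context (R : realType) (d : nat).
Local Notation E := (Rd R d).
Local Notation C := R[i].
Local Notation mu := (lebesgue_Rd R d).
Variable phi : E -> \bar R.
Hypothesis phi_meas : measurable_fun setT phi.
Hypothesis phi_ge0 : forall x, (0 <= phi x)%E.
Hypothesis phi_int : mu.-integrable setT phi.

(** [fine] sends [+oo] to 0; for each [x] this concerns a null set of [y], since [phi] is
    integrable. *)
Definition phi_at (x y : E) : R := fine (phi (Rdsub x y)).

Lemma phi_at_ge0 x y : 0 <= phi_at x y.
Proof. by rewrite fine_ge0. Qed.

Lemma phi_at_fin x : \forall y \ae mu, phi (Rdsub x y) = (phi_at x y)%:E.
Proof.
have H : \forall y \ae mu, phi y = (fine (phi y))%:E.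
  have := integrable_ae measurableT phi_int.
  by apply: filterS => y /(_ I) h; rewrite fineK.
exact: ae_refl H.
Qed.

Lemma measurable_phi_at : measurable_fun setT (fun p : E * E => phi_at p.1 p.2).
Proof.
apply: measurableT_comp => //; apply: measurableT_comp => //.
exact: measurable_Rdsub.
Qed.

Lemma measurable_phi_atr x : measurable_fun setT (phi_at x).
Proof.
apply: measurableT_comp => //; apply: measurableT_comp => //.
exact: measurable_Rdsubr.
Qed.

Lemma integral_phi_at x : (\int[mu]_y (phi_at x y)%:E = \int[mu]_y phi y)%E.
Proof.
rewrite -(ge0_integral_refl x phi_meas phi_ge0); apply: ae_eq_integral => //.
- by apply/measurable_EFinP; exact: measurable_phi_atr.
- exact: (measurableT_comp phi_meas (measurable_Rdsubr x)).
- by apply: filterS (phi_at_fin x) => y -> _.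
Qed.

Lemma rint_phi_at x : rint mu (phi_at x).
Proof.
apply/integrableP; split; first by apply/measurable_EFinP; exact: measurable_phi_atr.
under eq_integral do rewrite /= ger0_norm ?phi_at_ge0//.
rewrite integral_phi_at; have /integrableP[_] := phi_int.
by under eq_integral do rewrite gee0_abs//.
Qed.

Lemma Rintegral_phi_at x : \int[mu]_y phi_at x y = phinorm phi.
Proof.
rewrite /Rintegral integral_phi_at /phinorm Lnorm1; congr fine.
by apply: eq_integral => y _; rewrite gee0_abs.
Qed.

Lemma phinorm_ge0 : 0 <= phinorm phi.
Proof. by rewrite fine_ge0// Lnorm_ge0. Qed.

Lemma boltzmannE eps x y : 0 < eps -> boltzmann phi eps x y =
  if phi (Rdsub x y) == +oo%E then 0 else expR (- (eps * phi_at x y)).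
Proof.
move=> e0; rewrite /boltzmann /phi_at; have := phi_ge0 (Rdsub x y).
case: (phi _) => [r|_|//] /=; first by [].
by rewrite gt0_muley ?lte_fin.
Qed.

Lemma boltzmann_itv eps x y : 0 < eps -> 0 <= boltzmann phi eps x y <= 1.
Proof.
move=> e0; rewrite boltzmannE//; case: ifP => _; first by rewrite lexx ler01.
by rewrite expR_ge0 -expR0 ler_expR oppr_le0 mulr_ge0 ?phi_at_ge0// ltW.
Qed.

Lemma measurable_boltzmann eps : 0 < eps ->
  measurable_fun setT (fun p : E * E => boltzmann phi eps p.1 p.2).
Proof.
move=> e0.
have mp : measurable_fun setT (fun p : E * E => phi (Rdsub p.1 p.2)).
  by apply: measurableT_comp => //; exact: measurable_Rdsub.
have mS : measurable [set p : E * E | phi (Rdsub p.1 p.2) = +oo%E].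
  have := mp measurableT [set +oo%E] (emeasurable_set1 _).
  by rewrite setTI.
(* The case distinction at [+oo] becomes a factor 1 minus an indicator, so that a product of
   measurable functions results. *)
have -> : (fun p : E * E => boltzmann phi eps p.1 p.2) = (fun p : E * E =>
    (1 - \1_[set p : E * E | phi (Rdsub p.1 p.2) = +oo%E] p) * expR (- (eps * phi_at p.1 p.2))).
  apply/funext => p; rewrite boltzmannE// indicE.
  have [h|h] := eqVneq (phi (Rdsub p.1 p.2)) +oo%E.
    by rewrite mem_set// subrr mul0r.
  by rewrite memNset ?subr0 ?mul1r//; exact/eqP.
apply: measurable_funM.
  by apply: measurable_funB => //; exact: measurable_indic.
apply: measurableT_comp; first exact: measurable_expR.
apply: measurableT_comp => //; apply: measurable_funM => //; exact: measurable_phi_at.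
Qed.

(** With [u = eps * phi], the first part gives the [eps]-independent bound on the kernels, the
    second the rate of convergence. Both follow from [e^-u <= 1 / (1 + u)] and tangent
    inequalities. *)
Lemma expRN_bounds (u : R) : 0 <= u -> 0 <= 1 - expR (- u) <= u /\
  0 <= expR (- u) - 1 + u <= u ^+ 2.
Proof.
move=> u0; have h1 := expR_ge1Dx (- u); have h2 := expR_ge1Dx u.
have h3 : expR (- u) <= (1 + u)^-1.
  by rewrite expRN lef_pV2 ?posrE ?expR_gt0//; lra.
have h4 : (1 + u)^-1 = 1 - u + u ^+ 2 / (1 + u) by field; rewrite gt_eqF//; lra.
have h5 : u ^+ 2 / (1 + u) <= u ^+ 2.
  by rewrite ler_pdivrMr ?ler_peMr ?sqr_ge0//; lra.
have h6 : expR (- u) <= 1 by rewrite -expR0 ler_expR; lra.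
by split; apply/andP; split; lra.
Qed.

Definition boltzmann_rate (eps : R) (x y : E) : R := (boltzmann phi eps x y - 1) / eps.

Lemma boltzmann_rate_le eps x : 0 < eps ->
  \forall y \ae mu, `|boltzmann_rate eps x y| <= phi_at x y.
Proof.
move=> e0; apply: filterS (phi_at_fin x) => y yfin.
rewrite /boltzmann_rate boltzmannE// yfin /=.
have u0 : 0 <= eps * phi_at x y by rewrite mulr_ge0 ?phi_at_ge0// ltW.
have [/andP[h1 h2] _] := expRN_bounds u0.
rewrite normrM distrC (ger0_norm h1) ger0_norm ?invr_ge0 ?(ltW e0)//.
by rewrite ler_pdivrMr// [leRHS]mulrC.
Qed.

Lemma kernel_ok_ren eps : 0 < eps ->
  kernel_ok (phinorm phi) (boltzmann phi eps) (boltzmann_rate eps).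
Proof.
move=> e0; have mb := measurable_boltzmann e0.
have mr : measurable_fun setT (fun p : E * E => boltzmann_rate eps p.1 p.2).
  by apply: measurable_funM => //; apply: measurable_funB.
have ir x : rint mu (boltzmann_rate eps x).
  apply: rint_le (rint_phi_at x) (boltzmann_rate_le x e0).
  by apply: (measurableT_comp (f := fun p : E * E => boltzmann_rate eps p.1 p.2)
    (g := fun y => (x, y))) => //; exact: pair1_measurable.
split => //; first by move=> x y; exact: boltzmann_itv.
move=> x; rewrite -(Rintegral_phi_at x); apply: ae_le_Rintegral.
- exact: rint_norm.
- exact: rint_phi_at.
- exact: boltzmann_rate_le.
Qed.

Lemma kernel_ok_V : kernel_ok (phinorm phi) (fun _ _ => 1) (fun x y => - phi_at x y).
Proof.
split.
- exact: measurable_cst.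
- by apply: measurableT_comp => //; exact: measurable_phi_at.
- by move=> x y; rewrite lexx ler01.
- by move=> x; apply: rintN; exact: rint_phi_at.
- move=> x; rewrite -(Rintegral_phi_at x) le_eqVlt; apply/orP; left; apply/eqP.
  by apply: eq_Rintegral => y _; rewrite normrN ger0_norm// phi_at_ge0.
Qed.

Lemma LVE z B : LV z phi B = Lgen z (fun _ _ => 1) (fun x y => - phi_at x y) B.
Proof.
apply/funext => th; rewrite /LV /Lgen; congr (- Cintegral _); apply/funext => x.
congr (_ * (_ - _ * B _)); apply/funext => y.
by rewrite /affine_kernel rmorph1 mulr1 rmorphN.
Qed.

End potential_kernels.
Lemma near_within_sub (R : realType) (A A' : set R) (t : R) (P Q : R -> Prop) :
  (forall s, A' s -> A s) -> (forall s, A' s -> P s -> Q s) ->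
  (\forall s \near within A (nbhs t), P s) -> \forall s \near within A' (nbhs t), Q s.
Proof.
move=> AA PQ H; have H' : nbhs t (fun s => A s -> P s) by exact: H.
suff : nbhs t (fun s => A' s -> Q s) by [].
by apply: filterS H' => s h As; apply: PQ => //; apply/h/AA.
Qed.

Section local_solutions.
Context (R : realType) (d : nat).
Local Notation E := (Rd R d).
Local Notation C := R[i].
Local Notation L1 := (@L1 R d).

Lemma Ebound_add (al : R) (B1 B2 B3 : (E -> C) -> C) K1 K2 :
  Ebound al B1 K1 -> Ebound al B2 K2 -> (forall th, L1 th -> B3 th = B1 th + B2 th) ->
  Ebound al B3 (K1 + K2).
Proof.
move=> b1 b2 H th Lt; rewrite H// mulrDl.
by apply: le_trans (le_normcD _ _) _; apply: lerD; [exact: b1|exact: b2].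
Qed.

(** By the triangle inequality the norm of [u t] is continuous in [t], hence attains a maximum on
    [[0, T1]]. *)
Lemma local_solution_bounded (al T : R) (u : R -> (E -> C) -> C) T1 :
  (forall t, 0 <= t < T -> Espace al (u t)) ->
  (forall t, 0 <= t < T ->
        Enorm al (u s \- u t) @[s --> within `[0, T[ (nbhs t)] --> 0%E) ->
  0 <= T1 -> T1 < T -> exists A, forall t, 0 <= t <= T1 -> Ebound al (u t) A.
Proof.
move=> uE uC T10 T1T.
pose N t := fine (Enorm al (u t)).
have NE t : 0 <= t < T -> Ebound al (u t) (N t).
  move=> tI; have [_ f] := uE t tI; apply: Ebound_Enorm.
  by rewrite /N fineK// ge0_fin_numE// Enorm_ge0.
have inT t : 0 <= t <= T1 -> 0 <= t < T by move=> /andP[h1 h2]; rewrite h1 (le_lt_trans h2).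
have Nle t K : 0 <= t < T -> Ebound al (u t) K -> N t <= K.
  move=> tI H; have [_ f] := uE t tI; rewrite -lee_fin /N fineK; first exact: Enorm_le.
  by rewrite ge0_fin_numE// Enorm_ge0.
have cN : {within `[0, T1], continuous N}.
  apply/subspace_continuousP => t; rewrite /= in_itv/= => tI.
  apply/cvgrPdist_le => e e0.
  suff : \forall s \near within `[0, T1] (nbhs t), `|N t - N s| <= e by [].
  have sub s : [set` `[0, T1]] s -> [set` `[0, T[] s by rewrite /= !in_itv/=; exact: inT.
  apply: near_within_sub sub _ ((Enorm_cvg0P _ _ _).1 (uC t (inT t tI)) e e0) => s sI bs.
  have sT : 0 <= s < T by apply: inT; move: sI; rewrite /= in_itv.
  have h1 : N s <= N t + e.
    apply: Nle => //; apply: Ebound_add (NE t (inT t tI)) bs _ => th _ /=.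
    by rewrite addrC subrK.
  have h2 : N t <= N s + e.
    apply: Nle; first exact: inT.
    apply: (Ebound_add (B2 := fun th => - (u s th - u t th)) (NE s sT)) => [th Lt|th _].
      by rewrite normcN; exact: bs.
    by ring.
  by rewrite ler_norml; apply/andP; split; lra.
have [m mI mmax] := EVT_max T10 cN.
exists (N m) => t tI th Lt; apply: le_trans (NE t (inT t tI) th Lt) _.
by rewrite ler_wpM2r ?expR_ge0// mmax// in_itv.
Qed.

(** Evaluation at a fixed [th] is continuous for [Enorm al], with constant [e^(L1norm th / al)], so
    limits in norm pass to values. *)
Lemma local_solution_pointwise L (al T : R) (B0 : (E -> C) -> C) (u : R -> (E -> C) -> C) :
  local_solution L al T B0 u -> pointwise_solution L al T B0 u.
Proof.
move=> [uE uC [u' [u'E uD u'C u'L]] u0]; split.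
- by move=> t /uE[[]].
- move=> T1 h1 h2; apply: (local_solution_bounded (T := T)) => // t /uE[]//.
- move=> th T1 Lt T10 T1T.
  apply: ccont_on_dist => t; rewrite in_itv/= => /andP[t0 tT1] e e0.
  have X0 : 0 < expR (al^-1 * L1norm th) := expR_gt0 _.
  have tI : 0 <= t < T by rewrite t0 (le_lt_trans tT1).
  have X1 : 0 < e / expR (al^-1 * L1norm th) by rewrite divr_gt0.
  have /nbhs_ballP[r r0 Hr] : nbhs t (fun s => [set` `[0, T[] s ->
      Ebound al (u s \- u t) (e / expR (al^-1 * L1norm th))).
    by have := (Enorm_cvg0P _ _ _).1 (uC t tI) _ X1; exact.
  exists r => // s; rewrite in_itv/= => /andP[s0 sT1] st.
  have := Hr s; rewrite /ball/= distrC in_itv/= s0 (le_lt_trans sT1)//.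
  by move=> /(_ st isT th Lt); rewrite divfK ?gt_eqF.
- move=> th t Lt tI; have [t0 tT] := andP tI.
  rewrite -(u'L t tI th (mem_set Lt)); apply/rdiff_epsP => e e0.
  have X0 : 0 < expR (al^-1 * L1norm th) := expR_gt0 _.
  have X1 : 0 < e / expR (al^-1 * L1norm th) by rewrite divr_gt0.
  have /nbhs_ballP[r /= r0 H] : nbhs t (fun s => s != t -> Ebound al (fun theta =>
      (u s theta - u t theta) / (s - t)%:C - u' t theta) (e / expR (al^-1 * L1norm th))).
    by have := (Enorm_cvg0P _ _ _).1 (uD t tI) _ X1; exact.
  exists r => // h hr.
  have [->|h0] := eqVneq h 0.
    by rewrite addr0 subrr mulr0 subr0 normc0 normr0 mulr0.
  have := H (t + h); rewrite /ball/= opprD addrA subrr sub0r normrN => /(_ hr).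
  have th0 : t + h != t by rewrite -subr_eq0 addrAC subrr add0r.
  move=> /(_ th0 th Lt); rewrite divfK ?gt_eqF// addrAC subrr add0r.
  have hC : h%:C != 0 by rewrite -normc_gt0 normcR normr_gt0.
  rewrite -(ler_pM2r (x := `|h|)) ?normr_gt0// -{1}normcR -normcM.
  by rewrite mulrBl divfK.
- by move=> th Lt; apply: u0; exact: mem_set.
Qed.

End local_solutions.

(** * Strong convergence of the generators *)

Section strong_convergence.
Context (R : realType) (d : nat).
Local Notation E := (Rd R d).
Local Notation C := R[i].
Local Notation mu := (lebesgue_Rd R d).
Local Notation L1 := (@L1 R d).

(** In contrast to [entire_lip], [f] and [g] may be far apart: by convexity their segment stays in
    the ball of radius [r], where the directional derivative is bounded. *)
Lemma entire_lip_segment (al : R) (B : (E -> C) -> C) K (f g : E -> C) r : 0 < al ->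
  entire B -> Ebound al B K -> L1 f -> L1 g -> L1norm f <= r -> L1norm g <= r ->
  normc (B g - B f) <= Bball al K (r + 1) * L1norm (fun x => g x - f x).
Proof.
move=> a0 eB bB Lf Lg fr gr; have Lh := L1B Lg Lf; set h := fun x => g x - f x in Lh *.
have cB := entire_line eB Lf Lh.
have := @mean_value_ineq_lin _ (fun t => B (line f h (0 + 1 * t%:C)))
  (fun t => cder (fun w => B (line f h w)) (0 + 1 * t%:C) * 1)
  (Bball al K (r + 1) * L1norm h) 0 1 ler01.
rewrite subr0 !mulr1 mulr0 addr0 line0 add0r.
have -> : line f h 1 = g by apply/funext => x; rewrite /line /h mul1r addrC subrK.
apply.
- move=> t _; apply: (@rdiff_line _ (fun w => B (line f h w))).
  exact: cderP.
- move=> t /andP[t0 t1]; rewrite mulr1 add0r mul1r.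
  have -> : cder (fun w => B (line f h w)) t%:C = vder B (line f h t%:C) h.
    rewrite -[t%:C]addr0 -(cder_shift _ _ cB) addr0 /vder; congr cder.
    by apply/funext => w; rewrite line_shift.
  have Ll : L1 (line f h t%:C) by exact: L1_line.
  apply: le_trans (vder_le_lin a0 eB bB Ll Lh) _.
  rewrite ler_wpM2r ?L1norm_ge0// ler_wpM2l ?(Ebound_ge0 bB)// ler_expR.
  rewrite ler_wpM2l ?invr_ge0 ?(ltW a0)// lerD2r.
  have -> : line f h t%:C = fun x => (1 - t)%:C * f x + t%:C * g x.
    by apply/funext => x; rewrite /line /h rmorphB rmorph1; ring.
  apply: le_trans (L1normD (L1Z _ Lf) (L1Z _ Lg)) _.
  rewrite !L1normZ// !normcR (ger0_norm t0) ger0_norm ?subr_ge0//.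
  have h1 : (1 - t) * L1norm f <= (1 - t) * r by rewrite ler_wpM2l// subr_ge0.
  have h2 : t * L1norm g <= t * r by rewrite ler_wpM2l.
  by lra.
Qed.

Variables (z : R) (phi : E -> \bar R).
Hypothesis z_gt0 : 0 < z.
Hypothesis phi_meas : measurable_fun setT phi.
Hypothesis phi_ge0 : forall x, (0 <= phi x)%E.
Hypothesis phi_int : mu.-integrable setT phi.
Variable c : R.
Hypothesis phi_bd : \forall x \ae mu, (`|phi x| <= c%:E)%E.
Hypothesis c_ge0 : 0 <= c.

Local Notation Phi := (phinorm phi).
Local Notation Le eps := (Lgen z (boltzmann phi eps) (boltzmann_rate phi eps)).
Local Notation L0 := (Lgen z (fun _ _ => 1) (fun x y => - phi_at phi x y)).

Let Phi_ge0 : 0 <= Phi. Proof. exact: phinorm_ge0. Qed.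

(** With [p = phi (x - y)], the integrand is at most [eps * p * |th y| + eps * p ^+ 2]. The bound
    [p <= c] is spent on one factor [p], and what remains is integrable. *)
Lemma affine_kernel_diff eps th x : 0 < eps -> L1 th ->
  L1norm (fun y => affine_kernel (boltzmann phi eps) (boltzmann_rate phi eps) th x y -
    affine_kernel (fun _ _ => 1) (fun x y => - phi_at phi x y) th x y) <=
  eps * c * (L1norm th + Phi).
Proof.
move=> e0 Lt.
have ok1 := kernel_ok_ren phi_meas phi_ge0 phi_int e0.
have ok2 := kernel_ok_V phi_meas phi_ge0 phi_int.
have -> : eps * c * (L1norm th + Phi) =
    \int[mu]_y (eps * c * (normc (th y) + phi_at phi x y)).
  rewrite RintegralZl//; last by apply: rintD; [exact: L1_int|exact: rint_phi_at].
  by rewrite RintegralD// ?Rintegral_phi_at ?L1normE//; [exact: L1_int|exact: rint_phi_at].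
apply: L1norm_le.
- by apply: L1B; [exact: (L1_affine_kernel ok1)|exact: (L1_affine_kernel ok2)].
- by apply: rintZ; apply: rintD; [exact: L1_int|exact: rint_phi_at].
have bdx := ae_refl x phi_bd.
apply: filterS2 (phi_at_fin phi_int x) bdx => y yfin.
rewrite yfin lee_fin ger0_norm ?phi_at_ge0// => pc.
have p0 := phi_at_ge0 phi_ge0 x y; set p := phi_at phi x y in p0 pc yfin *.
have bE : boltzmann phi eps x y = expR (- (eps * p)) by rewrite boltzmannE// yfin.
have u0 : 0 <= eps * p by rewrite mulr_ge0// ltW.
have [/andP[h1 h2] /andP[h3 h4]] := expRN_bounds u0.
rewrite /affine_kernel /boltzmann_rate -/p bE; set b := expR _ in h1 h2 h3 h4 *.
have -> : th y * b%:C + ((b - 1) / eps)%:C - (th y * 1%:C + (- p)%:C) =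
   ((b - 1 + eps * p) / eps)%:C - th y * (1 - b)%:C.
  rewrite !(rmorphB, rmorphD, rmorphM, rmorphN, fmorphV, rmorph1)/=; field.
  by rewrite -normc_gt0 normcR normr_gt0 gt_eqF.
apply: le_trans (normcB _ _) _; rewrite normcM !normcR.
rewrite (ger0_norm h1) ger0_norm ?divr_ge0 ?(ltW e0)// [leLHS]addrC [leRHS]mulrDr; apply: lerD.
  rewrite mulrC ler_wpM2r ?normc_ge0//; apply: le_trans h2 _.
  by rewrite ler_pM2l.
rewrite ler_pdivrMr//; apply: le_trans h4 _; rewrite expr2.
have -> : eps * p * (eps * p) = p * (eps * p * eps) by ring.
have -> : eps * c * p * eps = c * (eps * p * eps) by ring.
by rewrite ler_wpM2r// mulr_ge0// ltW.
Qed.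

(** The derivative terms cancel. The other difference grows like [N * (N + Phi)] times the
    exponential of index [a'], and the passage to the index [a] absorbs the polynomial factor. *)
Lemma Lgen_strong_convergence (a a' : R) (B : (E -> C) -> C) K : 0 < a -> a < a' ->
  entire B -> Ebound a' B K -> exists2 D, 0 <= D & forall eps, 0 < eps ->
  Ebound a (fun th => Le eps B th + -1 * L0 B th) (eps * D).
Proof.
move=> a0 aa' eB bB; have a'0 : 0 < a' by exact: lt_trans aa'.
have K0 : 0 <= K := Ebound_ge0 bB.
pose k := a^-1 - a'^-1.
have k0 : 0 < k by rewrite subr_gt0 ltf_pV2.
(* The square comes from [N + Phi <= (2 / k + Phi) * e^(k * N / 2)], used twice: two halves of the
   exponent gap [k] pay for two linear factors. *)
pose D := z * K * expR (a'^-1 * (Phi + 1)) * c * (2 / k + Phi) ^+ 2.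
have D0 : 0 <= D.
  by rewrite /D !mulr_ge0 ?expR_ge0 ?exprn_ge0// ?(ltW z_gt0)// addr_ge0// divr_ge0// ltW.
exists D => // eps e0 th Lt.
have ok1 := kernel_ok_ren phi_meas phi_ge0 phi_int e0.
have ok2 := kernel_ok_V phi_meas phi_ge0 phi_int.
have Lb1 := L1_th_B_affine ok1 a'0 eB bB Lt Lt.
have Lb2 := L1_th_B_affine ok2 a'0 eB bB Lt Lt.
rewrite (LgenE z ok1 a'0 eB bB Lt) (LgenE z ok2 a'0 eB bB Lt).
set I1 := Cintegral _; set I2 := Cintegral _.
have -> : - (vder B th th - z%:C * I1) + -1 * - (vder B th th - z%:C * I2) =
  z%:C * (I1 - I2) by ring.
rewrite normcM normcR (gtr0_norm z_gt0) /I1 /I2 -CintegralB//.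
set N := L1norm th; have N0 : 0 <= N := L1norm_ge0 _.
have h1 : L1norm (fun x => th x * B (affine_kernel (boltzmann phi eps) (boltzmann_rate phi eps) th x) -
   th x * B (affine_kernel (fun _ _ => 1) (fun x y => - phi_at phi x y) th x)) <=
   Bball a' K (N + Phi + 1) * (eps * c * (N + Phi)) * N.
  have -> : Bball a' K (N + Phi + 1) * (eps * c * (N + Phi)) * N = \int[mu]_x
      (Bball a' K (N + Phi + 1) * (eps * c * (N + Phi)) * normc (th x)).
    by rewrite RintegralZl// -?L1normE//; exact: L1_int.
  apply: L1norm_le; [exact: L1B|by apply: rintZ; exact: L1_int|].
  apply: aeW => x; rewrite -mulrBr normcM mulrC ler_wpM2r ?normc_ge0//.
  apply: le_trans (entire_lip_segment (r := N + Phi) a'0 eB bB _ _ _ _) _.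
  - exact: (L1_affine_kernel ok2).
  - exact: (L1_affine_kernel ok1).
  - exact: (L1norm_affine_kernel ok2).
  - exact: (L1norm_affine_kernel ok1).
  - by rewrite ler_wpM2l ?(Bball_ge0 bB)//; exact: affine_kernel_diff.
apply: le_trans (ler_wpM2l (ltW z_gt0) (le_trans (normc_Cintegral (L1B Lb1 Lb2)) h1)) _.
have X1 : 1 <= expR (k * N / 2) by rewrite -expR0 ler_expR divr_ge0// mulr_ge0// ltW.
have h2 : N + Phi <= (2 / k + Phi) * expR (k * N / 2).
  rewrite mulrDl; apply: lerD; last by rewrite ler_peMr.
  have := expR_ge1Dx (k * N / 2) => h.
  have NE : N = 2 / k * (k * N / 2) by field; rewrite gt_eqF.
  by rewrite [leLHS]NE ler_wpM2l ?divr_ge0 ?(ltW k0)//; lra.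
have h3 : (N + Phi) * N <= (2 / k + Phi) ^+ 2 * expR (k * N).
  apply: (le_trans (y := (N + Phi) * (N + Phi))).
    by rewrite ler_wpM2l ?addr_ge0// lerDl.
  have -> : expR (k * N) = expR (k * N / 2) * expR (k * N / 2).
    by rewrite -expRD; congr expR; field.
  rewrite expr2 mulrACA; apply: ler_pM => //; exact: addr_ge0.
have -> : z * (Bball a' K (N + Phi + 1) * (eps * c * (N + Phi)) * N) =
  z * K * eps * c * (expR (a'^-1 * (N + Phi + 1)) * ((N + Phi) * N)).
  by rewrite /Bball; ring.
apply: (le_trans (y := z * K * eps * c * (expR (a'^-1 * (N + Phi + 1)) *
   ((2 / k + Phi) ^+ 2 * expR (k * N))))).
  by rewrite ler_wpM2l ?mulr_ge0 ?(ltW z_gt0) ?(ltW e0)// ler_wpM2l ?expR_ge0.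
have -> : expR (a'^-1 * (N + Phi + 1)) * ((2 / k + Phi) ^+ 2 * expR (k * N)) =
  (2 / k + Phi) ^+ 2 * expR (a'^-1 * (Phi + 1)) * expR (a^-1 * N).
  have -> : a^-1 * N = k * N + a'^-1 * N by rewrite /k; ring.
  have -> : a'^-1 * (N + Phi + 1) = a'^-1 * N + a'^-1 * (Phi + 1) by ring.
  rewrite !expRD; ring.
by rewrite /D le_eqVlt; apply/orP; left; apply/eqP; ring.
Qed.

End strong_convergence.

Lemma geometric_small (R : realType) (q D e : R) : 0 <= q -> q < 1 -> 0 <= D -> 0 < e ->
  exists N, D * q ^+ N <= e.
Proof.
move=> q0 q1 D0 e0; have d1 : 0 < 1 - q by rewrite subr_gt0.
pose Q := D * (1 - q)^-1; exists (Num.truncn (Q / e)).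
apply: (le_trans (ler_wpM2l D0 (geometric_le _ q0 q1))).
rewrite mulrA -/Q ler_pdivrMr ?ltr0n// mulrC -ler_pdivrMr//.
exact/ltW/truncnS_gt.
Qed.

Lemma Ebound_eq (R : realType) (d : nat) (al : R) (B B' : (Rd R d -> R[i]) -> R[i]) K :
  (forall th, L1 th -> B th = B' th) -> Ebound al B K -> Ebound al B' K.
Proof. by move=> h H th Lt; rewrite -h//; exact: H. Qed.

Lemma pointwise_solution_unique (R : realType) (d : nat) (z Phi : R) (b c : Rd R d -> Rd R d -> R)
    (al al0 K0 : R) (B0 : (Rd R d -> R[i]) -> R[i]) (u v : R -> (Rd R d -> R[i]) -> R[i]) :
  0 < z -> 0 <= Phi -> kernel_ok Phi b c -> 0 < al -> al < al0 ->
  entire B0 -> Ebound al0 B0 K0 ->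
  let T := (al0 - al) / (expR 1 * Mop z Phi al al0) in
  pointwise_solution (Lgen z b c) al T B0 u ->
  pointwise_solution (Lgen z b c) al T B0 v ->
  forall t th, 0 <= t < T -> L1 th -> u t th = v t th.
Proof.
move=> z0 P0 ok a0 a1 eB bB T su sv t th tI Lt.
have [t0 tT] := andP tI; have T0 : 0 < T by exact: le_lt_trans tT.
have q0 : 0 <= t / T by rewrite divr_ge0// ltW.
have q1 : t / T < 1 by rewrite ltr_pdivrMr// mul1r.
have d1 : 0 < 1 - t / T by rewrite subr_gt0.
have K0_ge0 := Ebound_ge0 bB.
have X0 : 0 < expR (al^-1 * L1norm th) := expR_gt0 _.
apply/eqP; rewrite -subr_eq0; apply/eqP; apply: eq0_normc; apply/eqP.
rewrite eq_le normc_ge0 andbT; apply/ler_addgt0Pr => e e0; rewrite add0r.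
have D0 : 0 <= 2 * K0 / (1 - t / T) * expR (al^-1 * L1norm th).
  by rewrite mulr_ge0 ?(ltW X0)// divr_ge0 ?(ltW d1)// mulr_ge0.
have [N HN] := geometric_small q0 q1 D0 e0.
have h1 := solution_taylor z0 P0 ok a0 a1 eB bB su N tI Lt.
have h2 := solution_taylor z0 P0 ok a0 a1 eB bB sv N tI Lt.
apply: le_trans HN.
have -> : u t th - v t th = (u t th + -1 * psum z b c B0 N t th) - (v t th + -1 * psum z b c B0 N t th) by ring.
apply: le_trans (normcB _ _) _; apply: le_trans (lerD h1 h2) _.
by rewrite le_eqVlt; apply/orP; left; apply/eqP; rewrite -/T; ring.
Qed.

(** * Convergence of the Taylor coefficients and of the solutions *)

Section vlasov_limit.
Context (R : realType) (d : nat).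
Local Notation E := (Rd R d).
Local Notation C := R[i].
Local Notation mu := (lebesgue_Rd R d).
Local Notation L1 := (@L1 R d).
Variables (z : R) (phi : E -> \bar R).
Hypothesis z_gt0 : 0 < z.
Hypothesis phi_meas : measurable_fun setT phi.
Hypothesis phi_ge0 : forall x, (0 <= phi x)%E.
Hypothesis phi_int : mu.-integrable setT phi.
Variable c : R.
Hypothesis phi_bd : \forall x \ae mu, (`|phi x| <= c%:E)%E.
Hypothesis c_ge0 : 0 <= c.
Variables (al al0 : R).
Hypothesis al_gt0 : 0 < al.
Hypothesis al_lt : al < al0.
Variables (B0ren : R -> (E -> C) -> C) (B0V : (E -> C) -> C).
Hypothesis B0ren_in : forall eps, 0 < eps -> Espace al0 (B0ren eps).
Hypothesis B0V_in : Espace al0 B0V.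
Hypothesis B0_cvg : Enorm al0 (B0ren eps \- B0V) @[eps --> 0^'+] --> 0%E.

Local Notation Phi := (phinorm phi).
Local Notation Le eps := (Lgen z (boltzmann phi eps) (boltzmann_rate phi eps)).
Local Notation L0 := (Lgen z (fun _ _ => 1) (fun x y => - phi_at phi x y)).
Local Notation diff_small a f g :=
  (forall e, 0 < e -> \forall eps \near 0^'+, Ebound a (fun th => f eps th + -1 * g th) e).

Let Phi_ge0 : 0 <= Phi. Proof. exact: phinorm_ge0. Qed.
Let ok1 eps (e0 : 0 < eps) := kernel_ok_ren phi_meas phi_ge0 phi_int e0.
Let ok2 := kernel_ok_V phi_meas phi_ge0 phi_int.

Let B0_small : diff_small al0 B0ren B0V.
Proof.
move=> e e0; apply: filterS ((Enorm_cvg0P _ _ _).1 B0_cvg e e0) => eps.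
by apply: Ebound_eq => th _; rewrite mulN1r.
Qed.

(** All indices below [al0] are treated at once, since the step at [a] uses the hypothesis at the
    midpoint of [a] and [al0]. The difference splits into [Le eps] of the previous difference, with
    operator bound independent of [eps], and [Le eps - L0] on the fixed functional
    [iter n L0 B0V]. *)
Lemma iter_Lren_cvg n a : al <= a -> a < al0 ->
  [/\ entire (iter n L0 B0V), exists K, Ebound a (iter n L0 B0V) K,
      forall eps, 0 < eps -> entire (iter n (Le eps) (B0ren eps)) /\
        exists K, Ebound a (iter n (Le eps) (B0ren eps)) K &
      diff_small a (fun eps => iter n (Le eps) (B0ren eps)) (iter n L0 B0V)].
Proof.
have weaken a' B K : al <= a' -> a' < al0 -> Ebound al0 B K -> Ebound a' B K.
  move=> h1 h2 H; apply: Ebound_le (H) => //.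
  - exact: lt_le_trans h1.
  - exact: ltW.
  - exact: Ebound_ge0 H.
elim: n a => [|n IH] a ala aal.
  split.
  - by case: B0V_in.
  - by have [K HK] := Espace_Ebound B0V_in; exists K; exact: weaken HK.
  - move=> eps /B0ren_in eB; split; first by case: eB.
    by have [K HK] := Espace_Ebound eB; exists K; exact: weaken HK.
  - by move=> e e0; apply: filterS (B0_small e0) => eps; exact: weaken.
have a0 : 0 < a by exact: lt_le_trans ala.
pose a' := (a + al0) / 2; have aa' : a < a' by rewrite /a'; lra.
have a'al : a' < al0 by rewrite /a'; lra.
have a'0 : 0 < a' by exact: lt_trans aa'.
have ala' : al <= a' by exact: le_trans (ltW aa').
have [e0 [K HK] er small] := IH a' ala' a'al; split => /=.
- exact: (Lgen_entire z_gt0 Phi_ge0 ok2 a'0 e0 HK).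
- by eexists; apply: (Lgen_le z_gt0 Phi_ge0 ok2 a'0 e0 HK al_gt0 ala aa'); exact: ltW a'al.
- move=> eps eps0; have [e1 [K1 HK1]] := er eps eps0; split.
    exact: (Lgen_entire z_gt0 Phi_ge0 (ok1 eps0) a'0 e1 HK1).
  by eexists; apply: (Lgen_le z_gt0 Phi_ge0 (ok1 eps0) a'0 e1 HK1 al_gt0 ala aa'); exact: ltW a'al.
- have [D D0 HD] := Lgen_strong_convergence z_gt0 phi_meas phi_ge0 phi_int phi_bd c_ge0 a0 aa' e0 HK.
  pose M' := al0 * (1 + z * al0 * expR (Phi / al - 1)) / (a' - a).
  have M'0 : 0 < M'.
    rewrite /M' divr_gt0 ?subr_gt0// -/(Mop z Phi al al0) Mop_gt0//.
    exact: lt_trans al_lt.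
  move=> e egt; have h1 : 0 < e / 2 / M' by apply: divr_gt0 => //; exact: divr_gt0.
  have h2 : 0 < e / 2 / (D + 1) by rewrite !divr_gt0// ltr_wpDl.
  near=> eps.
  have eps0 : 0 < eps by near: eps; exact: nbhs_right_gt.
  have [e1 [K1 HK1]] := er eps eps0.
  have HB : Ebound a' (fun th => iter n (Le eps) (B0ren eps) th + -1 * iter n L0 B0V th) (e / 2 / M').
    by near: eps; exact: small.
  have epsD : eps * D <= e / 2.
    apply: (le_trans (y := eps * (D + 1))).
      by rewrite ler_wpM2l ?(ltW eps0)// lerDl.
    by rewrite -ler_pdivlMr ?ltr_wpDl//; near: eps; exact: nbhs_right_le.
  have H1 := Lgen_le z_gt0 Phi_ge0 (ok1 eps0) a'0 (entire_lin (-1) e1 e0) HB al_gt0 ala aa' (ltW a'al).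
  have -> : e = e / 2 / M' * M' + e / 2 by field; rewrite gt_eqF.
  apply: Ebound_le (Ebound_add H1 (HD eps eps0) _) => //.
  - by rewrite divfK ?gt_eqF//; lra.
  - by rewrite -/M' lerD2l.
  - move=> th Lt; have := Lgen_lin z (ok1 eps0) (-1) a'0 e1 e0 HK1 HK Lt.
    by move=> ->; rewrite !mulN1r addrA subrK.
Unshelve. all: by end_near. Qed.

Lemma psum_cvg N t : 
  diff_small al (fun eps => psum z (boltzmann phi eps) (boltzmann_rate phi eps) (B0ren eps) N t)
    (psum z (fun _ _ => 1) (fun x y => - phi_at phi x y) B0V N t).
Proof.
elim: N => [|N IH] e e0.
  apply: nearW => eps th Lt; rewrite /psum !big_ord0 mulr0 addr0 normc0.
  by rewrite mulr_ge0 ?(ltW e0)// expR_ge0.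
have [_ _ _ small] := iter_Lren_cvg N (lexx al) al_lt.
pose k := `|t ^+ N / N`!%:R|; have k0 : 0 <= k by exact: normr_ge0.
have h1 : 0 < e / 2 by rewrite divr_gt0.
have h2 : 0 < e / 2 / (k + 1) by rewrite divr_gt0// ltr_wpDl.
near=> eps; have {1}-> : e = e / 2 + e / 2 by field.
have H1 : Ebound al (fun th => iter N (Le eps) (B0ren eps) th + -1 * iter N L0 B0V th) (e / 2 / (k + 1)).
  by near: eps; exact: small.
have H2 : Ebound al (fun th => (t ^+ N / N`!%:R)%:C * (iter N (Le eps) (B0ren eps) th + -1 * iter N L0 B0V th)) (e / 2).
  move=> th Lt; rewrite normcM normcR -/k.
  apply: le_trans (ler_wpM2l k0 (H1 th Lt)) _.
  rewrite mulrA ler_wpM2r ?expR_ge0//.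
  apply: (le_trans (y := (k + 1) * (e / 2 / (k + 1)))).
    by rewrite ler_wpM2r ?(ltW h2)// lerDl.
  by rewrite mulrC divfK// gt_eqF// ltr_wpDl.
have H3 : Ebound al (fun th => psum z (boltzmann phi eps) (boltzmann_rate phi eps) (B0ren eps) N t th +
    -1 * psum z (fun _ _ => 1) (fun x y => - phi_at phi x y) B0V N t th) (e / 2).
  by near: eps; exact: IH.
have alg (a b q x y : C) : a + q * x + -1 * (b + q * y) = (a + -1 * b) + q * (x + -1 * y).
  by ring.
by apply: Ebound_add H3 H2 _ => th _; rewrite /psum !big_ord_recr; exact: alg.
Unshelve. all: by end_near. Qed.

Theorem vlasov_limit (Bren : R -> R -> (E -> C) -> C) (BV : R -> (E -> C) -> C) t :
  let T := (al0 - al) / (expR 1 * Mop z Phi al al0) in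
  (forall eps, 0 < eps -> pointwise_solution (Le eps) al T (B0ren eps) (Bren eps)) ->
  pointwise_solution L0 al T B0V BV -> 0 <= t < T ->
  Enorm al (Bren eps t \- BV t) @[eps --> 0^'+] --> 0%E.
Proof.
move=> T sr sV tI; apply/Enorm_cvg0P => e e0.
have [t0 tT] := andP tI; have T0 : 0 < T by exact: le_lt_trans tT.
have q0 : 0 <= t / T by rewrite divr_ge0// ltW.
have q1 : t / T < 1 by rewrite ltr_pdivrMr// mul1r.
have d1 : 0 < 1 - t / T by rewrite subr_gt0.
have [K HK] := Espace_Ebound B0V_in; have K0 := Ebound_ge0 HK.
have eV : entire B0V by case: B0V_in.
(* [K + 1] also bounds [B0ren eps] for small [eps], so a single truncation order [N] serves both
   series, uniformly in [eps]. *)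
pose D := (K + 1) / (1 - t / T); have D0 : 0 <= D by rewrite divr_ge0 ?(ltW d1)// addr_ge0.
have e3 : 0 < e / 3 by rewrite divr_gt0.
have [N HN] := geometric_small q0 q1 D0 e3.
near=> eps.
have eps0 : 0 < eps by near: eps; exact: nbhs_right_gt.
have er : entire (B0ren eps) by case: (B0ren_in eps0).
have bV : Ebound al0 B0V (K + 1).
  by apply: Ebound_le HK => //; [exact: lt_trans al_lt|rewrite addr_ge0|rewrite lerDl].
have br : Ebound al0 (B0ren eps) (K + 1).
  have H1 : Ebound al0 (fun th => B0ren eps th + -1 * B0V th) 1 by near: eps; exact: B0_small.
  by apply: Ebound_add HK H1 _ => th _; ring.
have HP : Ebound al (fun th => psum z (boltzmann phi eps) (boltzmann_rate phi eps) (B0ren eps) N t th +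
    -1 * psum z (fun _ _ => 1) (fun x y => - phi_at phi x y) B0V N t th) (e / 3).
  by near: eps; exact: psum_cvg.
have small K' : (K + 1) * (t / T) ^+ N / (1 - t / T) = K' -> K' <= e / 3.
  by move=> <-; apply: le_trans HN; rewrite /D mulrAC.
have H1 := solution_taylor z_gt0 Phi_ge0 (ok1 eps0) al_gt0 al_lt er br (sr eps eps0) N tI.
have H2 := solution_taylor z_gt0 Phi_ge0 ok2 al_gt0 al_lt eV bV sV N tI.
have H1' := Ebound_le al_gt0 (lexx al) (ltW e3) (small _ erefl) H1.
have H2' := Ebound_le al_gt0 (lexx al) (ltW e3) (small _ erefl) H2.
have H12 := Ebound_add H1' (Ebound_lin (-1) HP H2') (fun th _ => erefl).
apply: Ebound_le (Ebound_eq _ H12) => //; first exact: ltW.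
  by rewrite normcN normc1; lra.
have alg (a b q x : C) : (a + -1 * b) + ((b + -1 * q) + -1 * (x + -1 * q)) = a - x by ring.
by move=> th _; exact: alg.
Unshelve. all: by end_near. Qed.

End vlasov_limit.

(** * The kinetic equation *)

Section real_tools.
Variable R : realType.

Lemma real_mean_value_ineq (P p G g : R -> R) (a b : R) : a <= b ->
  (forall t : R, a <= t <= b -> is_derive t 1 P (p t)) ->
  (forall t : R, a <= t <= b -> is_derive t 1 G (g t)) ->
  (forall t, a <= t <= b -> `|p t| <= g t) -> `|P b - P a| <= G b - G a.
Proof.
move=> ab dP dG bd.
have dP' t : a <= t <= b -> rdiff (fun s => 1 * (P s)%:C) t (1 * (p t)%:C).
  by move=> /dP; exact: rdiffZ.
have := @mean_value_ineq R (fun s => 1 * (P s)%:C) (fun s => 1 * (p s)%:C) G g a b ab.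
rewrite !mul1r -rmorphB normcR; apply.
- apply: (@rdiff_ccont _ `[a, b] _ (fun s => 1 * (p s)%:C)) => t; rewrite in_itv/=; exact: dP'.
- by apply: derivable_within_continuous => t; rewrite in_itv/= => /dG h; exact: ex_derive.
- by move=> t /andP[t1 t2]; apply: dP'; rewrite !ltW.
- by move=> t /andP[t1 t2]; apply: dG; rewrite !ltW.
- by move=> t /andP[t1 t2]; rewrite mul1r normcR; apply: bd; rewrite !ltW.
Qed.

(** Exhibits a time integral as a limit of finite sums; this is how the primitive of the rate
    becomes measurable in [x]. *)
Lemma riemann_sum_error (P q : R -> R) (K t : R) (n : nat) : 0 <= t -> 0 <= K ->
  (forall s : R, 0 <= s -> is_derive s 1 P (q s)) ->
  (forall s r : R, `|q s - q r| <= K * `|s - r|) ->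
  `|P t - P 0 - \sum_(i < n.+1) t / n.+1%:R * q (t / n.+1%:R * i%:R)| <= K * t ^+ 2 / n.+1%:R.
Proof.
move=> t0 K0 dP qK; set h := t / n.+1%:R.
have n0 : n.+1%:R != 0 :> R by rewrite pnatr_eq0.
have h0 : 0 <= h by rewrite divr_ge0.
have H k : `|P (h * k%:R) - P 0 - \sum_(i < k) h * q (h * i%:R)| <= K * h ^+ 2 * k%:R.
  elim: k => [|k IH]; first by rewrite big_ord0 !mulr0 subr0 subrr normr0.
  set a := h * k%:R in IH *; have a0 : 0 <= a by rewrite mulr_ge0.
  have bE : h * k.+1%:R = a + h by rewrite -natr1 mulrDr mulr1.
  have step : `|(P (a + h) - (a + h) * q a) - (P a - a * q a)| <= K * h * (a + h) - K * h * a.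
    apply: (@real_mean_value_ineq (fun s => P s - s * q a) (fun s => q s - q a)
      (fun s => K * h * s) (fun=> K * h)).
    - by rewrite lerDl.
    - move=> s /andP[as_ _]; have ds := dP s (le_trans a0 as_).
      have d2 : is_derive s 1 (fun s => s * q a) (q a).
        have -> : (fun s => s * q a) = q a *: id by apply/funext => r; rewrite /= mulrC.
        by apply: is_derive_eq; rewrite -[RHS]mulr1.
      exact: is_deriveB ds d2.
    - by move=> s _; apply: is_derive_eq; rewrite -[RHS]mulr1.
    - move=> s /andP[s1 s2]; apply: le_trans (qK _ _) _; rewrite ler_wpM2l//.
      by rewrite ger0_norm ?subr_ge0//; lra.
  rewrite bE big_ord_recr/= -/a.
  have -> : P (a + h) - P 0 - (\sum_(i < k) h * q (h * i%:R) + h * q a) =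
    (P a - P 0 - \sum_(i < k) h * q (h * i%:R)) +
    ((P (a + h) - (a + h) * q a) - (P a - a * q a)) by ring.
  apply: le_trans (ler_normD _ _) _; apply: le_trans (lerD IH step) _.
  by rewrite le_eqVlt -natr1; apply/orP; left; apply/eqP; ring.
have := H n.+1; rewrite {1}/h divfK// => /le_trans; apply.
by rewrite le_eqVlt; apply/orP; left; apply/eqP; rewrite /h; field.
Qed.

Lemma geometric_limit (u : nat -> R) (D : R) : 0 <= D ->
  (forall n, `|u n.+1 - u n| <= D * 2^-1 ^+ n) ->
  exists L, forall n, `|u n - L| <= 2 * D * 2^-1 ^+ n.
Proof.
move=> D0 H; have q0 : 0 <= 2^-1 :> R by [].
have q1 : 2^-1 < 1 :> R by lra.
have tele n m : (n <= m)%N -> `|u m - u n| <= 2 * D * 2^-1 ^+ n.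
  move=> nm; apply: (le_trans (y := D * \sum_(n <= i < m) 2^-1 ^+ i)).
    rewrite mulr_sumr -telescope_sumr//; apply: le_trans (ler_norm_sum _ _ _) _.
    by apply: ler_sum => i _; exact: H.
  have := geometric_sum_le n m q0 q1.
  have -> : 1 - 2^-1 = 2^-1 :> R by lra.
  rewrite invrK => h; apply: le_trans (ler_wpM2l D0 h) _.
  by rewrite mulrA mulrC mulrA.
pose N (e : R) := Num.truncn e^-1.
have Ne e n : 0 < e -> (N e <= n)%N -> 2^-1 ^+ n <= 2 * e.
  move=> e0 Nn; have := geometric_le n q0 q1.
  have -> : 1 - 2^-1 = 2^-1 :> R by lra.
  rewrite invrK => /le_trans; apply; rewrite ler_wpM2l// -[leRHS]invrK lef_pV2 ?posrE ?invr_gt0//.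
  by apply/ltW/(lt_le_trans (truncnS_gt _)); rewrite ler_nat ltnS.
have [|L HL] := @uniform_cauchy_limit R (fun e => u (N e)) (4 * D).
  move=> e e' e0 e'0; have le1 := tele (N e) (maxn (N e) (N e')) (leq_maxl _ _).
  have le2 := tele (N e') (maxn (N e) (N e')) (leq_maxr _ _).
  have := ler_wpM2l (mulr_ge0 (ltW (ltr0Sn R 1)) D0) (Ne e _ e0 (leqnn _)).
  have := ler_wpM2l (mulr_ge0 (ltW (ltr0Sn R 1)) D0) (Ne e' _ e'0 (leqnn _)).
  move: le1 le2; rewrite !ler_norml => /andP[? ?] /andP[? ?] ? ?; apply/andP; split; lra.
exists L => n; apply/ler_addgt0Pr => e e0.
pose e' := Num.min (e / (4 * D + 1)) n.+1%:R^-1.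
have D4 : 0 < 4 * D + 1 by rewrite ltr_wpDl// mulr_ge0.
have e'0 : 0 < e' by rewrite lt_min divr_gt0//= invr_gt0 ltr0n.
have nN : (n <= N e')%N.
  have h : n.+1%:R <= e'^-1.
    by rewrite -[leLHS]invrK lef_pV2 ?posrE ?invr_gt0 ?ltr0n// /e' ge_min lexx orbT.
  by rewrite /N truncn_ge_nat ?invr_ge0 ?(ltW e'0)//; apply: le_trans h; rewrite ler_nat.
have h1 := tele n (N e') nN; have h2 := HL e' e'0.
have h3 : 4 * D * e' <= e.
  apply: (le_trans (y := (4 * D + 1) * e')); first by rewrite ler_wpM2r ?(ltW e'0)// lerDl.
  by rewrite mulrC -ler_pdivlMr// /e' ge_min lexx.
have -> : u n - L = (u (N e') - L) - (u (N e') - u n) by ring.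
apply: le_trans (ler_normB _ _) _; lra.
Qed.

Lemma expR_lip (M a b : R) : a <= M -> b <= M -> `|expR a - expR b| <= expR M * `|a - b|.
Proof.
have H c c' : c <= M -> c' <= M -> expR c - expR c' <= expR M * `|c - c'|.
  move=> cM c'M; have h := expR_ge1Dx (c' - c).
  have -> : expR c - expR c' = expR c * (1 - expR (c' - c)).
    by rewrite mulrBr mulr1 -expRD addrCA subrr addr0.
  apply: (le_trans (y := expR c * `|c - c'|)).
    rewrite ler_wpM2l ?expR_ge0//; apply: (le_trans (y := c - c')); last exact: ler_norm.
    by lra.
  by rewrite ler_wpM2r// ler_expR.
move=> aM bM; rewrite ler_norml H// andbT lerNl opprB distrC; exact: H.
Qed.

Definition clamp (T s : R) : R := Num.min (Num.max s 0) T.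

Lemma clamp_itv T s : 0 <= T -> 0 <= clamp T s <= T.
Proof. by move=> T0; rewrite /clamp le_min ge_min lexx orbT T0 le_max lexx orbT. Qed.

Lemma clamp_id T s : 0 <= s <= T -> clamp T s = s.
Proof. by move=> /andP[s0 sT]; rewrite /clamp max_l// min_l. Qed.

Lemma clamp_lip T s t : `|clamp T s - clamp T t| <= `|s - t|.
Proof.
have H a b : a <= b -> 0 <= clamp T b - clamp T a <= b - a.
  move=> ab; rewrite /clamp !maxEle; case: (leP a 0) => ?; case: (leP b 0) => ?;
    rewrite !minEle; case: (leP 0 T) => ?; case: (leP a T) => ?; case: (leP b T) => ?;
    apply/andP; split; lra.
case: (leP s t) => st; last by rewrite !ger0_norm//; have /andP[? ?] := H _ _ (ltW st); lra.
by rewrite distrC [leRHS]distrC !ger0_norm//; have /andP[? ?] := H _ _ st; lra.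
Qed.

End real_tools.

(** * Picard iteration for the kinetic equation *)

Section vlasov_equation.
Context (R : realType) (d : nat).
Local Notation E := (Rd R d).
Local Notation mu := (lebesgue_Rd R d).
Variables (z : R) (phi : E -> \bar R).
Hypothesis z_gt0 : 0 < z.
Hypothesis phi_meas : measurable_fun setT phi.
Hypothesis phi_ge0 : forall x, (0 <= phi x)%E.
Hypothesis phi_int : mu.-integrable setT phi.
Variables (T m : R) (r0 : E -> R).
Hypothesis T_ge0 : 0 <= T.
Hypothesis z_le : z <= m.
Hypothesis r0_meas : measurable_fun setT r0.
Hypothesis r0_itv : forall x, 0 <= r0 x <= m.

Local Notation Phi := (phinorm phi).
Local Notation conv := (convolution phi).

(** Bounds at every point and not almost everywhere, so that the equation can be solved for each [x]
    separately. *)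
Definition bounded_density (r : E -> R) := measurable_fun setT r /\ forall x, 0 <= r x <= m.

(** [m] doubles as the Lipschitz constant in time: for values in [[0, m]] and [z <= m] the
    right-hand side of the equation lies in [[- m, m]]. *)
Definition density_path (r : R -> E -> R) :=
  (forall t, 0 <= t <= T -> bounded_density (r t)) /\
  forall s t x, 0 <= s <= T -> 0 <= t <= T -> `|r s x - r t x| <= m * `|s - t|.

Let m_gt0 : 0 < m. Proof. exact: lt_le_trans z_le. Qed.
Let Phi_ge0 : 0 <= Phi. Proof. exact: phinorm_ge0. Qed.

Lemma rint_conv r x : bounded_density r -> rint mu (fun y => r y * phi_at phi x y).
Proof.
move=> [mr rI]; apply: rint_le (rintZ m (rint_phi_at phi_meas phi_ge0 phi_int x)) _.
  by apply: measurable_funM => //; exact: measurable_phi_atr.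
apply: aeW => y; have /andP[h1 h2] := rI y.
by rewrite ger0_norm ?mulr_ge0 ?phi_at_ge0// ler_wpM2r ?phi_at_ge0.
Qed.

Lemma conv_ge0 r x : bounded_density r -> 0 <= conv r x.
Proof.
move=> [mr rI]; apply: Rintegral_ge0 => y _.
by have /andP[h1 _] := rI y; rewrite mulr_ge0// phi_at_ge0.
Qed.

Lemma conv_dist r r' x K : bounded_density r -> bounded_density r' ->
  (forall y, `|r y - r' y| <= K) -> `|conv r x - conv r' x| <= K * Phi.
Proof.
move=> br br' H; have i1 := rint_conv x br; have i2 := rint_conv x br'.
rewrite /convolution -RintegralB//.
apply: le_trans (le_normr_Rintegral _ _) _ => //; first exact: rintB.
rewrite -(Rintegral_phi_at phi_meas phi_ge0 phi_int x) -RintegralZl//; last exact: rint_phi_at.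
apply: ae_le_Rintegral.
- by apply: rint_norm; exact: rintB.
- by apply: rintZ; exact: rint_phi_at.
- apply: aeW => y; rewrite -mulrBl normrM [X in _ * X]ger0_norm ?phi_at_ge0//.
  by rewrite ler_wpM2r ?phi_at_ge0.
Qed.

Lemma measurable_conv r : bounded_density r -> measurable_fun setT (conv r).
Proof.
move=> [mr rI].
apply: (@measurable_Rintegral _ E _ E R mu (fun p : E * E => r p.2 * phi_at phi p.1 p.2)).
  by apply: measurable_funM; [exact: measurableT_comp|exact: measurable_phi_at].
by move=> p; have /andP[h1 _] := rI p.2; rewrite mulr_ge0// phi_at_ge0.
Qed.

(* Time is clamped to [0, T], so that the rate is defined and Lipschitz on the whole line. *)
Definition rate (r : R -> E -> R) (x : E) (s : R) : R :=
  expR (clamp T s - conv (r (clamp T s)) x).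

(** The range starts at [-1] so that the derivative at time 0 is two-sided. *)
Definition rate_primitive (r : R -> E -> R) (x : E) : R -> R :=
  xget (fun=> 0) [set P | forall t : R, -1 < t -> is_derive t 1 P (rate r x t)].

(* The mild form [rho_t = e^-t (r0 + z int_0^t e^s e^{- rho_s * phi} ds)] preserves the
   bounds [0 <= rho <= m]. *)
Definition picard (r : R -> E -> R) (t : R) (x : E) : R :=
  expR (- t) * (r0 x + z * (rate_primitive r x t - rate_primitive r x 0)).

Section one_path.
Variable r : R -> E -> R.
Hypothesis r_path : density_path r.

Let K := expR T * (1 + m * Phi).
Let K_ge0 : 0 <= K.
Proof. by rewrite mulr_ge0 ?expR_ge0// addr_ge0// mulr_ge0// ltW. Qed.

Lemma path_clamp s : bounded_density (r (clamp T s)).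
Proof. by apply: r_path.1; exact: clamp_itv. Qed.

Lemma rate_exponent_le x s : clamp T s - conv (r (clamp T s)) x <= T.
Proof.
have /andP[_ h] := clamp_itv s T_ge0.
by apply: le_trans h; rewrite gerBl; apply: conv_ge0; exact: path_clamp.
Qed.

Lemma rate_lip x s t : `|rate r x s - rate r x t| <= K * `|s - t|.
Proof.
apply: le_trans (expR_lip (rate_exponent_le x s) (rate_exponent_le x t)) _.
rewrite -mulrA ler_wpM2l ?expR_ge0//.
have h1 := clamp_lip T s t.
have h2 : `|conv (r (clamp T s)) x - conv (r (clamp T t)) x| <= m * `|s - t| * Phi.
  apply: conv_dist; try exact: path_clamp.
  move=> y; apply: le_trans (r_path.2 _ _ _ _ _) _; try exact: clamp_itv.
  by rewrite ler_wpM2l// ltW.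
set c1 := conv _ _ in h2 *; set c2 := conv _ _ in h2 *.
have -> : clamp T s - c1 - (clamp T t - c2) = (clamp T s - clamp T t) - (c1 - c2) by ring.
apply: le_trans (ler_normB _ _) _; apply: le_trans (lerD h1 h2) _.
by rewrite le_eqVlt; apply/orP; left; apply/eqP; ring.
Qed.

Lemma rate_primitiveP x (t : R) : -1 < t -> is_derive t 1 (rate_primitive r x) (rate r x t).
Proof.
have cr : continuous (rate r x).
  move=> s; apply/cvgrPdist_le => e e0.
  have K1 : 0 < K + 1 by rewrite ltr_wpDl.
  apply/nbhs_ballP; exists (e / (K + 1)) => /=; first by rewrite divr_gt0.
  move=> u; rewrite /ball/= => h; apply: le_trans (rate_lip _ _ _) _.
  apply: (le_trans (y := (K + 1) * `|s - u|)); first by rewrite ler_wpM2r// lerDl.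
  by rewrite mulrC -ler_pdivlMr// ltW.
have [P HP] := primitive_exists (-1) cr.
exact: (xgetPex (fun=> 0) (P := [set P | forall t : R, -1 < t -> is_derive t 1 P (rate r x t)])
  (ex_intro _ P HP)).
Qed.

Lemma rate_primitive_derive x (t : R) : 0 <= t -> is_derive t 1 (rate_primitive r x) (rate r x t).
Proof. by move=> t0; apply: rate_primitiveP; lra. Qed.

Lemma rate_primitive_itv x t : 0 <= t <= T ->
  0 <= rate_primitive r x t - rate_primitive r x 0 <= expR t - 1.
Proof.
move=> /andP[t0 tT]; set P := rate_primitive r x.
(* The bounds [0 <= rate <= e^s] are one absolute value around the midpoint [e^s / 2], which suits
   the mean value inequality. *)
have := @real_mean_value_ineq R (fun s => P s - expR s / 2) (fun s => rate r x s - expR s / 2)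
  (fun s => expR s / 2) (fun s => expR s / 2) 0 t t0.
have dE (s : R) : is_derive s 1 (fun s => expR s / 2) (expR s / 2).
  have -> : (fun s => expR s / 2) = 2^-1 *: (@expR R) by apply/funext => u; rewrite /= mulrC.
  by apply: is_derive_eq; rewrite /= [RHS]mulrC.
rewrite expR0 => H; suff : `|P t - expR t / 2 - (P 0 - 1 / 2)| <= expR t / 2 - 1 / 2.
  by rewrite ler_norml => /andP[? ?]; apply/andP; split; lra.
apply: H => // s /andP[s0 st].
- exact: is_deriveB (rate_primitive_derive x s0) (dE s).
- have sT : 0 <= s <= T by rewrite s0 (le_trans st).
  have h1 : 0 <= rate r x s by exact: expR_ge0.
  have h2 : rate r x s <= expR s.
    rewrite ler_expR clamp_id// gerBl; apply: conv_ge0; exact: r_path.1.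
  by rewrite ler_norml; apply/andP; split; lra.
Qed.

Lemma measurable_rate s : measurable_fun setT (fun x => rate r x s).
Proof.
apply: measurableT_comp; first exact: measurable_expR.
by apply: measurable_funB => //; apply: measurable_conv; exact: path_clamp.
Qed.

Lemma measurable_rate_primitive t : 0 <= t ->
  measurable_fun setT (fun x => rate_primitive r x t - rate_primitive r x 0).
Proof.
move=> t0.
apply: (measurable_fun_cvg (h := fun n x => \sum_(i < n.+1) t / n.+1%:R * rate r x (t / n.+1%:R * i%:R))) => //.
  move=> n; apply: measurable_sum => i; apply: measurable_funM => //; exact: measurable_rate.
move=> x _; apply/cvgrPdist_le => e e0.
exists (Num.truncn (K * t ^+ 2 / e)) => // n /= Nn.
have := riemann_sum_error n t0 K_ge0 (rate_primitive_derive x) (rate_lip x).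
move=> /le_trans; apply; rewrite ler_pdivrMr ?ltr0n// [leRHS]mulrC -ler_pdivrMr//.
apply: ltW; apply: lt_le_trans (truncnS_gt _) _; by rewrite ler_nat ltnS.
Qed.

Lemma picard_derive x (t : R) : 0 <= t <= T ->
  is_derive t 1 (picard r ^~ x) (- picard r t x + z * expR (- conv (r t) x)).
Proof.
move=> /[dup] tI /andP[t0 tT]; set P := rate_primitive r x.
have dP : is_derive t 1 P (rate r x t) := rate_primitive_derive x t0.
have dN : is_derive t 1 (fun s => expR (- s)) (- expR (- t)).
  by apply: is_derive_eq; rewrite mulrN1.
have dF : is_derive t 1 (fun s => r0 x + z * (P s - P 0)) (z * rate r x t).
  have -> : (fun s => r0 x + z * (P s - P 0)) = cst (r0 x - z * P 0) + z *: P.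
    apply/funext => s; rewrite !fctE /cst/= /GRing.scale/=; ring.
  apply: (is_derive_eq (is_deriveD (is_derive_cst _ _ _) (is_deriveZ z dP))).
  exact: add0r.
apply: (is_derive_eq (is_deriveM dN dF)).
rewrite /rate clamp_id//= /picard -/P [expR (t - _)]expRD /GRing.scale/=.
have -> : expR (- t) * (z * (expR t * expR (- conv (r t) x))) =
  (expR t * expR (- t)) * (z * expR (- conv (r t) x)) by ring.
by rewrite expRxMexpNx_1 mul1r addrC; congr (_ + _); ring.
Qed.

(** Since [z <= m], the value is at most [e^-t * m + (1 - e^-t) * m]. *)
Lemma picard_itv x t : 0 <= t <= T -> 0 <= picard r t x <= m.
Proof.
move=> tI; have /andP[P0 P1] := rate_primitive_itv x tI.
rewrite /picard; set X := _ - _ in P0 P1 *.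
have /andP[r1 r2] := r0_itv x.
have h1 : z * X <= m * (expR t - 1) by apply: ler_pM => //; exact: ltW.
have h2 : 0 <= z * X by rewrite mulr_ge0// ltW.
rewrite mulr_ge0 ?expR_ge0 ?addr_ge0//=.
apply: (le_trans (y := expR (- t) * (m * expR t))).
  by rewrite ler_wpM2l ?expR_ge0//; lra.
by rewrite mulrCA mulrC [X in X * _]mulrC expRxMexpNx_1 mul1r.
Qed.

Lemma picard_path : density_path (picard r).
Proof.
split=> [t tI|].
  split; last by move=> x; exact: picard_itv.
  have /andP[t0 _] := tI; apply: measurable_funM => //; apply: measurable_funD => //.
  by apply: measurable_funM => //; exact: measurable_rate_primitive.
have H s t x : 0 <= s <= T -> 0 <= t <= T -> s <= t -> `|picard r t x - picard r s x| <= m * (t - s).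
  move=> /andP[s0 sT] /andP[t0 tT] st; rewrite mulrBr.
  apply: (@real_mean_value_ineq R (fun u => picard r u x) (fun u => - picard r u x + z * expR (- conv (r u) x))
     (fun s => m * s) (fun=> m) s t st).
  - move=> u /andP[su ut]; apply: picard_derive; rewrite (le_trans s0 su)/=.
    exact: le_trans tT.
  - by move=> u _; apply: is_derive_eq; rewrite -[RHS]mulr1.
  - move=> u /andP[su ut]; have uI : 0 <= u <= T.
      by rewrite (le_trans s0 su)/=; exact: le_trans tT.
    have /andP[h1 h2] := picard_itv x uI.
    have h3 : 0 <= z * expR (- conv (r u) x) by rewrite mulr_ge0 ?expR_ge0// ltW.
    have h4 : z * expR (- conv (r u) x) <= m * 1.
      apply: ler_pM; rewrite ?expR_ge0 ?(ltW z_gt0)//.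
      by rewrite -expR0 ler_expR oppr_le0; apply: conv_ge0; exact: r_path.1.
    by rewrite ler_norml; apply/andP; split; lra.
move=> s t x sI tI; case: (leP t s) => st.
  by rewrite [in leRHS]ger0_norm ?subr_ge0//; exact: H.
by rewrite distrC [in leRHS]distrC [in leRHS]ger0_norm ?subr_ge0 ?(ltW st)//; apply: H => //; exact: ltW.
Qed.

End one_path.

(* In the norm [sup_t e^{- lam t} |.|] the Picard map contracts by a factor [1/2]. *)
Let lam := 2 * (z * expR T * Phi) + 1.
Let lam_gt0 : 0 < lam.
Proof. by rewrite ltr_wpDl// !mulr_ge0 ?expR_ge0// ltW. Qed.

(** Integrating [e^(lam s)] gains [1 / lam], and [lam] exceeds twice the constant [z * e^T * Phi]
    with which [z * rate] depends on the path. *)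
Lemma picard_contraction r q A : density_path r -> density_path q ->
  (forall t x, 0 <= t <= T -> `|r t x - q t x| <= A * expR (lam * t)) ->
  forall t x, 0 <= t <= T -> `|picard r t x - picard q t x| <= A / 2 * expR (lam * t).
Proof.
move=> rp qp H t x tI; have [t0 tT] := andP tI.
have A0 : 0 <= A.
  have T00 : 0 <= (0 : R) <= T by rewrite lexx.
  by have := le_trans (normr_ge0 _) (H 0 x T00); rewrite mulr0 expR0 mulr1.
set P := rate_primitive r x; set Q := rate_primitive q x.
pose c := expR T * Phi * A.
have c0 : 0 <= c by rewrite !mulr_ge0 ?expR_ge0.
have h : `|(P t - Q t) - (P 0 - Q 0)| <= c / lam * expR (lam * t) - c / lam * expR (lam * 0).
  apply: (@real_mean_value_ineq R (fun s => P s - Q s) (fun s => rate r x s - rate q x s)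
    (fun s => c / lam * expR (lam * s)) (fun s => c * expR (lam * s))) => //.
  - move=> s /andP[s0 _].
    exact: is_deriveB (rate_primitive_derive rp x s0) (rate_primitive_derive qp x s0).
  - move=> s _; apply: is_derive_eq.
    rewrite /GRing.scale/= mulr1; field; exact: lt0r_neq0.
  - move=> s /andP[s0 st]; have sI : 0 <= s <= T by rewrite s0 (le_trans st).
    apply: le_trans (expR_lip (rate_exponent_le rp x s) (rate_exponent_le qp x s)) _.
    rewrite clamp_id// /c -!mulrA ler_wpM2l ?expR_ge0//.
    have -> : s - conv (r s) x - (s - conv (q s) x) = - (conv (r s) x - conv (q s) x) by ring.
    rewrite normrN mulrC; apply: conv_dist; [exact: rp.1|exact: qp.1|].
    by move=> y; exact: H.
rewrite /picard -/P -/Q -mulrBr normrM (ger0_norm (expR_ge0 _)).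
have -> : r0 x + z * (P t - P 0) - (r0 x + z * (Q t - Q 0)) = z * ((P t - Q t) - (P 0 - Q 0)) by ring.
rewrite normrM (gtr0_norm z_gt0).
apply: (le_trans (y := 1 * (z * (c / lam * expR (lam * t))))).
  apply: ler_pM; rewrite ?expR_ge0 ?mulr_ge0 ?(ltW z_gt0)//.
    by rewrite -expR0 ler_expR oppr_le0.
  rewrite ler_wpM2l ?(ltW z_gt0)//; apply: le_trans h _.
  by rewrite gerBl mulr_ge0 ?expR_ge0// divr_ge0// ltW.
have -> : 1 * (z * (c / lam * expR (lam * t))) = z * c / lam * expR (lam * t) by ring.
rewrite ler_wpM2r ?expR_ge0// ler_pdivrMr//.
have -> : z * c = A / 2 * (2 * (z * expR T * Phi)) by rewrite /c; field.
by rewrite ler_wpM2l ?divr_ge0// lerDl.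
Qed.

Theorem vlasov_equation_solution : exists rho, [/\ density_path rho,
  forall x, rho 0 x = r0 x &
  forall (t : R) x, 0 <= t <= T -> is_derive t 1 (rho ^~ x) (vlasov_rhs z phi (rho t) x)].
Proof.
pose u n := iter n picard (fun=> r0).
have up n : density_path (u n).
  elim: n => [|n IH]; last exact: picard_path.
  by split=> [t _|s t x _ _]; [split|rewrite subrr normr0 mulr_ge0// ltW].
have e1 t : 0 <= t -> 1 <= expR (lam * t).
  by move=> t0; rewrite -expR0 ler_expR mulr_ge0// ltW.
have ud n t x : 0 <= t <= T -> `|u n.+1 t x - u n t x| <= m * expR (lam * t) * 2^-1 ^+ n.
  suff H : forall t x, 0 <= t <= T -> `|u n.+1 t x - u n t x| <= m * 2^-1 ^+ n * expR (lam * t).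
    by move=> /H h; rewrite mulrAC.
  elim: n {t x} => [|n IH] t x tI.
    rewrite expr0 mulr1; apply: (le_trans (y := m * 1)).
      have [_ /(_ x)/andP[h1 h2]] := (up 1).1 t tI; have [_ /(_ x)/andP[h3 h4]] := (up 0).1 t tI.
      by rewrite ler_norml; apply/andP; split; lra.
    by have /andP[t0 _] := tI; rewrite ler_wpM2l ?(ltW m_gt0)// e1.
  have := picard_contraction (up n.+1) (up n) IH x tI.
  by rewrite exprSr mulrA.
have /choice[rho0 H0] : forall tx : R * E, exists L, 0 <= tx.1 <= T ->
    forall n, `|u n tx.1 tx.2 - L| <= 2 * (m * expR (lam * tx.1)) * 2^-1 ^+ n.
  move=> [t x] /=; have [tI|tI] := boolP (0 <= t <= T); last by exists 0.
  have D0 : 0 <= m * expR (lam * t) by rewrite mulr_ge0 ?expR_ge0// ltW.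
  by have [L HL] := geometric_limit D0 (fun n => ud n t x tI); exists L.
pose rho t x := rho0 (t, x).
have close n t x : 0 <= t <= T -> `|u n t x - rho t x| <= 2 * m * 2^-1 ^+ n * expR (lam * t).
  by move=> tI; have := H0 (t, x) tI n; rewrite !mulrA mulrAC.
have q0 : 0 <= 2^-1 :> R by [].
have q1 : 2^-1 < 1 :> R by lra.
have small e : 0 < e -> exists n, forall t x, 0 <= t <= T -> `|u n t x - rho t x| <= e.
  move=> e0; have D0 : 0 <= 2 * m * expR (lam * T) by rewrite !mulr_ge0 ?expR_ge0// ltW.
  have [n Hn] := geometric_small q0 q1 D0 e0; exists n => t x /[dup] tI /andP[t0 tT].
  apply: le_trans (close n t x tI) _; apply: le_trans Hn.
  rewrite mulrAC ler_wpM2r ?exprn_ge0// ler_wpM2l ?mulr_ge0 ?(ltW m_gt0)//.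
  by rewrite ler_expR ler_wpM2l// ltW.
have rp : density_path rho.
  split=> [t tI|s t x sI tI].
    split.
      apply: (measurable_fun_cvg (h := fun n => u n t)) => //.
        by move=> n; have [] := (up n).1 t tI.
      move=> x _; apply/cvgrPdist_le => e e0.
      have D0 : 0 <= 2 * m * expR (lam * t) by rewrite !mulr_ge0 ?expR_ge0// ltW.
      have [N HN] := geometric_small q0 q1 D0 e0; exists N => // n /= Nn.
      rewrite distrC; apply: le_trans (close n t x tI) _; apply: le_trans HN.
      by rewrite mulrAC ler_wpM2l// ler_wiXn2l// ltW.
    move=> x; apply/andP; split; apply/ler_addgt0Pr => e e0;
      have [n /(_ t x tI)] := small e e0; have [_ /(_ x)/andP[h1 h2]] := (up n).1 t tI;
      rewrite ler_norml => /andP[? ?]; lra.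
  apply/ler_addgt0Pr => e e0; have e2 : 0 < e / 2 by rewrite divr_gt0.
  have [n Hn] := small _ e2; have := (up n).2 s t x sI tI; have := Hn s x sI; have := Hn t x tI.
  have -> : rho s x - rho t x = (u n s x - u n t x) - (u n s x - rho s x) + (u n t x - rho t x) by ring.
  move=> ? ? ?; apply: le_trans (ler_normD _ _) _.
  have := ler_normB (u n s x - u n t x) (u n s x - rho s x); lra.
(* [u n.+1] is close to [rho] by convergence and to [picard rho] by contraction. *)
have fixed t x : 0 <= t <= T -> picard rho t x = rho t x.
  move=> tI; apply/eqP; rewrite -subr_eq0 -normr_le0; apply/ler_addgt0Pr => e e0; rewrite add0r.
  have D0 : 0 <= 2 * m * expR (lam * t) by rewrite !mulr_ge0 ?expR_ge0// ltW.
  have [n Hn] := geometric_small q0 q1 D0 e0.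
  have h1 := picard_contraction (up n) rp (close n) x tI.
  have h2 := close n.+1 t x tI; rewrite exprS in h2.
  rewrite (_ : u n.+1 t x = picard (u n) t x)// in h2.
  move: h1 h2 Hn; move: (2^-1 ^+ n) (expR _) (picard (u n) t x) (picard rho t x) (rho t x).
  move=> y X a b c h1 h2 Hn.
  have -> : b - c = (a - c) - (a - b) by ring.
  apply: le_trans (ler_normB _ _) _; apply: le_trans (lerD h2 h1) _; apply: le_trans Hn.
  by rewrite le_eqVlt; apply/orP; left; apply/eqP; field.
(* [picard rho] agrees with [rho] on [[0, T]] and, by its formula, continues beyond the endpoints,
   so that two-sided derivatives exist there. *)
exists (picard rho); split.
- exact: picard_path.
- by move=> x; rewrite /picard subrr mulr0 addr0 oppr0 expR0 mul1r.
- move=> t x tI; have := picard_derive rp x tI.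
  have -> : rho t = picard rho t by apply/funext => y; rewrite fixed.
  by [].
Qed.

End vlasov_equation.

(** * Exponential functionals under the Vlasov generator *)

Section exponential_functionals.
Context (R : realType) (d : nat).
Local Notation E := (Rd R d).
Local Notation C := R[i].
Local Notation mu := (lebesgue_Rd R d).
Local Notation L1 := (@L1 R d).

Definition pairing (g : E -> R) (th : E -> C) : C := Cintegral (fun x => (g x)%:C * th x).

Lemma L1_pairing (g : E -> R) (K : R) th : measurable_fun setT g -> (forall x, `|g x| <= K) ->
  L1 th -> L1 (fun x => (g x)%:C * th x).
Proof.
move=> mg gK Lt; apply: L1_le (rintZ K (L1_int Lt)) _.
  by apply: cmeasM; [exact: cmeas_real|exact: L1_cmeas].
by apply: aeW => x; rewrite normcM normcR ler_wpM2r ?normc_ge0.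
Qed.

Lemma pairing_le (g : E -> R) (K : R) th : measurable_fun setT g -> (forall x, `|g x| <= K) ->
  L1 th -> normc (pairing g th) <= K * L1norm th.
Proof.
move=> mg gK Lt; have Lg := L1_pairing mg gK Lt.
apply: le_trans (normc_Cintegral Lg) _.
have -> : K * L1norm th = \int[mu]_x (K * normc (th x)).
  by rewrite RintegralZl// -?L1normE//; exact: L1_int.
apply: L1norm_le => //; first exact/rintZ/L1_int.
by apply: aeW => x; rewrite normcM normcR ler_wpM2r ?normc_ge0.
Qed.

Lemma pairing_lin (g : E -> R) (K : R) f h c : measurable_fun setT g -> (forall x, `|g x| <= K) ->
  L1 f -> L1 h -> pairing g (fun x => f x + c * h x) = pairing g f + c * pairing g h.
Proof.
move=> mg gK Lf Lh; have L1f := L1_pairing mg gK Lf; have L1h := L1_pairing mg gK Lh.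
rewrite /pairing -CintegralZ// -CintegralD//; last exact: L1Z.
by congr Cintegral; apply/funext => x; ring.
Qed.

Lemma pairing_linl (g1 g2 : E -> R) (K1 K2 a : R) th :
  measurable_fun setT g1 -> (forall x, `|g1 x| <= K1) ->
  measurable_fun setT g2 -> (forall x, `|g2 x| <= K2) -> L1 th ->
  pairing (fun x => g1 x + a * g2 x) th = pairing g1 th + a%:C * pairing g2 th.
Proof.
move=> m1 k1 m2 k2 Lt; have L1' := L1_pairing m1 k1 Lt; have L2' := L1_pairing m2 k2 Lt.
rewrite /pairing -CintegralZ// -CintegralD//; last exact: L1Z.
by congr Cintegral; apply/funext => x; rewrite rmorphD rmorphM; ring.
Qed.

Lemma pairing_real (g f : E -> R) : pairing g (fun x => (f x)%:C) = (\int[mu]_x (g x * f x))%:C.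
Proof.
rewrite /pairing /Cintegral.
under eq_Rintegral do rewrite -rmorphM/=.
under [X in _ +i* X]eq_Rintegral do rewrite -rmorphM/=.
congr (_ +i* _); rewrite /Rintegral; under eq_integral do [].
by rewrite integral0.
Qed.

Variables (m : R) (r : E -> R).
Hypothesis r_bd : bounded_density m r.

Let r_meas : measurable_fun setT r. Proof. by case: r_bd. Qed.
Let r_norm x : `|r x| <= m.
Proof. by have [_ /(_ x)/andP[h1 h2]] := r_bd; rewrite ger0_norm. Qed.

Lemma exp_functional_line f h w : L1 f -> L1 h ->
  exp_functional r (line f h w) = Cexp (pairing r f + w * pairing r h).
Proof. by move=> Lf Lh; rewrite /exp_functional -(pairing_lin w r_meas r_norm Lf Lh). Qed.

Lemma cdiff_exp_functional_line f h w : L1 f -> L1 h ->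
  cdiff (fun w => exp_functional r (line f h w)) w (exp_functional r (line f h w) * pairing r h).
Proof.
move=> Lf Lh; have -> : (fun w => exp_functional r (line f h w)) =
    (fun w => Cexp (pairing r f + w * pairing r h)).
  by apply/funext => v; rewrite exp_functional_line.
rewrite exp_functional_line//.
apply: (cdiff_comp (f := @Cexp R) (g := fun w => pairing r f + w * pairing r h)).
  exact: cdiff_affine.
exact: cdiff_Cexp.
Qed.

Lemma exp_functional_Ebound al : m <= al^-1 -> Ebound al (exp_functional r) 1.
Proof.
move=> mal th Lt; rewrite mul1r normc_Cexp ler_expR.
apply: le_trans (ler_norm _) _; apply: le_trans (normc_Re _) _.
apply: le_trans (pairing_le r_meas r_norm Lt) _.
by rewrite ler_wpM2r ?L1norm_ge0.
Qed.

Lemma exp_functional_entire al : 0 < al -> m <= al^-1 -> entire (exp_functional r).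
Proof.
move=> a0 mal; split.
- move=> f h Lf Lh fh; congr Cexp; apply: Cintegral_ae.
  + exact: L1_pairing r_norm _.
  + exact: L1_pairing r_norm _.
  + by apply: filterS fh => x /(_ I) ->.
- exact: (entire_locally_bounded a0 (exp_functional_Ebound mal)).
- move=> f h Lf Lh w; apply/derivable_cdiff; eexists; exact: cdiff_exp_functional_line.
Qed.

Lemma vder_exp_functional f h : L1 f -> L1 h ->
  vder (exp_functional r) f h = exp_functional r f * pairing r h.
Proof.
by move=> Lf Lh; apply: cder_val; have := cdiff_exp_functional_line 0 Lf Lh; rewrite line0.
Qed.

Variables (z : R) (phi : E -> \bar R).
Hypothesis z_gt0 : 0 < z.
Hypothesis phi_meas : measurable_fun setT phi.
Hypothesis phi_ge0 : forall x, (0 <= phi x)%E.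
Hypothesis phi_int : mu.-integrable setT phi.

Let ok := kernel_ok_V phi_meas phi_ge0 phi_int.
Let Phi_ge0 : 0 <= phinorm phi. Proof. exact: phinorm_ge0. Qed.

Lemma boltzmann_conv_itv x : 0 <= expR (- convolution phi r x) <= 1.
Proof.
rewrite expR_ge0 -expR0 ler_expR oppr_le0.
exact: (conv_ge0 phi_ge0 x r_bd).
Qed.

Lemma measurable_boltzmann_conv : measurable_fun setT (fun x => expR (- convolution phi r x)).
Proof.
apply: measurableT_comp; first exact: measurable_expR.
by apply: measurableT_comp => //; exact: (measurable_conv phi_meas phi_ge0 r_bd).
Qed.

(** The exponential turns the translation by [- phi (x - .)] into the factor [e^(- (r * phi)(x))],
    the nonlinearity of the kinetic equation. *)
Lemma exp_functional_shift th x : L1 th ->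
  exp_functional r (affine_kernel (fun _ _ => 1) (fun x y => - phi_at phi x y) th x) =
  exp_functional r th * (expR (- convolution phi r x))%:C.
Proof.
move=> Lt; have Lp : L1 (fun y => (phi_at phi x y)%:C) by apply: L1_real; exact: rint_phi_at.
have -> : affine_kernel (fun _ _ => 1) (fun x y => - phi_at phi x y) th x =
    (fun y => th y + -1 * (phi_at phi x y)%:C).
  by apply/funext => y; rewrite /affine_kernel rmorph1 mulr1 mulN1r rmorphN.
rewrite /exp_functional -/(pairing _ _) (pairing_lin _ r_meas r_norm Lt Lp) CexpD; congr (_ * _).
rewrite pairing_real mulN1r -rmorphN.
by rewrite /Cexp/= cos0 sin0 mulr1 mulr0.
Qed.

(** Both terms of the generator are the exponential times a functional linear in [th], so the
    evolution equation becomes an equation for the exponent. *)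
Lemma Lgen_exp_functional al th : 0 < al -> m <= al^-1 -> L1 th ->
  Lgen z (fun _ _ => 1) (fun x y => - phi_at phi x y) (exp_functional r) th =
  exp_functional r th * pairing (vlasov_rhs z phi r) th.
Proof.
move=> a0 mal Lt.
have eB := exp_functional_entire a0 mal; have bB := exp_functional_Ebound mal.
rewrite (LgenE z ok a0 eB bB Lt) vder_exp_functional//.
have mN : measurable_fun setT (fun x => - r x) by exact: measurableT_comp.
have bN x : `|- r x| <= m by rewrite normrN.
have be x : `|expR (- convolution phi r x)| <= 1.
  by have /andP[? ?] := boltzmann_conv_itv x; rewrite ger0_norm.
have -> : pairing (vlasov_rhs z phi r) th = - pairing r th +
    z%:C * pairing (fun x => expR (- convolution phi r x)) th.
  rewrite (pairing_linl z mN bN measurable_boltzmann_conv be Lt); congr (_ + _).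
  rewrite -mulN1r -CintegralZ; last exact: (L1_pairing r_meas r_norm Lt).
  by congr Cintegral; apply/funext => x; rewrite rmorphN; ring.
have -> : Cintegral (fun x => th x * exp_functional r (affine_kernel (fun _ _ => 1)
     (fun x y => - phi_at phi x y) th x)) =
   exp_functional r th * pairing (fun x => expR (- convolution phi r x)) th.
  rewrite -CintegralZ; last exact: (L1_pairing measurable_boltzmann_conv be Lt).
  by congr Cintegral; apply/funext => x; rewrite exp_functional_shift//; ring.
ring.
Qed.

End exponential_functionals.

(** * The exponential solution of the Vlasov evolution *)

Section vlasov_exponential_solution.
Context (R : realType) (d : nat).
Local Notation E := (Rd R d).
Local Notation C := R[i].
Local Notation mu := (lebesgue_Rd R d).
Local Notation L1 := (@L1 R d).
Variables (z : R) (phi : E -> \bar R).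
Hypothesis z_gt0 : 0 < z.
Hypothesis phi_meas : measurable_fun setT phi.
Hypothesis phi_ge0 : forall x, (0 <= phi x)%E.
Hypothesis phi_int : mu.-integrable setT phi.
Variables (T m : R) (rho : R -> E -> R).
Hypothesis m_gt0 : 0 < m.
Hypothesis rho_path : density_path T m rho.
Hypothesis rho_eq : forall (t : R) x, 0 <= t <= T ->
  is_derive t 1 (rho ^~ x) (vlasov_rhs z phi (rho t) x).

Local Notation Phi := (phinorm phi).
Local Notation rhs t := (vlasov_rhs z phi (rho t)).
Let Phi_ge0 : 0 <= Phi. Proof. exact: phinorm_ge0. Qed.

(** The Lipschitz constant in time of the right-hand side: [m] from [rho] itself, [z * m * Phi] from
    the convolution, [e^-u] being 1-Lipschitz for [u >= 0]. *)
Let K := m + z * (m * Phi).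
Let K_ge0 : 0 <= K.
Proof. by rewrite addr_ge0 ?mulr_ge0// ltW. Qed.

Lemma vlasov_rhs_lip s t x : 0 <= s <= T -> 0 <= t <= T ->
  `|rhs s x - rhs t x| <= K * `|s - t|.
Proof.
move=> sI tI; have bs := rho_path.1 s sI; have bt := rho_path.1 t tI.
have h1 := rho_path.2 s t x sI tI.
have h2 : `|convolution phi (rho s) x - convolution phi (rho t) x| <= m * `|s - t| * Phi.
  by apply: (conv_dist phi_meas phi_ge0 phi_int x bs bt) => y; exact: rho_path.2.
have c1 : - convolution phi (rho s) x <= 0 by rewrite oppr_le0; exact: (conv_ge0 phi_ge0 x bs).
have c2 : - convolution phi (rho t) x <= 0 by rewrite oppr_le0; exact: (conv_ge0 phi_ge0 x bt).
have := expR_lip c1 c2; rewrite expR0 mul1r -opprD normrN => h3.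
rewrite /vlasov_rhs.
set a := expR _ in h3 *; set b := expR _ in h3 *.
have -> : - rho s x + z * a - (- rho t x + z * b) = z * (a - b) - (rho s x - rho t x) by ring.
apply: le_trans (ler_normB _ _) _; rewrite normrM (gtr0_norm z_gt0).
have := ler_wpM2l (ltW z_gt0) (le_trans h3 h2); rewrite /K; lra.
Qed.

(** The remainder is uniform in [x], so it can be integrated against [th]; this differentiates the
    pairing in time. *)
Lemma density_taylor s t x : 0 <= s <= T -> 0 <= t <= T ->
  `|rho s x - rho t x - (s - t) * rhs t x| <= K * (s - t) ^+ 2.
Proof.
have H a b c : 0 <= a -> a <= b -> b <= T -> a <= c <= b ->
    `|(rho b x - b * rhs c x) - (rho a x - a * rhs c x)| <= K * (b - a) ^+ 2.
  move=> a0 ab bT /andP[ac cb].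
  have inI u : a <= u <= b -> 0 <= u <= T.
    by move=> /andP[h1 h2]; rewrite (le_trans a0 h1) (le_trans h2).
  have -> : K * (b - a) ^+ 2 = K * (b - a) * b - K * (b - a) * a by ring.
  apply: (@real_mean_value_ineq R (fun u => rho u x - u * rhs c x) (fun u => rhs u x - rhs c x)
    (fun u => K * (b - a) * u) (fun=> K * (b - a)) a b ab).
  - move=> u uI; have d2 : is_derive u 1 (fun s => s * rhs c x) (rhs c x).
      have -> : (fun s => s * rhs c x) = rhs c x *: id by apply/funext => v; rewrite /= mulrC.
      by apply: is_derive_eq; rewrite -[RHS]mulr1.
    exact: is_deriveB (rho_eq x (inI u uI)) d2.
  - by move=> u _; apply: is_derive_eq; rewrite -[RHS]mulr1.
  - move=> u /[dup] /inI uI /andP[au ub]; have cI : 0 <= c <= T by apply: inI; rewrite ac.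
    apply: le_trans (vlasov_rhs_lip x uI cI) _; rewrite ler_wpM2l// ler_norml.
    by apply/andP; split; lra.
move=> /andP[s0 sT] /andP[t0 tT]; case: (leP t s) => st.
  have := H t s t t0 st sT; rewrite lexx st => /(_ isT).
  by congr (`|_| <= _); ring.
have := H s t t s0 (ltW st) tT; rewrite lexx (ltW st) => /(_ isT).
by rewrite -normrN => h; apply: le_trans (le_trans _ h) _;
  rewrite le_eqVlt; apply/orP; left; apply/eqP; [congr `|_|; ring|ring].
Qed.

Lemma measurable_vlasov_rhs t : 0 <= t <= T -> measurable_fun setT (rhs t).
Proof.
move=> tI; have bt := rho_path.1 t tI; have [mt _] := bt.
apply: measurable_funD; first exact: measurableT_comp.
by apply: measurable_funM => //; exact: (measurable_boltzmann_conv bt phi_meas phi_ge0).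
Qed.

Lemma vlasov_rhs_bounded t x : 0 <= t <= T -> `|rhs t x| <= m + z.
Proof.
move=> tI; have bt := rho_path.1 t tI; have [_ /(_ x)/andP[h1 h2]] := bt.
have /andP[h3 h4] := boltzmann_conv_itv bt phi_ge0 x.
apply: le_trans (ler_normD _ _) _; rewrite normrN normrM (gtr0_norm z_gt0) !ger0_norm//.
by apply: lerD => //; rewrite ler_piMr// ltW.
Qed.

Let rho_norm t x : 0 <= t <= T -> `|rho t x| <= m.
Proof. by move=> /(rho_path.1 t)[_ /(_ x)/andP[h1 h2]]; rewrite ger0_norm. Qed.

Lemma pairing_taylor s t th : L1 th -> 0 <= s <= T -> 0 <= t <= T ->
  normc (pairing (rho s) th - pairing (rho t) th - pairing (rhs t) th * (s - t)%:C) <=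
  K * (s - t) ^+ 2 * L1norm th.
Proof.
move=> Lt sI tI; have [ms _] := rho_path.1 s sI; have [mt _] := rho_path.1 t tI.
have mr := measurable_vlasov_rhs tI.
have ns x := rho_norm x sI; have nt x := rho_norm x tI; have nr x := vlasov_rhs_bounded x tI.
have m1 : measurable_fun setT (fun x => rho s x + -1 * rho t x).
  by apply: measurable_funD => //; exact: measurable_funM.
have n1 x : `|rho s x + -1 * rho t x| <= m + m.
  by apply: le_trans (ler_normD _ _) _; rewrite mulN1r normrN lerD.
have -> : pairing (rho s) th - pairing (rho t) th - pairing (rhs t) th * (s - t)%:C =
    pairing (fun x => rho s x + -1 * rho t x + - (s - t) * rhs t x) th.
  rewrite (pairing_linl _ m1 n1 mr nr Lt) (pairing_linl _ ms ns mt nt Lt) rmorphN1 rmorphN.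
  by ring.
apply: pairing_le => //.
  by apply: measurable_funD => //; exact: measurable_funM.
by move=> x; rewrite mulN1r mulNr; exact: density_taylor.
Qed.

Lemma pairing_lip s t th : L1 th -> 0 <= s <= T -> 0 <= t <= T ->
  normc (pairing (rho s) th - pairing (rho t) th) <= m * `|s - t| * L1norm th.
Proof.
move=> Lt sI tI; have [ms _] := rho_path.1 s sI; have [mt _] := rho_path.1 t tI.
have ns x := rho_norm x sI; have nt x := rho_norm x tI.
have := pairing_linl (-1) ms ns mt nt Lt; rewrite rmorphN1 mulN1r => <-.
apply: pairing_le => //.
  by apply: measurable_funD => //; exact: measurable_funM.
by move=> x; rewrite mulN1r; exact: rho_path.2.
Qed.

Lemma rdiff_pairing t th : L1 th -> 0 < t < T ->
  rdiff (fun s => pairing (rho s) th) t (pairing (rhs t) th).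
Proof.
move=> Lt /andP[t0 tT]; apply/rdiff_epsP => e e0.
pose D := K * L1norm th + 1; have D0 : 0 < D by rewrite ltr_wpDl// mulr_ge0// L1norm_ge0.
exists (Num.min (e / D) (Num.min t (T - t))) => [|h].
  by rewrite !lt_min divr_gt0//= t0 subr_gt0.
rewrite !lt_min => /and3P[h1 h2 h3].
have hI : 0 <= t + h <= T.
  by move: h2 h3; rewrite !ltr_norml => /andP[? ?] /andP[? ?]; apply/andP; split; lra.
have tI : 0 <= t <= T by rewrite !ltW.
have := pairing_taylor Lt hI tI; rewrite (_ : t + h - t = h); last by ring.
move=> /le_trans; apply.
rewrite -[h ^+ 2]ger0_norm ?sqr_ge0// normrX expr2.
have hD : `|h| * D <= e by rewrite -ler_pdivlMr// ltW.
apply: (le_trans (y := `|h| * D * `|h|)); last by rewrite ler_wpM2r.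
have -> : K * (`|h| * `|h|) * L1norm th = `|h| * (K * L1norm th) * `|h| by ring.
by rewrite ler_wpM2r// ler_wpM2l// lerDl.
Qed.

Lemma exp_functional_solution al B0 : 0 < al -> m <= al^-1 ->
  (forall th, L1 th -> B0 th = exp_functional (rho 0) th) ->
  pointwise_solution (Lgen z (fun _ _ => 1) (fun x y => - phi_at phi x y)) al T B0
    (fun t => exp_functional (rho t)).
Proof.
move=> a0 mal B0E; have incl t T1 : T1 < T -> 0 <= t <= T1 -> 0 <= t <= T.
  by move=> h /andP[-> h']; rewrite (le_trans h')// ltW.
split.
- move=> t /andP[t0 tT]; apply: exp_functional_entire a0 mal; apply: rho_path.1.
  by rewrite t0 ltW.
- move=> T1 _ T1T; exists 1 => t tI; apply: exp_functional_Ebound mal.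
  by apply: rho_path.1; exact: incl tI.
- move=> th T1 Lt _ T1T; apply: ccont_on_dist => t; rewrite in_itv/= => /(incl _ _ T1T) tI e e0.
  have [r r0 Hr] := cdiff_continuous (cdiff_Cexp (pairing (rho t) th)) e0.
  pose D := m * L1norm th + 1.
  have D0 : 0 < D by rewrite ltr_wpDl// mulr_ge0 ?L1norm_ge0// ltW.
  exists (r / D) => [|s]; first by rewrite divr_gt0.
  rewrite in_itv/= => /(incl _ _ T1T) sI st.
  have := Hr (pairing (rho s) th - pairing (rho t) th); rewrite addrCA subrr addr0 => H.
  apply/ltW/H; apply: le_lt_trans (pairing_lip Lt sI tI) _.
  apply: (@le_lt_trans _ _ (`|s - t| * D)); last by rewrite -ltr_pdivlMr.
  by rewrite mulrAC mulrC ler_wpM2l// lerDl.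
- move=> th t Lt tI; have tI' : 0 <= t <= T by case/andP: tI => ? ?; rewrite !ltW.
  rewrite (Lgen_exp_functional (rho_path.1 t tI') z phi_meas phi_ge0 phi_int a0 mal Lt).
  apply: (rdiff_comp (f := @Cexp R)); first exact: rdiff_pairing.
  exact: cdiff_Cexp.
- by move=> th Lt; rewrite B0E.
Qed.

Lemma classical_solution_density (rho0 : E -> R) : {ae mu, forall x, rho 0 x = rho0 x} ->
  classical_solution z phi T rho0 rho.
Proof.
apply: filterS => x x0; split=> //; exists (fun t => rhs t x).
  apply/subspace_continuousP => t; rewrite /= in_itv/= => /andP[t0 tT].
  apply/cvgrPdist_le => e e0.
  suff : nbhs t (fun s => `[0, T[%classic s -> `|rhs t x - rhs s x| <= e) by [].
  have K1 : 0 < K + 1 by rewrite ltr_wpDl.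
  apply/nbhs_ballP; exists (e / (K + 1)) => /=; first by rewrite divr_gt0.
  move=> s; rewrite /ball/= in_itv/= => st /andP[s0 sT].
  have tI : 0 <= t <= T by rewrite t0 ltW.
  have sI : 0 <= s <= T by rewrite s0 ltW.
  apply: le_trans (vlasov_rhs_lip x tI sI) _.
  apply: (le_trans (y := (K + 1) * `|t - s|)); first by rewrite ler_wpM2r// lerDl.
  by rewrite mulrC -ler_pdivlMr// ltW.
move=> t /andP[t0 tT]; split=> //; have tI : 0 <= t <= T by rewrite t0 ltW.
have /is_derive_realP H := rho_eq x tI.
apply/cvgrPdist_le => e e0; have [r r0 Hr] := H e e0.
suff : nbhs t (fun s => s != t -> `[0, T[%classic s ->
    `|rhs t x - (rho s x - rho t x) / (s - t)| <= e) by [].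
apply/nbhs_ballP; exists r => // s; rewrite /ball/= => st snt _.
have s0 : s - t != 0 by rewrite subr_eq0.
have := Hr (s - t); rewrite [in X in X -> _]distrC => /(_ st); rewrite addrCA subrr addr0.
rewrite distrC -ler_pdivrMr ?normr_gt0// -normfV -normrM.
by rewrite mulrBl mulfK// distrC.
Qed.

End vlasov_exponential_solution.

Theorem theorem4p5 (R : realType) (d : nat) (d_gt0 : (0 < d)%N)
    (z : R) (z_gt0 : 0 < z)
    (phi : Rd R d -> \bar R)
    (phi_meas : measurable_fun [set: Rd R d] phi)
    (phi_sym : forall x, x <> Rd0 R d ->
      phi (Rdopp x) = phi x /\ phi x \is a fin_num)
    (phi_ge0 : forall x, (0 <= phi x)%E)
    (phi_int : (lebesgue_Rd R d).-integrable setT phi)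
    (alpha alpha0 : R) (alpha_gt0 : 0 < alpha) (alpha_lt : alpha < alpha0)
    (B0ren : R -> (Rd R d -> R[i]) -> R[i])
    (B0V : (Rd R d -> R[i]) -> R[i])
    (Bren : R -> R -> (Rd R d -> R[i]) -> R[i])
    (BV : R -> (Rd R d -> R[i]) -> R[i])
    (B0ren_in : forall eps, 0 < eps -> Espace alpha0 (B0ren eps))
    (B0V_in : Espace alpha0 B0V) :
  let T := deltaconst z phi alpha alpha0 * (alpha0 - alpha) in
  (forall eps, 0 < eps ->
     local_solution (Lren z phi eps) alpha T (B0ren eps) (Bren eps)) ->
  local_solution (LV z phi) alpha T B0V BV ->
  (('N[lebesgue_Rd R d]_+oo[phi] < +oo)%E ->
     Enorm alpha0 (B0ren eps \- B0V) @[eps --> 0^'+] --> 0%E ->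
     forall t, 0 <= t < T ->
       Enorm alpha (Bren eps t \- BV t) @[eps --> 0^'+] --> 0%E)
  /\
  (forall rho0 : Rd R d -> R,
     rho0 \in Lfun (lebesgue_Rd R d) +oo%E ->
     (\forall x \ae lebesgue_Rd R d, 0 <= rho0 x) ->
     ('N[lebesgue_Rd R d]_+oo[EFin \o rho0] <= (alpha0^-1)%:E)%E ->
     {in @L1 R d, B0V =1 exp_functional rho0} ->
     Num.max alpha0^-1 z < alpha^-1 ->
     exists rho : R -> Rd R d -> R,
       classical_solution z phi T rho0 rho /\
       forall t, 0 <= t < T ->
         [/\ rho t \in Lfun (lebesgue_Rd R d) +oo%E,
             (\forall x \ae lebesgue_Rd R d, 0 <= rho t x),
             ('N[lebesgue_Rd R d]_+oo[EFin \o rho t] <= (alpha^-1)%:E)%E &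
             {in @L1 R d, BV t =1 exp_functional (rho t)}]).
Proof.
move=> T sr sV.
have a0 : 0 < alpha0 by exact: lt_trans alpha_lt.
have TE : T = (alpha0 - alpha) / (expR 1 * Mop z (phinorm phi) alpha alpha0).
  by rewrite /T /deltaconst mulrC.
have pV : pointwise_solution (Lgen z (fun _ _ => 1) (fun x y => - phi_at phi x y)) alpha T B0V BV.
  have := local_solution_pointwise sV.
  by rewrite (_ : LV z phi = Lgen z (fun _ _ => 1) (fun x y => - phi_at phi x y)) //;
    apply/funext => B; exact: LVE.
have ok := kernel_ok_V phi_meas phi_ge0 phi_int.
have Phi0 : 0 <= phinorm phi by exact: phinorm_ge0.
split.
  move=> phi_bd cvg0 t tI; have [c c0 phi_c] := Lnorm_oo_ae_real phi_bd.
  rewrite TE in sr pV tI.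
  apply: (vlasov_limit z_gt0 phi_meas phi_ge0 phi_int phi_c c0 alpha_gt0 alpha_lt B0ren_in B0V_in
    cvg0 _ pV tI).
  (* [Lren] is the corresponding [Lgen] by conversion, whereas [LV] had to be rewritten by [LVE]. *)
  by move=> eps /sr/local_solution_pointwise.
(* [m] dominates the initial density, and the equation cannot push a density above it: where
   [rho = m] the right-hand side is at most [z - m <= 0]. *)
move=> rho0 rho0_Lfun rho0_ge0 rho0_le B0VE; set m := Num.max _ _ => m_lt.
have mal : m <= alpha^-1 := ltW m_lt.
have m1 : alpha0^-1 <= m by rewrite le_max lexx.
have m2 : z <= m by rewrite le_max lexx orbT.
have m0 : 0 < m := lt_le_trans z_gt0 m2.
have T0 : 0 <= T.
  rewrite TE divr_ge0 ?subr_ge0 ?(ltW alpha_lt)// mulr_ge0 ?expR_ge0//.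
  exact/ltW/Mop_gt0.
have rho0_meas : measurable_fun setT rho0 by have /andP[/set_mem] := rho0_Lfun.
(* [rho0] obeys its bounds almost everywhere only; this representative obeys them at every point and
   has the same exponential functional. *)
pose r0 x := clamp m (rho0 x).
have r0_itv x : 0 <= r0 x <= m by apply: clamp_itv; exact: ltW.
have r0_meas : measurable_fun setT r0.
  by apply: measurable_minr => //; exact: measurable_maxr.
have r0E : \forall x \ae lebesgue_Rd R d, r0 x = rho0 x.
  apply: filterS2 rho0_ge0 (Lnorm_oo_ae rho0_le) => x h1 /=.
  rewrite lee_fin => h2; apply: clamp_id; rewrite h1 (le_trans _ m1)//.
  exact: le_trans (ler_norm _) h2.
have [rho [rho_path rho00 rho_eq]] :=
  vlasov_equation_solution z_gt0 phi_meas phi_ge0 phi_int T0 m2 r0_meas r0_itv.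
exists rho; split.
  apply: (classical_solution_density z_gt0 phi_meas phi_ge0 phi_int m0 rho_path rho_eq).
  by apply: filterS r0E => x; rewrite rho00.
have T00 : 0 <= (0 : R) <= T by rewrite lexx.
have B0r th : L1 th -> B0V th = exp_functional (rho 0) th.
  move=> Lt; rewrite (B0VE th (mem_set Lt)) /exp_functional; congr Cexp; apply: Cintegral_ae.
  - apply: L1_le (rintZ m (L1_int Lt)) _.
      by apply: cmeasM; [exact: cmeas_real|exact: L1_cmeas].
    apply: filterS r0E => x <-; rewrite normcM normcR ler_wpM2r ?normc_ge0//.
    by have /andP[? ?] := r0_itv x; rewrite ger0_norm.
  - apply: (L1_pairing (K := m)) => //; first by have [] := rho_path.1 0 T00.
    by move=> x; have [_ /(_ x)/andP[? ?]] := rho_path.1 0 T00; rewrite ger0_norm.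
  - by apply: filterS r0E => x; rewrite rho00 => ->.
have pe := exp_functional_solution z_gt0 phi_meas phi_ge0 phi_int m0 rho_path rho_eq
  alpha_gt0 mal B0r.
have [K HK] := Espace_Ebound B0V_in; have eV : entire B0V by case: B0V_in.
move=> t tI; have tI' : 0 <= t <= T by case/andP: tI => -> /ltW.
have [mt bt] := rho_path.1 t tI'.
have norm_t : ('N[lebesgue_Rd R d]_+oo[EFin \o rho t] <= m%:E)%E.
  apply: Lnorm_oo_le; first exact: ltW.
  by apply: aeW => x /=; have /andP[? ?] := bt x; rewrite lee_fin ger0_norm.
split.
- apply/andP; split; first exact: mem_set.
  by apply: mem_set; exact: le_lt_trans norm_t (ltry _).
- by apply: aeW => x; have /andP[] := bt x.
- by apply: le_trans norm_t _; rewrite lee_fin.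
- move=> th /set_mem Lt; rewrite TE in pV pe tI.
  exact: (pointwise_solution_unique z_gt0 Phi0 ok alpha_gt0 alpha_lt eV HK pV pe tI Lt).
Qed.
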